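(* Let $n>0$ and let $G\le I(S^n)=O(n+1)$ be a subgroup that contains a dense subgroup of the group of orientation-preserving isometries of $S^n$. Then the assembler $\mathcal S^n_G$ of polytopes in $n$-dimensional spherical geometry, with volume function given by spherical volume, is an EA-assembler.
   Context: Geometry. $S^n=\{(x_0,\dots,x_n)\in\mathbb R^{n+1}\mid\sum_{i=0}^nx_i^2=1\}$, with isometry group $I(S^n)=O(n+1)$. A geometric $n$-simplex in $S^n$ is obtained by taking the convex hull of $n+1$ points of $S^n$ in general position (as points of $\mathbb R^{n+1}$), such that the convex hull does not contain the origin, and projecting it to $S^n$ from the origin. An $n$-polytope is a subset of $S^n$ that is a finite union of geometric $n$-simplices (possibly empty). The assembler $\mathcal S^n_G$: objects are $n$-polytopes $P\subseteq S^n$; morphisms $P\to Q$ with $P\neq\varnothing$ are elements $g\in G$ with $g(P)\subseteq Q$, and there is a unique morphism $\varnothing\to Q$. A family of morphisms is a covering family if the union of the images is the target; morphisms with the same target are disjoint if their images have disjoint interiors. A cover of $P$ is a finite pairwise disjoint covering family. Tuples. For an assembler $\mathcal A$, $\mathcal W(\mathcal A)$ is the category whose objects are finite tuples $\mathcal P=(I,\{P_i\}_{i\in I})$ of objects of $\mathcal A$, and whose morphisms $(I,\{P_i\})\to(J,\{Q_j\})$ are maps $\phi\colon I\to J$ with morphisms $f(i)\colon P_i\to Q_{\phi(i)}$ such that $\{f(i)\}_{i\in\phi^{-1}(j)}$ is a cover of $Q_j$ for each $j$; $\sqcup$ is disjoint union of tuples. Two tuples are scissors congruent, $\mathcal P\simeq\mathcal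 Q$, if there is a span $\mathcal P\leftarrow\mathcal R\to\mathcal Q$ in $\mathcal W(\mathcal A)$. EA-assemblers. A volume function on $\mathcal A$ (with values in an ordered abelian group $\mathbf R$; here $\mathbf R=\mathbb R$) is a function $\mathrm{vol}\colon\mathrm{ob}(\mathcal A)\to\mathbf R_{\ge0}$ with $\mathrm{vol}(P)=\sum_i\mathrm{vol}(P_i)$ for every cover $\{P_i\to P\}_{i\in I}$; extend it to tuples by $\mathrm{vol}(\mathcal P)=\sum_i\mathrm{vol}(P_i)$. An EA-assembler is an assembler with a volume function such that: (E) if $\mathrm{vol}(\mathcal P)<\mathrm{vol}(\mathcal Q)$ there is a tuple $\mathcal P'$ with $\mathcal P\sqcup\mathcal P'\simeq\mathcal Q$; (A) given $\mathcal P$ with $\mathrm{vol}(\mathcal P)>0$, every $\mathcal Q$ admits a (finite) cover $\{\mathcal Q_i\}$ (i.e. a morphism $\bigsqcup_i\mathcal Q_i\to\mathcal Q$ in $\mathcal W(\mathcal A)$) with $2\,\mathrm{vol}(\mathcal Q_i)\le\mathrm{vol}(\mathcal P)$ for each $i$. *)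

(* Defs.v *)
From HB Require Import structures.
From mathcomp Require Import all_boot all_order all_algebra.
From mathcomp Require Import all_classical all_reals all_analysis.

Set Implicit Arguments.
Unset Strict Implicit.
Unset Printing Implicit Defensive.

Import Order.TTheory GRing.Theory Num.Theory.
Import numFieldTopology.Exports.

Local Open Scope classical_set_scope.
Local Open Scope ring_scope.

(** * Assemblers *)

(* Only finite covering families are recorded: covers are finite, and the
   topology is the one they generate (see [covering_sieve]). *)
Record assembler_data := AssemblerData {
  ob :> Type;
  hom : ob -> ob -> Type;
  idm : forall P, hom P P;
  comp : forall P Q T, hom Q T -> hom P Q -> hom P T;
  init : ob;
  covering : forall (Q : ob) (I : finType) (P : I -> ob),
    (forall i, hom (P i) Q) -> Prop;
  disj : forall P P' Q : ob, hom P Q -> hom P' Q -> Prop }.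

Section assembler.
Variable A : assembler_data.
Implicit Types P Q T : A.

Definition is_cover Q (I : finType) (P : I -> A) (f : forall i, hom (P i) Q) :=
  covering f /\ (forall i j, i <> j -> disj (f i) (f j)).

Definition is_initial P := forall Q, exists! f : hom P Q, True.

Definition monic P Q (f : hom P Q) :=
  forall T (a b : hom T P), comp f a = comp f b -> a = b.

Definition is_pullback P P' Q (f : hom P Q) (g : hom P' Q)
    T (p : hom T P) (q : hom T P') :=
  comp f p = comp g q /\
  forall X (a : hom X P) (b : hom X P'), comp f a = comp g b ->
    exists! u : hom X T, comp p u = a /\ comp q u = b.

Definition sieve Q := forall P, hom P Q -> Prop.

Definition is_sieve Q (S : sieve Q) :=
  forall P T (f : hom P Q) (g : hom T P), S P f -> S T (comp f g).

Definition pull_sieve Q P (h : hom P Q) (S : sieve Q) : sieve P :=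
  fun T f => S T (comp h f).

Definition covering_sieve Q (S : sieve Q) :=
  exists (I : finType) (P : I -> A) (f : forall i, hom (P i) Q),
    covering f /\ (forall i, S (P i) (f i)).

Definition refines Q (I K : finType) (P : I -> A) (T : K -> A)
    (h : forall k, hom (T k) Q) (f : forall i, hom (P i) Q) :=
  forall k, exists i, exists u : hom (T k) (P i), h k = comp (f i) u.

Record is_assembler : Prop := IsAssembler {
  asm_comp1m : forall P Q (f : hom P Q), comp (idm Q) f = f;
  asm_compm1 : forall P Q (f : hom P Q), comp f (idm P) = f;
  asm_compA : forall P Q T X (h : hom T X) (g : hom Q T) (f : hom P Q),
    comp h (comp g f) = comp (comp h g) f;
  asm_top_max : forall Q, covering_sieve (fun P (_ : hom P Q) => True);
  asm_top_stable : forall Q (S : sieve Q), is_sieve S -> covering_sieve S ->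
    forall P (h : hom P Q), covering_sieve (pull_sieve h S);
  asm_top_trans : forall Q (S S' : sieve Q), is_sieve S -> is_sieve S' ->
    covering_sieve S ->
    (forall P (f : hom P Q), S P f -> covering_sieve (pull_sieve f S')) ->
    covering_sieve S';
  asm_init : is_initial (init A);
  asm_cover_init : forall (P : void -> A) (f : forall i, hom (P i) (init A)),
    covering f;
  asm_monic : forall P Q (f : hom P Q), monic f;
  asm_disj : forall P P' Q (f : hom P Q) (g : hom P' Q),
    disj f g <->
    exists (p : hom (init A) P) (q : hom (init A) P'), is_pullback f g p q;
  asm_refine : forall Q (I J : finType) (P : I -> A) (P' : J -> A)
    (f : forall i, hom (P i) Q) (g : forall j, hom (P' j) Q),
    is_cover f -> is_cover g ->
    exists (K : finType) (T : K -> A) (h : forall k, hom (T k) Q),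
      [/\ is_cover h, refines h f & refines h g] }.

(** ** Tuples and scissors congruence *)

Record tup := Tup { idx : finType; entry :> idx -> A }.

(* the subfamily of the components of a map of tuples that lie over [j] *)
Definition fiber (P Q : tup) (phi : idx P -> idx Q)
    (f : forall i, hom (P i) (Q (phi i))) (j : idx Q)
    (i : {i : idx P | phi i == j}) : hom (P (val i)) (Q j) :=
  ecast k (hom (P (val i)) (Q k)) (eqP (valP i)) (f (val i)).

Record tup_hom (P Q : tup) := TupHom {
  tup_map : idx P -> idx Q;
  tup_comp : forall i, hom (P i) (Q (tup_map i));
  tup_cover : forall j, is_cover (@fiber P Q tup_map tup_comp j) }.

Definition tup_sqcup (P Q : tup) : tup :=
  @Tup (idx P + idx Q)%type
    (fun i => match i with inl a => P a | inr b => Q b end).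

Definition tup_bigsqcup (K : finType) (P : K -> tup) : tup :=
  @Tup {k : K & idx (P k)} (fun u => P (tag u) (tagged u)).

Definition scissors_congruent (P Q : tup) :=
  exists T : tup, inhabited (tup_hom T P) /\ inhabited (tup_hom T Q).

(** ** Volume functions and EA-assemblers *)

Variables (R : realType) (vol : A -> R).

Definition is_volume :=
  (forall P, 0 <= vol P) /\
  (forall Q (I : finType) (P : I -> A) (f : forall i, hom (P i) Q),
     is_cover f -> vol Q = \sum_(i : I) vol (P i)).

Definition tup_vol (P : tup) : R := \sum_(i : idx P) vol (P i).

Definition axiom_E := forall P Q : tup, tup_vol P < tup_vol Q ->
  exists P' : tup, scissors_congruent (tup_sqcup P P') Q.

Definition axiom_A := forall P : tup, 0 < tup_vol P ->
  forall Q : tup, exists (K : finType) (Qs : K -> tup),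
    inhabited (tup_hom (tup_bigsqcup Qs) Q) /\
    (forall k, 2 * tup_vol (Qs k) <= tup_vol P).

Definition EA_assembler := [/\ is_assembler, is_volume, axiom_E & axiom_A].

End assembler.

(** * Spherical polytopes *)

Section sphere.
Variables (R : realType) (n : nat).
Local Notation V := 'cV[R]_n.+1.

Definition sphere : set V := [set x | \sum_i x i 0 ^+ 2 = 1].

Definition conv_hull (m : nat) (v : 'I_m -> V) : set V :=
  [set x | exists a : 'I_m -> R,
     [/\ forall i, 0 <= a i, \sum_i a i = 1 & x = \sum_i a i *: v i]].

Definition to_sphere (x : V) : V :=
  (Num.sqrt (\sum_i x i 0 ^+ 2))^-1 *: x.

(* General position of n+1 points of S^n is meant in the linear sense.  Affine
   independence alone would admit n+1 points of a great subsphere, whose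
   projected hull has empty interior. *)
Definition is_simplex (S : set V) :=
  exists v : 'I_n.+1 -> V,
    [/\ forall i, sphere (v i),
        free [tuple v i | i < n.+1],
        ~ conv_hull v 0
      & S = to_sphere @` conv_hull v].

Definition is_polytope (P : set V) :=
  exists (m : nat) (S : 'I_m -> set V),
    (forall i, is_simplex (S i)) /\ P = \bigcup_i S i.

Record polytope := Polytope { pset :> set V; _ : is_polytope pset }.

(* interior relative to S^n *)
Definition sinterior (P : set V) : set V :=
  [set x | sphere x /\ (\forall y \near x, sphere y -> P y)].

(** ** Spherical volume *)

(* (m+1)-dimensional Lebesgue measure is the product of the one-dimensional and
   the m-dimensional ones, along R x R^m = R^(m+1). *)
Fixpoint lebesgue_tuple (m : nat) : set (m.-tuple R) -> \bar R :=
  match m with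
  | 0 => fun A => \d_([tuple]) A
  | m'.+1 => fun A =>
      ((@lebesgue_measure R) \x (@lebesgue_tuple m'))%E
        [set p : R * m'.-tuple R | A [tuple of p.1 :: p.2]]
  end.

Definition lebesgue_vec (A : set V) : \bar R :=
  lebesgue_tuple [set t : n.+1.-tuple R | A (\col_i tnth t i)].

(* Surface measure of S^n is (n+1) times the Lebesgue measure of the radial
   cone in the unit ball of R^(n+1). *)
Definition cone (P : set V) : set V :=
  [set x | exists t y, [/\ 0 < t, t <= 1, P y & x = t *: y]].

Definition sphere_vol (P : polytope) : R :=
  n.+1%:R * fine (lebesgue_vec (cone P)).

(** ** Groups of isometries *)

Record orth_subgroup := OrthSubgroup {
  grp :> set 'M[R]_n.+1;
  grp_orth : forall g, grp g -> g^T *m g = 1%:M;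
  grp1 : grp 1%:M;
  grpM : forall g h, grp g -> grp h -> grp (g *m h);
  grpV : forall g, grp g -> grp (invmx g) }.

Definition SO : set 'M[R]_n.+1 := [set g | g^T *m g = 1%:M /\ \det g = 1].

Definition contains_dense_SO (G : orth_subgroup) :=
  exists H : orth_subgroup, [/\ H `<=` G, H `<=` SO & SO `<=` closure H].

(** ** The assembler of spherical polytopes *)

Variable G : orth_subgroup.

(* [None] is the unique morphism out of the empty polytope; out of a nonempty
   polytope the morphisms are [Some g] with [g] in [G]. *)
Definition hom_spec (P Q : set V) (o : option 'M[R]_n.+1) : Prop :=
  match o with
  | None => P = set0
  | Some g => [/\ P !=set0, grp G g & mulmx g @` P `<=` Q]
  end.

Definition sphere_hom (P Q : polytope) :=
  {o : option 'M[R]_n.+1 | hom_spec P Q o}.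

Definition hom_image (P Q : polytope) (f : sphere_hom P Q) : set V :=
  match sval f with None => set0 | Some g => mulmx g @` P end.

Definition id_opt (P : set V) : option 'M[R]_n.+1 :=
  if pselect (P = set0) then None else Some 1%:M.

Lemma id_optP (P : set V) : hom_spec P P (id_opt P).
Proof.
rewrite /id_opt; case: pselect => //= /eqP/set0P P0; split=> //.
  exact: grp1.
by move=> _ [x Px <-]; rewrite mul1mx.
Qed.

Definition comp_opt (g f : option 'M[R]_n.+1) : option 'M[R]_n.+1 :=
  match f, g with Some f, Some g => Some (g *m f) | _, _ => None end.

Lemma comp_optP (P Q T : set V) g f :
  hom_spec Q T g -> hom_spec P Q f -> hom_spec P T (comp_opt g f).
Proof.
case: f => [f|] //; case: g => [g|] /=.
  move=> [_ Gg gQ] [P0 Gf fP]; split=> //; first exact: grpM.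
  move=> _ [x Px <-]; rewrite -mulmxA; apply: gQ; exists (f *m x) => //.
  by apply: fP; exists x.
by move=> -> [[x Px] _ /(_ (f *m x))[]]; exists x.
Qed.

Definition sphere_idm (P : polytope) : sphere_hom P P :=
  exist _ _ (id_optP P).

Definition sphere_comp (P Q T : polytope)
    (g : sphere_hom Q T) (f : sphere_hom P Q) : sphere_hom P T :=
  exist _ _ (comp_optP (proj2_sig g) (proj2_sig f)).

Lemma is_polytope0 : is_polytope set0.
Proof.
exists 0, (fun=> set0); split; first by case.
by apply/seteqP; split=> // x [[]].
Qed.

Definition sphere_assembler : assembler_data := {|
  ob := polytope;
  hom := sphere_hom;
  idm := sphere_idm;
  comp := sphere_comp;
  init := Polytope is_polytope0;
  covering := fun Q I P (f : forall i, sphere_hom (P i) Q) =>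
    \bigcup_i hom_image (f i) = Q;
  disj := fun P P' Q (f : sphere_hom P Q) (g : sphere_hom P' Q) =>
    sinterior (hom_image f) `&` sinterior (hom_image g) = set0 |}.

End sphere.

(* Main.v *)
From HB Require Import structures.
Require Import Defs.
From mathcomp Require Import all_boot all_order all_algebra.
From mathcomp Require Import all_classical all_reals all_analysis.
From mathcomp Require Import measurable_realfun ring lra.

Set Implicit Arguments.
Unset Strict Implicit.
Unset Printing Implicit Defensive.

Import Order.TTheory GRing.Theory Num.Theory.
Import numFieldTopology.Exports.

Local Open Scope classical_set_scope.
Local Open Scope ring_scope.

(** The algebraic part (the assembler axioms, additivity of volume) is a
calculus of polytopes up to _negligible_ sets, the subsets of finite unions of
great hyperspheres.  Modulo negligible sets the polytopes form a Boolean
algebra ([apolyI], [apolyC]): a simplex that is crossed by a hyperplane can be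
bisected until no piece is crossed ([apoly_simp_halfspace]), so cutting by
half-spaces stays within finite unions of simplices.  A polytope is the closure
of what remains of it after removing a negligible set, hence inclusions between
polytopes and closed sets need only be checked almost everywhere
([polytope_sub]), and two polytopes have disjoint interiors exactly when they
meet in a negligible set ([sinterior_disjoint]).  Every covering argument then
takes the intersections of the given pieces and replaces them by polytopes
([polytope_inter]).

Volume is studied through [svol], the Lebesgue measure of the radial cone.
Its invariance under orthogonal matrices comes from the uniqueness argument for
Haar measure: translation invariance and Tonelli's theorem show that a measure
m and its image under a rotation, m', satisfy m'(A) m(B) = m(A) m(B) when B is
the unit ball ([vleb_orth_exchange], [vleb_orth]).  Hyperplanes are null because
a coordinate hyperplane is.  Comparing the cones over caps with boxes gives
bounds C r^n <= svol (cap x r) <= C' r^n with constants that do not depend on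
the centre ([svol_cap_ge], [svol_cap_le]).

Axiom (A) holds because a polytope can be cut into pieces of small diameter
([polytope_cut]), which have small volume as they lie in small caps.

For axiom (E) the key is [pack_small]: for every d > 0 there is e > 0 such that
every polytope B of volume at most e can be cut into pieces that elements of G
move into any given polytope X of volume at least d, with disjoint interiors.
At a scale r that is small with respect to B and X, a maximal r-separated set
of points of B has at most about e / r^n elements, because the disjoint caps
around them lie near B; and X contains at least about d / r^n disjoint caps of
radius L r for a fixed constant L.  When e is a small enough multiple of d
there are more caps than points, so every point can be sent, by density of G,
near the centre of a cap of its own, which receives the pieces of B around that
point.  Only the order of magnitude of the volume of caps matters here.  If now
vol P < vol Q, cut P into pieces of volume at most e, where e is given by
[pack_small] for a d such that #Q d < vol Q - vol P.  As long as only
pieces of P have been placed, some component of what is left of Q has volume at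
least d, so the next piece fits ([packing_exists]); what remains at the end is
the complement required by (E) ([sphere_axiom_E]). *)

(** * Lebesgue measure on tuples *)

Section lebesgue_tuple_measure.
Variable R : realType.
Local Open Scope ereal_scope.

(** The first factor carries the Borel structure generated by intervals, for
which Lebesgue measure is defined. *)
Definition tcons m (p : measurableTypeR R * m.-tuple R) : m.+1.-tuple R :=
  [tuple of p.1 :: p.2].

Lemma measurable_tcons m : measurable_fun [set: _] (@tcons m).
Proof. exact: measurable_cons. Qed.

Lemma measurable_tcons1 m (x : measurableTypeR R) :
  measurable_fun [set: m.-tuple R] (fun t => tcons (x, t)).
Proof.
exact: (measurableT_comp (@measurable_tcons m) (measurable_pair1 x)).
Qed.

Lemma measurable_thead m (A : set (measurableTypeR R)) :
  measurable A -> measurable [set t : m.+1.-tuple R | A (thead t)].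
Proof.
move=> mA; have := @measurable_tnth _ R m.+1 ord0 measurableT A mA.
by rewrite setTI.
Qed.

Lemma measurable_tbehead m (B : set (m.-tuple R)) :
  measurable B -> measurable [set t : m.+1.-tuple R | B [tuple of behead t]].
Proof.
move=> mB; have := @measurable_behead _ R m measurableT B mB.
by rewrite setTI.
Qed.

Section step.
Variables (m : nat) (M : {sigma_finite_measure set (m.-tuple R) -> \bar R}).

(** One step of the recursion that defines Lebesgue measure on tuples, packaged
so that the result is again a sigma-finite measure, as Tonelli's theorem
requires. *)
Definition lebesgue_step : set (m.+1.-tuple R) -> \bar R :=
  pushforward (@lebesgue_measure R \x M) (@tcons m).

Let step0 : lebesgue_step set0 = 0.
Proof. by rewrite /lebesgue_step /pushforward preimage_set0 measure0. Qed.

Let step_ge0 A : 0 <= lebesgue_step A.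
Proof. by apply: integral_ge0 => x _; exact: measure_ge0. Qed.

Let step_sigma_additive : semi_sigma_additive lebesgue_step.
Proof.
move=> F mF tF mUF; rewrite /lebesgue_step /pushforward preimage_bigcup.
have mf B : measurable B -> measurable (@tcons m @^-1` B).
  by move=> mB; rewrite -[X in measurable X]setTI; exact: measurable_tcons.
apply: measure_semi_sigma_additive.
- by move=> n; exact: mf.
- apply/trivIsetP => /= i j _ _ ij; rewrite -preimage_setI.
  by move/trivIsetP : tF => /(_ _ _ _ _ ij) ->//; rewrite preimage_set0.
- by rewrite -preimage_bigcup; exact: mf.
Qed.

HB.instance Definition _ := isMeasure.Build _ _ _ lebesgue_step
  step0 step_ge0 step_sigma_additive.

Lemma lebesgue_step_box (A : set (measurableTypeR R)) (B : set (m.-tuple R)) :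
  measurable A -> measurable B ->
  lebesgue_step [set t | A (thead t) /\ B [tuple of behead t]] =
  lebesgue_measure A * M B.
Proof.
move=> mA mB; rewrite -product_measure1E// /lebesgue_step /pushforward.
congr (product_measure1 _ _ _).
have tE x (t : m.-tuple R) : [tuple of behead [tuple of x :: t]] = t.
  exact: val_inj.
by apply/seteqP; split => -[x t]; rewrite /tcons/= theadE tE.
Qed.

Let step_sigma_finite : sigma_finite setT lebesgue_step.
Proof.
have /sigma_finiteP[F [FT ndF Foo]] := sigma_finiteT (@lebesgue_measure R).
have /sigma_finiteP[H [HT ndH Hoo]] := sigma_finiteT M.
exists (fun k => [set t | F k (thead t) /\ H k [tuple of behead t]]).
  apply/esym; rewrite -subTset => t _.
  have [k _ Fk] : (\bigcup_k F k) (thead t) by rewrite -FT.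
  have [l _ Hl] : (\bigcup_k H k) [tuple of behead t] by rewrite -HT.
  exists (maxn k l) => //; split.
    by move: (thead t) Fk; exact/subsetPset/ndF/leq_maxl.
  by move: [tuple of behead t] Hl; exact/subsetPset/ndH/leq_maxr.
move=> k; have [mF Fk] := Foo k; have [mH Hk] := Hoo k; split.
  by apply: measurableI; [exact: measurable_thead|exact: measurable_tbehead].
by rewrite lebesgue_step_box// lte_mul_pinfty// ge0_fin_numE.
Qed.

HB.instance Definition _ :=
  Measure_isSigmaFinite.Build _ _ _ lebesgue_step step_sigma_finite.

End step.

Fixpoint lebT m : {sigma_finite_measure set (m.-tuple R) -> \bar R} :=
  match m with
  | 0 => @dirac _ _ ([tuple] : 0.-tuple R) R
  | m'.+1 => lebesgue_step (lebT m')
  end.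

Lemma lebTE m : (lebT m : set _ -> _) = @lebesgue_tuple R m.
Proof. by elim: m => [//|m IH] /=; rewrite /lebesgue_step /pushforward IH. Qed.

Lemma lebTS m A :
  lebT m.+1 A = \int[@lebesgue_measure R]_x lebT m [set y | A (tcons (x, y))].
Proof.
apply: eq_integral => x _ /=; congr (lebT m _).
by apply/seteqP; split => y; rewrite /xsection/= inE.
Qed.

Lemma lebT_box m (A : set (measurableTypeR R)) (B : set (m.-tuple R)) :
  measurable A -> measurable B ->
  lebT m.+1 [set t | A (thead t) /\ B [tuple of behead t]] =
  lebesgue_measure A * lebT m B.
Proof. exact: lebesgue_step_box. Qed.

Definition tadd m (t u : m.-tuple R) : m.-tuple R :=
  [tuple (tnth t i + tnth u i)%R | i < m].

Lemma tadd_cons m x (t : m.-tuple R) (u : m.+1.-tuple R) :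
  tadd (tcons (x, t)) u = tcons (x + thead u, tadd t [tuple of behead u])%R.
Proof.
apply: eq_from_tnth => i; rewrite tnth_mktuple.
have [j ->|->] := unliftP ord0 i; last by rewrite !tnth0.
by rewrite !tnthS tnth_mktuple [in LHS](tuple_eta u) tnthS.
Qed.

Lemma measurable_preimageT d1 d2 (T1 : measurableType d1)
    (T2 : measurableType d2) (f : T1 -> T2) A :
  measurable_fun [set: T1] f -> measurable A -> measurable [set t | A (f t)].
Proof. by move=> mf mA; have := mf measurableT A mA; rewrite setTI. Qed.

(** Translates of half-open intervals have the same length, and these intervals
determine the measure. *)
Lemma lebesgue_measure_shift (a : R) (A : set (measurableTypeR R)) :
  measurable A ->
  lebesgue_measure [set x : R | A (x + a)%R] = lebesgue_measure A.
Proof.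
have mf : measurable_fun [set: measurableTypeR R]
    ((fun x : R => x + a)%R : measurableTypeR R -> measurableTypeR R).
  by apply: measurable_funD => //; exact: measurable_cst.
move=> mA; apply/esym.
pose nu := measure_function_pushforward__canonical__measure_function_Measure
  (@lebesgue_measure R) mf.
apply: (@lebesgue_measure_unique R nu) => //= _ [[c d]] _ <-.
rewrite /pushforward/=.
rewrite (_ : _ @^-1` _ = `](c - a)%R, (d - a)%R]%classic); last first.
  apply/seteqP; split => x /=; rewrite !in_itv/= => /andP[]; lra.
rewrite !lebesgue_measure_itv/= !lte_fin ltrD2r; case: ifP => // _.
rewrite -!EFinB; congr (_%:E); lra.
Qed.

(** Slice along the first coordinate: the slices are translated by the tail of
[u], and the integration variable by its head. *)
Lemma lebT_shift m (u : m.-tuple R) (A : set (m.-tuple R)) : measurable A ->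
  lebT m [set t | A (tadd t u)] = lebT m A.
Proof.
elim: m u A => [u A mA|m IH u A mA].
  congr (lebT 0 _); apply/seteqP; split => t /=;
    by rewrite (tuple0 t) (tuple0 (tadd _ _)).
rewrite !lebTS.
under eq_integral => x _.
  rewrite (_ : [set y | _] = [set y | [set z | A (tcons (x + thead u, z)%R)]
     (tadd y [tuple of behead u])]); last first.
    by apply/seteqP; split => y /=; rewrite tadd_cons.
  rewrite IH; last first.
    by have := measurable_tcons1 (x + thead u)%R measurableT mA; rewrite setTI.
  over.
pose h := (fun x : R => lebT m [set y | A (tcons (x, y))]).
have mh : measurable_fun [set: measurableTypeR R] h.
  rewrite (_ : h = lebT m \o xsection [set p : measurableTypeR R * m.-tuple R |
    A (tcons p)]); last first.
    apply/funext => x /=; congr (lebT m _).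
    by apply/seteqP; split => y; rewrite /xsection/= inE.
  by apply: measurable_fun_xsection; apply: measurable_preimageT => //;
    exact: measurable_tcons.
have mf : measurable_fun [set: measurableTypeR R]
    ((fun x : R => x + thead u)%R : measurableTypeR R -> measurableTypeR R).
  by apply: measurable_funD => //; exact: measurable_cst.
rewrite -[LHS]/(\int[@lebesgue_measure R]_(x in (fun x : R =>
  x + thead u)%R @^-1` setT) (h \o (fun x : R => x + thead u)%R) x).
rewrite -(@ge0_integral_pushforward _ _ _ _ R _ mf)//.
by apply: eq_measure_integral => //= B mB _; exact: lebesgue_measure_shift.
Qed.

End lebesgue_tuple_measure.

(** * Sets of column vectors *)

Section lebesgue_vec.
Variables (R : realType) (n : nat).
Local Notation V := 'cV[R]_n.
Local Notation T := (n.-tuple R).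
Local Open Scope ereal_scope.

Definition tcol (t : T) : V := (\col_i tnth t i)%R.
Definition tupcol (x : V) : T := [tuple x i ord0 | i < n].

Lemma tupcolK : cancel tupcol tcol.
Proof. by move=> x; apply/colP => i; rewrite mxE tnth_mktuple. Qed.

Lemma tcolD t u : tcol (tadd t u) = (tcol t + tcol u)%R.
Proof. by apply/colP => i; rewrite !mxE tnth_mktuple. Qed.

(** Column vectors inherit measurability and measure from tuples. *)
Definition vmeas (A : set V) := measurable [set t : T | A (tcol t)].
Definition vleb (A : set V) : \bar R := lebT R n [set t | A (tcol t)].

Lemma vleb_ge0 A : 0 <= vleb A.
Proof. exact: measure_ge0. Qed.

Section vfun.
Context d (X : measurableType d).

(** Measurability of a vector-valued function, checked on coordinates. *)
Definition vfun (f : X -> V) :=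
  forall i, measurable_fun [set: X] (fun t => f t i ord0).

Lemma vfun_meas f A : vfun f -> vmeas A -> measurable [set t | A (f t)].
Proof.
move=> mf mA; rewrite (_ : mkset _ = [set t | [set u | A (tcol u)] (tupcol (f
  t))]).
  apply: measurable_preimageT mA; apply/measurable_fun_tnthP => i.
  rewrite (_ : _ \o _ = fun t => f t i ord0)//.
  by apply/funext => t /=; rewrite tnth_mktuple.
by apply/seteqP; split => t /=; rewrite tupcolK.
Qed.

Lemma vfun_mulmx g f : vfun f -> vfun (fun t => g *m f t)%R.
Proof.
move=> mf i; under eq_fun do rewrite mxE.
apply: measurable_sum => j; apply: measurable_funM => //; exact: mf.
Qed.

Lemma vfunD f h : vfun f -> vfun h -> vfun (fun t => f t + h t)%R.
Proof.
move=> mf mh i; under eq_fun do rewrite mxE.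
apply: measurable_funD; [exact: mf|exact: mh].
Qed.

Lemma vfunN f : vfun f -> vfun (fun t => - f t)%R.
Proof.
move=> mf i; under eq_fun do rewrite mxE.
apply: measurable_funN; exact: mf.
Qed.

End vfun.

Lemma vfun_tcol : vfun tcol.
Proof. by move=> i; under eq_fun do rewrite mxE; exact: measurable_tnth. Qed.

Lemma vfun_comp d d' (X : measurableType d) (Y : measurableType d')
    (f : Y -> V) (h : X -> Y) :
  measurable_fun [set: X] h -> vfun f -> vfun (f \o h).
Proof. by move=> mh mf i; exact: measurableT_comp (mf i) mh. Qed.

Lemma vleb_shift (v : V) A : vmeas A -> vleb [set x | A (x + v)%R] = vleb A.
Proof.
move=> mA; apply: etrans (lebT_shift (tupcol v) mA).
congr (lebT R n _).
by apply/seteqP; split => t /=; rewrite tcolD tupcolK.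
Qed.

Lemma vmeas_mulmx g A : vmeas A -> vmeas [set x | A (g *m x)%R].
Proof. exact: vfun_meas (vfun_mulmx g vfun_tcol). Qed.

Lemma tonelli_set (S : set (T * T)) : measurable S ->
  \int[lebT R n]_t lebT R n [set u | S (t, u)] =
  \int[lebT R n]_u lebT R n [set t | S (t, u)].
Proof.
move=> mS; have := indic_fubini_tonelli (lebT R n) (lebT R n) mS.
rewrite indic_fubini_tonelli_FE// indic_fubini_tonelli_GE//=.
have -> : [eta (lebT R n) \o xsection S] = fun t => lebT R n [set u | S (t, u)].
  by apply/funext => t /=; congr (lebT R n _); apply/seteqP; split => u;
    rewrite /xsection/= inE.
have -> // : [eta (lebT R n) \o ysection S] = fun u =>
  lebT R n [set t | S (t, u)].
by apply/funext => t /=; congr (lebT R n _); apply/seteqP; split => u;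
  rewrite /ysection/= inE.
Qed.

Lemma integral_section (A : set T) (c : \bar R) : measurable A -> 0 <= c ->
  \int[lebT R n]_t (if t \in A then c else 0) = lebT R n A * c.
Proof.
move=> mA c0.
rewrite -[LHS](_ : \int[lebT R n]_t ((\1_A t)%:E * c) = _); last first.
  by apply: eq_integral => t _; rewrite indicE; case: ifP;
    rewrite ?mul1e ?mul0e.
rewrite ge0_integralZr//; last exact: measurableT_comp.
by rewrite integral_indic// setIT.
Qed.

(** The uniqueness argument for Haar measure. Integrate over x and y the
condition that g x + y lies in A and y in B. For fixed y, a translation of x
removes y from the first condition, which gives the left-hand side. For fixed
x, the translation of y by - g x turns the conditions into y in A and y - g x
in B; integrating over x first, a translation of x by g^-1 y leaves the measure
of the x with - g x in B, which is that of B. *)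
Lemma vleb_orth_exchange (g : 'M[R]_n) (A B : set V) : (g^T *m g = 1%:M)%R ->
  vmeas A -> vmeas B -> (forall x, B (- (g *m x))%R <-> B x) ->
  vleb [set x | A (g *m x)%R] * vleb B = vleb A * vleb B.
Proof.
move=> gg mA mB gB.
have gg' : (g *m g^T = 1%:M)%R by apply: mulmx1C.
have m1 : vfun (fun p : T * T =>
  tcol p.1) by exact: vfun_comp measurable_fst vfun_tcol.
have m2 : vfun (fun p : T * T =>
  tcol p.2) by exact: vfun_comp measurable_snd vfun_tcol.
(* the joint condition, before and after the translation of y by - g x *)
pose S1 := [set p : T * T | A (g *m tcol p.1 + tcol p.2)%R /\ B (tcol p.2)].
pose S2 := [set p : T * T | A (tcol p.2) /\ B (tcol p.2 - g *m tcol p.1)%R].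
have mS1 : measurable S1.
  apply: measurableI; last exact: vfun_meas.
  by apply: vfun_meas mA; apply: vfunD => //; exact: vfun_mulmx.
have mS2 : measurable S2.
  apply: measurableI; first exact: vfun_meas.
  by apply: vfun_meas mB; apply: vfunD => //; apply: vfunN; exact: vfun_mulmx.
have E1 : \int[lebT R n]_u lebT R n [set t | S1 (t, u)] =
    vleb [set x | A (g *m x)%R] * vleb B.
  rewrite muleC -[RHS](integral_section mB (vleb_ge0 _)).
  apply: eq_integral => u _; case: ifPn => [/set_mem/= Bu|/negP nB].
    rewrite -(vleb_shift (g^T *m tcol u)%R); last exact: vmeas_mulmx.
    rewrite /vleb; congr (lebT R n _); apply/seteqP; split => t/=.
      by rewrite /S1/= mulmxDr mulmxA gg' mul1mx => -[].
    by rewrite /S1/= mulmxDr mulmxA gg' mul1mx.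
  rewrite (_ : [set t | _] = set0) ?measure0//.
  by apply/seteqP; split => // t -[_ Bu]; apply: nB; exact: mem_set.
have E2 : \int[lebT R n]_t lebT R n [set u | S2 (t, u)] = vleb A * vleb B.
  rewrite tonelli_set// -[RHS](integral_section mA (vleb_ge0 _)).
  apply: eq_integral => u _; case: ifPn => [/set_mem/= Au|/negP nA].
    have mBu : vmeas [set x : V | B (tcol u - g *m x)%R].
      apply: vfun_meas mB; apply: vfunD; last by apply: vfunN;
        exact: vfun_mulmx _ vfun_tcol.
      by move=> i; exact: measurable_cst.
    transitivity (vleb [set x : V | B (tcol u - g *m x)%R]).
      by rewrite /vleb; congr (lebT R n _); apply/seteqP; split => t/= => [[]|].
    rewrite -(vleb_shift (g^T *m tcol u)%R)//.
    rewrite /vleb; congr (lebT R n _); apply/seteqP; split => t/=;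
      by rewrite mulmxDr mulmxA gg' mul1mx opprD addrCA subrr addr0 gB.
  rewrite (_ : [set t | _] = set0) ?measure0//.
  by apply/seteqP; split => // t -[Au _]; apply: nA; exact: mem_set.
rewrite -E1 -E2 -tonelli_set//; apply: eq_integral => t _.
transitivity (vleb [set x | A (g *m tcol t + x)%R /\ B x]) => //.
rewrite -(vleb_shift (- (g *m tcol t))%R); last first.
  apply: measurableI => //; apply: vfun_meas mA; apply: vfunD;
    last exact: vfun_tcol.
  by move=> i; exact: measurable_cst.
by rewrite /vleb; congr (lebT R n _); apply/seteqP; split => u/=;
  rewrite addrC subrK.
Qed.

End lebesgue_vec.

(** * Scalar product and orthogonal matrices *)

Section dot.
Variables (R : realType) (n : nat).
Local Notation V := 'cV[R]_n.
Implicit Types (x y : V) (g : 'M[R]_n).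

Definition dot x y : R := \sum_i x i 0 * y i 0.
Definition orth g := g^T *m g = 1%:M.

Lemma dotE x y : dot x y = (x^T *m y) 0 0.
Proof. by rewrite mxE; apply: eq_bigr => i _; rewrite mxE. Qed.

Lemma dotC x y : dot x y = dot y x.
Proof. by apply: eq_bigr => i _; rewrite mulrC. Qed.

Lemma dotDr x y z : dot x (y + z) = dot x y + dot x z.
Proof. by rewrite !dotE mulmxDr mxE. Qed.

Lemma dotZr a x y : dot x (a *: y) = a * dot x y.
Proof. by rewrite !dotE -scalemxAr mxE. Qed.

Lemma dotNr x y : dot x (- y) = - dot x y.
Proof. by rewrite -scaleN1r dotZr mulN1r. Qed.

Lemma dotDl x y z : dot (y + z) x = dot y x + dot z x.
Proof. by rewrite dotC dotDr !(dotC x). Qed.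

Lemma dotZl a x y : dot (a *: y) x = a * dot y x.
Proof. by rewrite dotC dotZr dotC. Qed.

Lemma dotNl x y : dot (- y) x = - dot y x.
Proof. by rewrite dotC dotNr dotC. Qed.

Lemma dot_ge0 x : 0 <= dot x x.
Proof. by apply: sumr_ge0 => i _; rewrite -expr2 sqr_ge0. Qed.

Lemma dot_eq0 x : (dot x x == 0) = (x == 0).
Proof.
apply/idP/eqP => [|->]; last by rewrite /dot big1// => i _; rewrite mxE mul0r.
rewrite psumr_eq0 => [/allP x0|i _]; last by rewrite -expr2 sqr_ge0.
apply/colP => i; rewrite mxE; apply/eqP; rewrite -(@sqrf_eq0 R) expr2.
exact: x0 (mem_index_enum i).
Qed.

Lemma dot_gt0 x : (0 < dot x x) = (x != 0).
Proof. by rewrite lt_def dot_ge0 andbT dot_eq0. Qed.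

Lemma dot_coord_le x i : x i 0 ^+ 2 <= dot x x.
Proof.
rewrite /dot (bigD1 i)//= -expr2 lerDl.
by apply: sumr_ge0 => j _; rewrite -expr2 sqr_ge0.
Qed.

Lemma coord_le1 x i : dot x x <= 1 -> `|x i 0| <= 1.
Proof.
move=> x1; rewrite -(@ler_pXn2r R 2)// ?nnegrE// real_normK ?num_real// expr1n.
exact: le_trans (dot_coord_le _ _) x1.
Qed.

Lemma orth_inv g : orth g -> g *m g^T = 1%:M.
Proof. exact: mulmx1C. Qed.

Lemma orth_trmx g : orth g -> orth g^T.
Proof. by move=> gg; rewrite /orth trmxK orth_inv. Qed.

Lemma orthM g h : orth g -> orth h -> orth (g *m h).
Proof.
by move=> gg hh; rewrite /orth trmx_mul mulmxA -(mulmxA h^T) gg mulmx1.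
Qed.

Lemma orth1 : orth 1%:M.
Proof. by rewrite /orth trmx1 mulmx1. Qed.

Lemma orthK g : orth g -> cancel (mulmx g : V -> V) (mulmx g^T).
Proof. by move=> gg x; rewrite mulmxA gg mul1mx. Qed.

Lemma orthKV g : orth g -> cancel (mulmx g^T : V -> V) (mulmx g).
Proof. by move=> gg x; rewrite mulmxA orth_inv// mul1mx. Qed.

Lemma orth_unit g : orth g -> g \in unitmx.
Proof. by move=> gg; have [] := mulmx1_unit gg. Qed.

Lemma orth_dot g x y : orth g -> dot (g *m x) (g *m y) = dot x y.
Proof. by move=> gg; rewrite !dotE trmx_mul mulmxA -(mulmxA x^T) gg mulmx1. Qed.

(** The reflection in the hyperplane orthogonal to [x - y] exchanges [x] and
[y] when they have the same length. *)
Lemma orth_transitive x y : dot x x = dot y y -> exists g, orth g /\ g *m x = y.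
Proof.
move=> xy; have [->|neq] := eqVneq x y.
  by exists 1%:M; split; [exact: orth1|rewrite mul1mx].
pose w := x - y; pose c := dot w w.
have c0 : c != 0 by rewrite dot_eq0 subr_eq0.
pose H := 1%:M - (2 / c) *: (w *m w^T).
have wx : dot w x = c / 2.
  by rewrite /c {2}/w /w !(dotDl, dotDr, dotNl, dotNr) (dotC y x) xy; field.
have ww (z : V) : w *m w^T *m z = dot w z *: w.
  by rewrite -mulmxA [w^T *m z]mx11_scalar -dotE mul_mx_scalar.
exists H; split; last first.
  rewrite mulmxBl mul1mx -scalemxAl ww wx scalerA.
  have -> : 2 / c * (c / 2) = 1 by field.
  by rewrite scale1r /w opprB addrC subrK.
have Ht : H^T = H by rewrite linearB/= trmx1 linearZ/= trmx_mul trmxK.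
have PP : w *m w^T *m (w *m w^T) = c *: (w *m w^T).
  by rewrite mulmxA ww scalemxAl.
rewrite /orth Ht /H mulmxBl mul1mx -scalemxAl mulmxBr mulmx1 -scalemxAr PP.
have aac : 2 / c * (2 / c * c) = 2 / c + 2 / c by field.
by rewrite scalerBr !scalerA opprB -mulrA aac scalerDl addrK subrK.
Qed.

End dot.

(** * Orthogonal invariance of Lebesgue measure *)

Section vleb_orth.
Variable R : realType.
Local Open Scope ereal_scope.

Lemma tnth_lift0 m (t : m.+1.-tuple R) i :
  tnth t (lift ord0 i) = tnth [tuple of behead t] i.
Proof. by rewrite [in LHS](tuple_eta t) tnthS. Qed.

(** The sides of the box are functions on [nat] rather than tuples, so that the
recursion on the dimension is a shift of indices. *)
Lemma lebT_cbox m (a b : nat -> R) : (forall i, a i <= b i)%R ->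
  let B := [set t : m.-tuple R | forall i : 'I_m, (a i <= tnth t i <= b i)%R] in
  measurable B /\ lebT R m B = (\prod_(i < m) (b i - a i))%:E.
Proof.
elim: m a b => [a b ab B|m IH a b ab B].
  have -> : B = setT by apply/seteqP; split => // t _ [].
  by split; [exact: measurableT|rewrite big_ord0 /= diracT].
pose a' i := a i.+1; pose b' i := b i.+1.
have [mB' B'E] := IH a' b' (fun i => ab i.+1).
set B' := (X in measurable X) in mB' B'E.
have BE : B = [set t | `[a 0%N,
  b 0%N]%classic (thead t) /\ B' [tuple of behead t]].
  apply/seteqP; split => t.
    move=> tB; split; first by rewrite /= in_itv/=; exact: (tB ord0).
    by move=> i; have := tB (lift ord0 i); rewrite tnth_lift0.
  rewrite /= in_itv/= => -[t0 tB] i.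
  have [j ->|->] := unliftP ord0 i; last exact: t0.
  by rewrite tnth_lift0; exact: tB.
split.
  rewrite BE; apply: measurableI; last exact: measurable_tbehead.
  by apply: (@measurable_thead _ _ `[a 0%N, b 0%N]%classic).
rewrite BE lebT_box// B'E lebesgue_measure_itv/= lte_fin big_ord_recl/=.
case: ltP => [_|ba]; first by rewrite -EFinB -EFinM.
have -> : b 0%N = a 0%N by apply/eqP; rewrite eq_le ba ab.
by rewrite subrr mul0r mul0e.
Qed.

Variable n : nat.
Local Notation V := 'cV[R]_n.

Definition vbox (a b : nat -> R) : set V :=
  [set x | forall i : 'I_n, (a i <= x i ord0 <= b i)%R].

Lemma vmeas_box a b : (forall i, a i <= b i)%R -> vmeas (vbox a b).
Proof.
move=> ab; have [+ _] := @lebT_cbox n a b ab.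
rewrite /vmeas (_ : mkset _ = [set t | vbox a b (tcol t)])//.
by apply/seteqP; split => t tB i; have := tB i; rewrite mxE.
Qed.

Lemma vleb_box a b : (forall i, a i <= b i)%R ->
  vleb (vbox a b) = (\prod_(i < n) (b i - a i))%:E.
Proof.
move=> ab; have [_ <-] := @lebT_cbox n a b ab; congr (lebT _ _ _).
by apply/seteqP; split => t tB i; have := tB i; rewrite mxE.
Qed.

Lemma le_vleb (A B : set V) : vmeas A -> vmeas B -> A `<=` B ->
  vleb A <= vleb B.
Proof.
by move=> mA mB AB; apply: le_measure; rewrite ?inE// => t; exact: AB.
Qed.

Definition unit_ball : set V := [set x | dot x x <= 1]%R.

Lemma measurable_fun_dot d (X : measurableType d) (f h : X -> V) :
  vfun f -> vfun h -> measurable_fun [set: X] (fun t => dot (f t) (h t)).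
Proof.
by move=> mf mh; apply: measurable_sum => i; apply: measurable_funM.
Qed.

Let mtrue : measurable [set true]. Proof. by []. Qed.

Lemma vmeas_le (f g : V -> R) :
  measurable_fun [set: n.-tuple R] (fun t => f (tcol t)) ->
  measurable_fun [set: n.-tuple R] (fun t => g (tcol t)) ->
  vmeas [set x | f x <= g x]%R.
Proof.
move=> mf mg; have := measurable_fun_ler mf mg measurableT (mtrue).
by rewrite setTI; apply.
Qed.

Lemma vmeas_lt (f g : V -> R) :
  measurable_fun [set: n.-tuple R] (fun t => f (tcol t)) ->
  measurable_fun [set: n.-tuple R] (fun t => g (tcol t)) ->
  vmeas [set x | f x < g x]%R.
Proof.
move=> mf mg; have := measurable_fun_ltr mf mg measurableT (mtrue).
by rewrite setTI; apply.
Qed.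

Lemma vmeas_unit_ball : vmeas unit_ball.
Proof.
by apply: vmeas_le => //; apply: measurable_fun_dot; exact: vfun_tcol.
Qed.

Lemma vleb_unit_ball_fin : vleb unit_ball < +oo.
Proof.
pose a (i : nat) : R := (-1)%R; pose b (i : nat) : R := 1%R.
have ab i : (a i <= b i)%R by rewrite /a /b; lra.
apply: (@le_lt_trans _ _ (vleb (vbox a b))); last by rewrite vleb_box// ltry.
apply: le_vleb; [exact: vmeas_unit_ball|exact: vmeas_box|].
by move=> x x1 i; rewrite -ler_norml; exact: coord_le1.
Qed.

Lemma vleb_unit_ball_gt0 : 0 < vleb unit_ball.
Proof.
pose c : R := (n.+1%:R^-1)%R.
have c0 : (0 < c)%R by rewrite invr_gt0.
have c1 : (c <= 1)%R by rewrite invf_le1// ler1n.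
pose a (i : nat) : R := (- c)%R; pose b (i : nat) : R := c.
have ab i : (a i <= b i)%R by rewrite /a /b; lra.
apply: (@lt_le_trans _ _ (vleb (vbox a b))).
  rewrite vleb_box// lte_fin prodr_gt0// => i _; rewrite /a /b; lra.
apply: le_vleb; [exact: vmeas_box|exact: vmeas_unit_ball|].
move=> x xc; rewrite /unit_ball /= /dot.
apply: (@le_trans _ _ (\sum_(i < n) c)%R).
  apply: ler_sum => i _; have := xc i; rewrite /a /b => /andP[? ?].
  by rewrite -expr2; nra.
rewrite sumr_const card_ord -mulr_natl /c ler_pdivrMr// mul1r ler_nat.
exact: leqnSn.
Qed.

(** In [vleb_orth_exchange] take for [B] the unit ball, which is symmetric and
invariant under [g]; its measure is positive and finite and can be
cancelled. *)
Lemma vleb_orth (g : 'M[R]_n) (A : set V) : orth g -> vmeas A ->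
  vleb [set x | A (g *m x)%R] = vleb A.
Proof.
move=> gg mA.
have BgB x : unit_ball (- (g *m x))%R <-> unit_ball x.
  by rewrite /unit_ball/= dotNl dotNr opprK orth_dot.
have := vleb_orth_exchange gg mA vmeas_unit_ball BgB.
have b0 := vleb_unit_ball_gt0; have := vleb_unit_ball_fin.
move: (vleb unit_ball) b0 => [r| |]//; rewrite lte_fin => r0 _ E.
by apply/le_anti/andP; split; rewrite -(@lee_pmul2r _ r%:E)// E.
Qed.

End vleb_orth.

(** The slice of the hyperplane is a point in the first coordinate, which has
length 0. *)
Lemma vleb_coord0 (R : realType) n :
  vleb [set x : 'cV[R]_n.+1 | x ord0 ord0 = 0%R] = 0%E.
Proof.
have := @lebT_box R n [set 0%R] setT (measurable_set1 _) measurableT.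
rewrite lebesgue_measure_set1 mul0e => <-; congr (lebT _ _ _).
by apply/seteqP; split => t /=; rewrite mxE => // -[].
Qed.

(** * Spherical measure *)

Section sphere_measure.
Variables (R : realType) (n : nat).
Local Notation V := 'cV[R]_n.+1.
Local Notation S := (sphere (R := R) (n := n)).
Implicit Types (x y : V) (A B : set V) (g : 'M[R]_n.+1).

Lemma sphereE x : S x <-> dot x x = 1.
Proof.
by rewrite /sphere/= /dot; under eq_bigr do rewrite expr2.
Qed.

Lemma to_sphereE x : to_sphere x = (Num.sqrt (dot x x))^-1 *: x.
Proof. by rewrite /to_sphere /dot; under eq_bigr do rewrite expr2. Qed.

Lemma sphere_orth g x : orth g -> S x -> S (g *m x).
Proof. by move=> gg /sphereE xS; apply/sphereE; rewrite orth_dot. Qed.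

Lemma sphere_to_sphere x : 0 < dot x x -> S (to_sphere x).
Proof.
move=> x0; apply/sphereE; rewrite to_sphereE dotZl dotZr mulrA -expr2 exprVn.
by rewrite sqr_sqrtr ?ltW// mulVf// gt_eqF.
Qed.

Lemma to_sphere_id x : S x -> to_sphere x = x.
Proof. by move=> /sphereE xS; rewrite to_sphereE xS sqrtr1 invr1 scale1r. Qed.

Lemma to_sphereZ (c : R) x : 0 < c -> to_sphere (c *: x) = to_sphere x.
Proof.
move=> c0; rewrite !to_sphereE dotZl dotZr mulrA -expr2 sqrtrM ?sqr_ge0//.
rewrite sqrtr_sqr gtr0_norm// invfM scalerA; congr (_ *: _).
by rewrite mulrAC mulVf ?mul1r// gt_eqF.
Qed.

Lemma to_sphere_orth g x : orth g -> to_sphere (g *m x) = g *m to_sphere x.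
Proof. by move=> gg; rewrite !to_sphereE orth_dot// scalemxAr. Qed.

(** The inverse of the square root is the power with exponent -1/2, including
at 0 where both are 0 by convention. *)
Lemma measurable_fun_invsqrt d (X : measurableType d) (f : X -> R) :
  (forall t, 0 <= f t) -> measurable_fun [set: X] f ->
  measurable_fun [set: X] (fun t => (Num.sqrt (f t))^-1).
Proof.
move=> f0 mf; rewrite (_ : (fun t => _) = (@powR R ^~ (- 2^-1)) \o f).
  by apply: measurableT_comp => //; exact: measurable_powR.
by apply/funext => t /=; rewrite powRN powR12_sqrt.
Qed.

Lemma vfun_to_sphere : vfun (fun t : n.+1.-tuple R => to_sphere (tcol t)).
Proof.
move=> i; under eq_fun do rewrite to_sphereE mxE.
apply: measurable_funM; last exact: vfun_tcol.
apply: measurable_fun_invsqrt => [t|]; first exact: dot_ge0.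
by apply: measurable_fun_dot; exact: vfun_tcol.
Qed.

(** The radial cone over [A] in the unit ball, without its apex: a preimage
under [to_sphere], hence compatible with all set operations on [A]. *)
Definition scone A : set V := [set x | 0 < dot x x <= 1 /\ A (to_sphere x)].
(** Surface measure up to the constant factor [n + 1]. *)
Definition svol A : R := fine (vleb (scone A)).

Lemma vmeas_dot (l : V) :
  measurable_fun [set: n.+1.-tuple R] (fun t => dot l (tcol t)).
Proof.
apply: measurable_fun_dot; last exact: vfun_tcol.
by move=> i; exact: measurable_cst.
Qed.

Lemma vmeasU A B : vmeas A -> vmeas B -> vmeas (A `|` B).
Proof. exact: measurableU. Qed.

Lemma vmeasI A B : vmeas A -> vmeas B -> vmeas (A `&` B).
Proof. exact: measurableI. Qed.

Lemma vmeasC A : vmeas A -> vmeas (~` A).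
Proof. exact: measurableC. Qed.

Lemma vmeas0 : vmeas (set0 : set V).
Proof. exact: measurable0. Qed.

Lemma vmeas_sphere : vmeas S.
Proof.
rewrite (_ : S = [set x | dot x x <= 1] `&` [set x | 1 <= dot x x]).
  by apply: vmeasI; apply: vmeas_le => //; apply: measurable_fun_dot;
    exact: vfun_tcol.
apply/seteqP; split => x; first by move=> /sphereE /= ->.
by move=> [/= x1 x2]; apply/sphereE/le_anti; rewrite x1 x2.
Qed.

Lemma vmeas_scone A : vmeas A -> vmeas (scone A).
Proof.
move=> mA; apply: (@vmeasI [set x | 0 < dot x x <= 1] [set x | A (to_sphere
  x)]).
  rewrite (_ : mkset _ = [set x | 0 < dot x x] `&` [set x | dot x x <= 1]).
    apply: vmeasI; [apply: vmeas_lt|apply: vmeas_le] => //;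
      by apply: measurable_fun_dot; exact: vfun_tcol.
  by apply/seteqP; split => x /= => [/andP[]//|[-> ->]].
exact: vfun_meas vfun_to_sphere mA.
Qed.

Lemma svolE A : vmeas A -> vleb (scone A) = (svol A)%:E.
Proof.
move=> mA; rewrite /svol fineK// ge0_fin_numE ?vleb_ge0//.
apply: le_lt_trans (@vleb_unit_ball_fin R n.+1).
apply: le_vleb; [exact: vmeas_scone|exact: vmeas_unit_ball|].
by move=> x [/andP[]].
Qed.

Lemma svol_ge0 A : 0 <= svol A.
Proof. by rewrite fine_ge0 ?vleb_ge0. Qed.

Lemma le_svol A B : vmeas A -> vmeas B -> A `&` S `<=` B -> svol A <= svol B.
Proof.
move=> mA mB AB; rewrite -lee_fin -!svolE//.
apply: le_vleb; [exact: vmeas_scone|exact: vmeas_scone|].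
move=> x [/andP[x0 x1] xA]; split; first by rewrite x0.
by apply: AB; split => //; exact: sphere_to_sphere.
Qed.

Lemma svol_set0 : svol set0 = 0.
Proof.
rewrite /svol (_ : scone set0 = set0) ?(measure0 (lebT R n.+1))//.
  by rewrite /vleb (_ : mkset _ = set0) ?measure0.
by apply/seteqP; split => // x [].
Qed.

Lemma svolU_le A B : vmeas A -> vmeas B -> svol (A `|` B) <= svol A + svol B.
Proof.
move=> mA mB; rewrite -lee_fin EFinD -!svolE//; last exact: vmeasU.
apply: le_trans (measureU2 (lebT R n.+1) (vmeas_scone mA) (vmeas_scone mB)).
apply: le_measure; rewrite ?inE.
- exact: vmeas_scone (vmeasU _ _).
- by apply: measurableU; exact: vmeas_scone.
- by move=> t [t1 [tA|tB]]; [left|right].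
Qed.

Lemma svolU_disj A B : vmeas A -> vmeas B -> (forall x, S x -> A x -> B x ->
  False) ->
  svol (A `|` B) = svol A + svol B.
Proof.
move=> mA mB AB; apply: EFin_inj; rewrite EFinD -!svolE//; last exact: vmeasU.
rewrite -[RHS]measureU//; try exact: vmeas_scone.
  congr (lebT _ _ _); apply/seteqP; split => t; rewrite /scone/=.
    by move=> [? [?|?]]; [left|right].
  by move=> [] [? ?]; split => //; [left|right].
apply/seteqP; split => // t [[/andP[t0 _] tA] [_ tB]].
exact: AB (sphere_to_sphere t0) tA tB.
Qed.

Lemma svolU A B : vmeas A -> vmeas B -> svol (A `&` B) = 0 ->
  svol (A `|` B) = svol A + svol B.
Proof.
move=> mA mB AB0; have mBC := vmeasC mA.
have mBA : vmeas (B `&` ~` A) by exact: vmeasI.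
have -> : svol B = svol (B `&` ~` A).
  rewrite -[RHS]addr0 -AB0 -svolU_disj//; first last.
  - by move=> x _ [_ ?] [].
  - exact: vmeasI.
  congr svol; apply/seteqP; split => x; last by case=> -[].
  by move=> Bx; have [Ax|nAx] := pselect (A x); [right|left].
rewrite -svolU_disj//; last by move=> x _ Ax [].
congr svol; apply/seteqP; split => x; last by case=> [|[]]; [left|right].
by have [Ax _|nAx [//|Bx]] := pselect (A x); [left|right].
Qed.

(** Continuity from below. *)
Lemma svol_bigcup_approx (A : nat -> set V) (e : R) : 0 < e ->
  (forall k, vmeas (A k)) -> (forall k l, (k <= l)%N -> A k `<=` A l) ->
  exists k, svol (\bigcup_i A i) - e < svol (A k).
Proof.
move=> e0 mA ndA.
have mU : vmeas (\bigcup_i A i).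
  rewrite /vmeas (_ : mkset _ = \bigcup_i [set t | A i (tcol t)]).
    exact: bigcupT_measurable.
  by apply/seteqP; split => t [k _ ?]; exists k.
have cv : vleb (scone (A k)) @[k --> \oo] --> vleb (scone (\bigcup_i A i)).
  have := @nondecreasing_cvg_mu _ _ _ (lebT R n.+1)
    (fun k => [set t | scone (A k) (tcol t)]).
  rewrite (_ : \bigcup_i _ = [set t | scone (\bigcup_i A i) (tcol t)]);
    last first.
    apply/seteqP; split => t; first by move=> [k _ [? ?]]; split => //;
      exists k.
    by move=> [? [k _ ?]]; exists k.
  apply.
  - by move=> k; exact: vmeas_scone.
  - exact: vmeas_scone.
  - move=> k l kl; apply/subsetPset => t [? Ak]; split => //;
      exact: ndA kl _ Ak.
have {}cv : svol (A k) @[k --> \oo] --> svol (\bigcup_i A i).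
  by apply: (fine_cvg (f := fun k => vleb (scone (A k)))); rewrite -svolE.
have /cvgrPdist_lt/(_ e e0)[k _ /(_ k (leqnn k))] := cv.
by move=> h; exists k; move: h; rewrite ltr_norml => /andP[_]; lra.
Qed.

Lemma svol_orth g A : orth g -> vmeas A -> svol [set x | A (g *m x)] = svol A.
Proof.
move=> gg mA; apply: EFin_inj; rewrite -!svolE//; last exact: vmeas_mulmx.
rewrite -(vleb_orth gg (vmeas_scone mA)); congr vleb.
by apply/seteqP; split => x; rewrite /scone/= orth_dot// to_sphere_orth.
Qed.

Lemma image_orth g A : orth g -> mulmx g @` A = [set x | A (g^T *m x)].
Proof.
move=> gg; apply/seteqP; split => [_ [x Ax <-]|x Ax]; first by rewrite /= orthK.
by exists (g^T *m x) => //; rewrite orthKV.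
Qed.

Lemma vmeas_image g A : orth g -> vmeas A -> vmeas (mulmx g @` A).
Proof. by move=> gg mA; rewrite image_orth//; exact: vmeas_mulmx. Qed.

Lemma svol_image g A : orth g -> vmeas A -> svol (mulmx g @` A) = svol A.
Proof.
by move=> gg mA; rewrite image_orth// svol_orth//; exact: orth_trmx.
Qed.

Lemma vmeas_hyper (l : V) : vmeas [set x | dot l x = 0].
Proof.
rewrite (_ : mkset _ = [set x | dot l x <= 0] `&` [set x | 0 <= dot l x]).
  by apply: vmeasI; apply: vmeas_le => //; exact: vmeas_dot.
apply/seteqP; split => x; first by move=> /= ->.
by move=> [/= ? ?]; apply/le_anti/andP.
Qed.

(** An orthogonal matrix takes the hyperplane to the coordinate hyperplane. *)
Lemma svol_hyper (l : V) : l != 0 -> svol [set x | dot l x = 0] = 0.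
Proof.
move=> l0; set nl := Num.sqrt (dot l l).
have nl0 : nl != 0 by rewrite sqrtr_eq0 -ltNge dot_gt0.
have [g [gg gl]] : exists g, orth g /\ g *m l = nl *: delta_mx 0 0.
  apply: orth_transitive; rewrite dotZl dotZr mulrA -expr2 sqr_sqrtr ?dot_ge0//.
  rewrite [X in _ * X](_ : _ = 1) ?mulr1// /dot (bigD1 0)//= big1 ?addr0 ?mxE
    ?mulr1// => i i0.
  by rewrite !mxE (negbTE i0) mul0r.
have lE x : dot l x = nl * (g *m x) 0 0.
  rewrite -(orth_dot l x gg) gl dotZl; congr (_ * _).
  rewrite /dot (bigD1 0)//= big1 ?addr0 => [|i i0]; rewrite !mxE.
    by rewrite eqxx mul1r.
  by rewrite (negbTE i0) mul0r.
pose Z : set V := [set x | x ord0 ord0 = 0].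
have mZ : vmeas Z.
  rewrite (_ : Z = [set x | dot (delta_mx 0 0) x = 0]);
    first exact: vmeas_hyper.
  apply/seteqP; split => x; rewrite /Z /dot/= (bigD1 0)//= big1 ?addr0 ?mxE
    ?eqxx ?mul1r// => i i0;
   by rewrite !mxE (negbTE i0) mul0r.
apply: EFin_inj; rewrite -svolE; last exact: vmeas_hyper.
apply/le_anti/andP; split; last exact: vleb_ge0.
have -> : 0%:E = vleb [set x | Z (g *m x)] by rewrite vleb_orth// vleb_coord0.
apply: le_vleb; [exact: vmeas_scone (vmeas_hyper _)|exact: vmeas_mulmx|].
move=> x [/andP[x0 _]] /= /eqP;
  rewrite lE mulf_eq0 (negbTE nl0)/= -to_sphere_orth//.
rewrite to_sphereE mxE orth_dot// mulf_eq0 invr_eq0 sqrtr_eq0 leNgt x0/=.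
by move=> /eqP.
Qed.

End sphere_measure.

(** * Spherical caps *)

Section caps.
Variables (R : realType) (n : nat).
Local Notation V := 'cV[R]_n.+1.
Local Notation S := (sphere (R := R) (n := n)).
Local Notation K := (n.+1%:R : R).
Implicit Types (x y : V) (A B : set V) (g : 'M[R]_n.+1).

Lemma mxballE x r y : ball x r y <-> forall i, `|x i 0 - y i 0| < r.
Proof.
split => [[_ xy] i|xy]; first exact: xy i 0.
split => [|i j]; first exact: le_lt_trans (normr_ge0 _) (xy ord0).
by rewrite ord1; exact: xy.
Qed.

Lemma orth_entry g i j : orth g -> `|g i j| <= 1.
Proof.
move=> gg; have -> : g i j = (col j g) i 0 by rewrite mxE.
apply: coord_le1; have <- : (g^T *m g) j j = 1 by rewrite gg mxE eqxx.
by rewrite [leRHS]mxE; apply: ler_sum => k _; rewrite !mxE.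
Qed.

(** Balls are those of the supremum norm, which orthogonal matrices do not
preserve; they distort it by at most the factor [K = n + 1]. *)
Lemma orth_ball g x y r : orth g -> ball x r y ->
  ball (g *m x) (K * r) (g *m y).
Proof.
move=> gg /mxballE xy; apply/mxballE => i.
have -> : (g *m x) i 0 - (g *m y) i 0 = \sum_j g i j * (x j 0 - y j 0).
  by rewrite !mxE -sumrB; apply: eq_bigr => j _; rewrite mulrBr.
apply: le_lt_trans (ler_norm_sum _ _ _) _.
apply: (@lt_le_trans _ _ (\sum_(j < n.+1) r));
  last by rewrite sumr_const card_ord mulr_natl.
apply: ltr_sum => [|j _]; first by apply/hasP; exists ord0;
  rewrite ?mem_index_enum.
rewrite normrM; apply: le_lt_trans (xy j).
by rewrite ler_piMl// orth_entry.
Qed.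

Definition cap x r : set V := S `&` ball x r.

Lemma vmeas_ball x r : vmeas (ball x r).
Proof.
rewrite (_ : ball x r = \bigcap_(i in [set: 'I_n.+1]) [set y | `|x i 0 - y i 0|
  < r]); last first.
  apply/seteqP; split => y; first by move=> /mxballE xy i _; exact: xy.
  by move=> xy; apply/mxballE => i; exact: xy.
rewrite /vmeas (_ : mkset _ = \bigcap_(i in [set: 'I_n.+1]) [set t | `|x i 0 -
  tcol t i 0| < r])//.
apply: fin_bigcap_measurable => // i _.
apply: (@vmeas_lt R n.+1 (fun y => `|x i 0 - y i 0|) (fun=> r)) => //.
apply: measurableT_comp => //; apply: measurable_funB => //; exact: vfun_tcol.
Qed.

Lemma vmeas_cap x r : vmeas (cap x r).
Proof. by apply: vmeasI; [exact: vmeas_sphere|exact: vmeas_ball]. Qed.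

Lemma le_cap x r s : r <= s -> cap x r `<=` cap x s.
Proof. by move=> rs y [Sy xy]; split => //; exact: le_ball rs _ xy. Qed.

Lemma image_cap g x r : orth g -> mulmx g @` cap x r `<=` cap (g *m x) (K * r).
Proof.
move=> gg _ [y [Sy xy] <-]; split; first exact: sphere_orth.
exact: orth_ball.
Qed.

Definition e0 : V := delta_mx 0 0.

Lemma e0E i : e0 i 0 = (i == 0)%:R.
Proof. by rewrite !mxE andbT. Qed.

Lemma dot_e0 x : dot x e0 = x 0 0.
Proof.
rewrite /dot (bigD1 0)//= big1 ?addr0 => [|i i0]; rewrite e0E ?mulr1//.
by rewrite (negbTE i0) mulr0.
Qed.

Lemma sphere_e0 : S e0.
Proof. by apply/sphereE; rewrite dot_e0 e0E. Qed.

Lemma to_e0 x : S x -> exists g, orth g /\ g *m x = e0.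
Proof.
by move=> /sphereE Sx; apply: orth_transitive; have /sphereE -> := sphere_e0.
Qed.

(** In the first coordinate [y] differs from the pole by at most 1 - y_0 ^ 2,
which is the sum of the squares of the other coordinates. *)
Lemma near_e0 y r s : S y -> 0 <= y 0 0 -> 0 <= s ->
  (forall i, i != 0 -> `|y i 0| <= s) -> s < r -> n%:R * s ^+ 2 < r ->
    ball e0 r y.
Proof.
move=> /sphereE Sy y0 s0 ys sr nsr; apply/mxballE => i; rewrite e0E.
have [->|i0] := eqVneq i 0; last by rewrite sub0r normrN;
  exact: le_lt_trans (ys _ i0) sr.
have y1 : y 0 0 <= 1.
  by have := @coord_le1 R _ y 0; rewrite Sy lexx ger0_norm//; apply.
rewrite ger0_norm ?subr_ge0//; apply: le_lt_trans nsr.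
apply: (@le_trans _ _ (1 - y 0 0 ^+ 2));
  first by rewrite lerD2l lerN2 expr2 ler_piMr.
rewrite -{1}Sy /dot big_ord_recl/= -expr2 addrAC subrr add0r.
apply: (@le_trans _ _ (\sum_(i < n) s ^+ 2));
  last by rewrite sumr_const card_ord mulr_natl.
apply: ler_sum => j _; rewrite -expr2 -real_normK ?num_real// ler_pXn2r//
  ?nnegrE//.
exact: ys.
Qed.

Let ubox (r : R) (i : nat) : R := if i is 0%N then 1 else r.

(** The cone over the cap lies in a box with one side 2 and the others [2 *
r]. *)
Lemma svol_cap_e0_le r : 0 <= r -> svol (cap e0 r) <= 2 * (2 * r) ^+ n.
Proof.
move=> r0; have ab i : - ubox r i <= ubox r i by case: i => [|i] /=; lra.
rewrite -lee_fin -svolE; last exact: vmeas_cap.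
have -> : 2 * (2 * r) ^+ n = \prod_(i < n.+1) (ubox r i - - ubox r i).
  rewrite big_ord_recl /= prodr_const card_ord; congr (_ * _ ^+ _); lra.
rewrite -(@vleb_box R n.+1 (fun i => - ubox r i) (ubox r))//.
apply: le_vleb; [exact: vmeas_scone (vmeas_cap _ _)|exact: vmeas_box|].
move=> x [/andP[x0 x1] [_ /mxballE xr]] i; rewrite -ler_norml.
have [j ->|->] /= := unliftP 0 i; last exact: coord_le1.
have := xr (lift 0 j); rewrite e0E /= sub0r normrN to_sphereE mxE normrM.
rewrite gtr0_norm ?invr_gt0 ?sqrtr_gt0// mulrC ltr_pdivrMr ?sqrtr_gt0// =>
  /ltW/le_trans; apply.
by rewrite ler_piMr// -sqrtr1 ler_sqrt.
Qed.

Lemma svol_cap_le x r : S x -> 0 <= r ->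
  svol (cap x r) <= 2 * (2 * K) ^+ n * r ^+ n.
Proof.
move=> /to_e0[g [gg gx]] r0; rewrite -mulrA -exprMn -mulrA.
apply: le_trans (svol_cap_e0_le _); last exact: mulr_ge0.
rewrite -(svol_image gg (vmeas_cap _ _)) -gx.
apply: le_svol; [exact: vmeas_image (vmeas_cap _ _)|exact: vmeas_cap|].
by move=> y [+ _]; exact: image_cap.
Qed.

Let c : R := (8 * K)^-1.
Let lbox (r : R) (i : nat) : R := if i is 0%N then 4^-1 else - (c * r).
Let hbox (r : R) (i : nat) : R := if i is 0%N then 2^-1 else c * r.

(** The cone over the cap contains the points whose first coordinate lies in
[1/4, 1/2] and whose other coordinates are at most r / (8 K): projecting them
to the sphere multiplies the coordinates by at most 4. *)
Lemma svol_cap_e0_ge r : 0 < r -> r <= 1 ->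
  4^-1 * (2 * (8 * K)^-1) ^+ n * r ^+ n <= svol (cap e0 r).
Proof.
move=> r0 r1; have K0 : 0 < K by rewrite ltr0n.
have K1 : 1 <= K by rewrite ler1n.
have nK : n%:R <= K by rewrite ler_nat.
have n0 : 0 <= n%:R :> R by [].
have c0 : 0 < c by rewrite invr_gt0 mulr_gt0.
have cK : c * K = 8^-1 by rewrite /c; field; rewrite gt_eqF.
have c8 : c <= 8^-1 by nra.
have cr0 : 0 < c * r by exact: mulr_gt0.
have crc : c * r <= c by rewrite ler_piMr// ltW.
have ab i : lbox r i <= hbox r i by case: i => [|i] /=; lra.
rewrite -lee_fin -svolE; last exact: vmeas_cap.
rewrite -mulrA -exprMn.
have -> : 4^-1 * (2 * (8 * K)^-1 * r) ^+ n = \prod_(i < n.+1) (hbox r i - lbox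
  r i).
  rewrite big_ord_recl /= prodr_const card_ord -/c; congr (_ * _ ^+ _); lra.
rewrite -vleb_box//.
apply: le_vleb; [exact: vmeas_box|exact: vmeas_scone (vmeas_cap _ _)|].
move=> x xB.
have /andP[x0l x0h] : 4^-1 <= x 0 0 <= 2^-1 by exact: (xB 0).
have xi j : j != 0 -> `|x j 0| <= c * r.
  by move: (xB j); have [k ->|->]// := unliftP 0 j; rewrite /= ler_norml.
have xx0 : 16^-1 <= dot x x by apply: le_trans (dot_coord_le x 0); nra.
have xx1 : dot x x <= 1.
  rewrite /dot big_ord_recl/= -expr2.
  apply: (@le_trans _ _ (4^-1 + \sum_(i < n) c ^+ 2)).
    apply: lerD; first by nra.
    apply: ler_sum => j _; rewrite -expr2 -real_normK ?num_real// ler_pXn2r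
      ?nnegrE ?(ltW c0)//.
    by apply: le_trans crc; exact: xi.
  rewrite sumr_const card_ord -mulr_natl expr2.
  have : n%:R * c <= 8^-1 by rewrite -cK mulrC ler_pM2l.
  nra.
have xxp : 0 < dot x x by apply: lt_le_trans xx0.
split; first by rewrite xxp.
have sq4 : 4^-1 <= Num.sqrt (dot x x).
  have -> : 4^-1 = Num.sqrt (4^-1 ^+ 2) :> R by rewrite sqrtr_sqr ger0_norm.
  by rewrite ler_sqrt//; apply: le_trans xx0; lra.
have Sx := sphere_to_sphere xxp; split => //.
apply: (@near_e0 _ _ (4 * (c * r))) => //.
- rewrite to_sphereE mxE mulr_ge0// ?invr_ge0 ?sqrtr_ge0//; lra.
- lra.
- move=> j j0; rewrite to_sphereE mxE normrM gtr0_norm ?invr_gt0; last lra.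
  rewrite mulrC ler_pdivrMr; last lra.
  have := xi j j0; nra.
- nra.
- have : n%:R * c <= 8^-1 by rewrite -cK mulrC ler_pM2l.
  have : 0 <= n%:R * c by rewrite mulr_ge0// ltW.
  have -> : n%:R * (4 * (c * r)) ^+ 2 = 16 * ((n%:R * c) * (c * r)) * r by ring.
  move: (n%:R * c) => p p0 p8.
  have : p * (c * r) <= 8^-1 * 8^-1 by apply: ler_pM => //; lra.
  move: (p * (c * r)) => pq; nra.
Qed.

(** The constant does not depend on the centre because an orthogonal matrix
moves the cap to the pole, at the cost of the factor [K] in the radius. *)
Lemma svol_cap_ge : exists2 C : R, 0 < C &
  forall x r, S x -> 0 < r -> r <= 1 -> C * r ^+ n <= svol (cap x r).
Proof.
have K0 : 0 < K by rewrite ltr0n.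
exists (4^-1 * (2 * (8 * K)^-1) ^+ n * K^-1 ^+ n).
  by rewrite !mulr_gt0// exprn_gt0// ?mulr_gt0// invr_gt0// mulr_gt0.
move=> x r /to_e0[g [gg gx]] r0 r1.
rewrite -[leLHS]mulrA -[X in _ * X <= _]exprMn.
have rK0 : 0 < K^-1 * r by rewrite mulr_gt0// invr_gt0.
have rK1 : K^-1 * r <= 1.
  rewrite ler_pdivrMl// mulr1; apply: le_trans r1 _; by rewrite ler1n.
apply: le_trans (svol_cap_e0_ge rK0 rK1) _.
rewrite -(svol_image (orth_trmx gg) (vmeas_cap _ _)).
apply: le_svol; [exact: vmeas_image (orth_trmx gg) (vmeas_cap _ _)|exact:
  vmeas_cap|].
move=> y [/(image_cap (orth_trmx gg)) + _].
by rewrite -gx orthK// mulrA divff ?mul1r// gt_eqF.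
Qed.

End caps.

(** * Negligible sets *)

Section negligible.
Variables (R : realType) (n : nat).
Local Notation V := 'cV[R]_n.+1.
Local Notation S := (sphere (R := R) (n := n)).
Implicit Types (x y : V) (A B X Y Z P : set V) (g M : 'M[R]_n.+1).

Definition negl A := exists Z : seq V, all (fun l => l != 0) Z /\
  forall x, S x -> A x -> exists2 l, l \in Z & dot l x = 0.

Lemma negl0 : negl set0.
Proof. by exists [::]. Qed.

Lemma neglS A B : (forall x, S x -> A x -> B x) -> negl B -> negl A.
Proof. by move=> AB [Z [Z0 ZB]]; exists Z;
  split => // x Sx /(AB _ Sx)/(ZB _ Sx). Qed.

Lemma neglU A B : negl A -> negl B -> negl (A `|` B).
Proof.
move=> [Z [Z0 ZA]] [Y [Y0 YB]]; exists (Z ++ Y); split;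
  first by rewrite all_cat Z0.
move=> x Sx [/(ZA _ Sx)|/(YB _ Sx)] [l lZ lx]; exists l => //;
  by rewrite mem_cat lZ ?orbT.
Qed.

Lemma negl_bigcup_seq (I : eqType) (s : seq I) (A : I -> set V) :
  (forall i, i \in s -> negl (A i)) ->
  negl [set x | exists2 i, i \in s & A i x].
Proof.
elim: s => [_|i s IH sA]; first by apply: neglS negl0 => x _ [].
apply: neglS (neglU (sA i (mem_head _ _)) (IH _)) => [x _ [j]|j js].
  by rewrite inE => /predU1P[->|js] Ax; [left|right; exists j].
by apply: sA; rewrite inE js orbT.
Qed.

Lemma negl_bigcup (I : finType) (A : I -> set V) :
  (forall i, negl (A i)) -> negl (\bigcup_i A i).
Proof.
move=> nA; apply: neglS (negl_bigcup_seq (s := index_enum I) (fun i _ => nA i)).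
by move=> x _ [i _ Ax]; exists i => //; exact: mem_index_enum.
Qed.

Lemma negl_hyper (l : V) : l != 0 -> negl [set x | dot l x = 0].
Proof.
move=> l0; exists [:: l]; split => [|x _ lx]; first by rewrite /= l0.
by exists l => //; rewrite inE.
Qed.

Lemma negl_image g A : orth g -> negl A -> negl (mulmx g @` A).
Proof.
move=> gg [Z [Z0 ZA]]; exists [seq g *m l | l <- Z]; split.
  apply/allP => _ /mapP[l lZ ->]; rewrite -dot_gt0 orth_dot// dot_gt0.
  exact: (allP Z0).
move=> x Sx [y Ay yx]; have Sy : S y.
  by rewrite -(orthK gg y) yx; apply: sphere_orth => //; exact: orth_trmx.
have [l lZ ly] := ZA y Sy Ay; exists (g *m l); first exact: map_f.
by rewrite -yx orth_dot.
Qed.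

Lemma svol_negl A : vmeas A -> negl A -> svol A = 0.
Proof.
move=> mA [Z [Z0 ZA]].
have : svol [set x | exists2 l, l \in Z & dot l x = 0] = 0 /\
       vmeas [set x | exists2 l, l \in Z & dot l x = 0].
  elim: Z Z0 {ZA} => [_|l Z IH /= /andP[l0 /IH[vZ mZ]]].
    rewrite (_ : mkset _ = set0); first by rewrite svol_set0; split => //;
      exact: vmeas0.
    by apply/seteqP; split => // x [].
  rewrite (_ : mkset _ = [set x | dot l x = 0] `|` [set x | exists2 l,
    l \in Z & dot l x = 0]).
    split; last by apply: vmeasU => //; exact: vmeas_hyper.
    apply/le_anti; rewrite svol_ge0 andbT;
      apply: le_trans (svolU_le _ _) _ => //.
      exact: vmeas_hyper.
    by rewrite svol_hyper// vZ addr0.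
  apply/seteqP; split => x.
    by move=> [l']; rewrite inE => /predU1P[->|lZ]; [left|right; exists l'].
  move=> [lx|[l' lZ l'x]]; first by exists l; rewrite // mem_head.
  by exists l' => //; rewrite inE lZ orbT.
move=> [vZ mZ]; apply/le_anti; rewrite svol_ge0 andbT -vZ.
by apply: le_svol => // x [Ax Sx]; exact: ZA.
Qed.

End negligible.

(** * Simplicial cones *)

Section simplex.
Variables (R : realType) (n : nat).
Local Notation V := 'cV[R]_n.+1.
Local Notation S := (sphere (R := R) (n := n)).
Implicit Types (x y : V) (A B X Y Z P : set V) (g M : 'M[R]_n.+1).

Lemma unitmx_inj M : (forall c : V, M *m c = 0 -> c = 0) -> M \in unitmx.
Proof.
move=> Minj; rewrite -unitmx_tr -row_free_unit; apply: inj_row_free => v vM.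
by apply: trmx_inj; rewrite trmx0; apply: Minj;
  rewrite -[M]trmxK -trmx_mul vM trmx0.
Qed.

Definition nneg (c : V) := forall i, 0 <= c i 0.

(** The spherical simplex spanned by the columns of [M]; it is a simplicial
cone cut by the sphere. *)
Definition simp M : set V := [set x | S x /\ exists2 c, nneg c & x = M *m c].

(** The facets of the cone spanned by the columns of [M] are given by the dual
basis. *)
Definition facet M i : V := (row i (invmx M))^T.

Lemma facetE M i x : dot (facet M i) x = (invmx M *m x) i 0.
Proof. by rewrite [RHS]mxE; apply: eq_bigr => j _; rewrite !mxE. Qed.

Lemma facet_neq0 M i : M \in unitmx -> facet M i != 0.
Proof.
move=> uM; apply/eqP => f0.
have := facetE M i (M *m delta_mx i 0); rewrite f0 mulKmx// mxE !eqxx.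
rewrite /dot big1 => [/eqP|j _]; first by rewrite eq_sym oner_eq0.
by rewrite mxE mul0r.
Qed.

Lemma simpE M : M \in unitmx ->
  simp M = S `&` [set x | forall i, 0 <= dot (facet M i) x].
Proof.
move=> uM; apply/seteqP; split => x.
  by move=> [Sx [c c0 xE]]; split => // i; rewrite facetE xE mulKmx.
move=> [Sx xM]; split => //; exists (invmx M *m x); last by rewrite mulKVmx.
by move=> i; rewrite -facetE; exact: xM.
Qed.

Lemma sumrZ_mulmx (v : 'I_n.+1 -> V) (a : 'I_n.+1 -> R) :
  \sum_i a i *: v i = (\matrix_(i, j) v j i 0) *m (\col_i a i).
Proof.
apply/colP => i; rewrite summxE mxE; apply: eq_bigr => j _.
by rewrite !mxE mulrC.
Qed.

Lemma free_unitmx (v : 'I_n.+1 -> V) :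
  free [tuple v i | i < n.+1] = (\matrix_(i, j) v j i 0 \in unitmx).
Proof.
apply/freeP/idP => [vf|uM k].
  apply: unitmx_inj => c Mc; apply/colP => i; rewrite mxE.
  apply: (vf (fun i => c i 0)).
  under eq_bigr do rewrite -tnth_nth tnth_mktuple.
  rewrite sumrZ_mulmx -[RHS]Mc; congr (_ *m _).
  by apply/colP => j; rewrite mxE.
under eq_bigr do rewrite -tnth_nth tnth_mktuple.
rewrite sumrZ_mulmx => /(congr1 (mulmx (invmx (\matrix_(i, j) v j i 0)))).
by rewrite mulKmx// mulmx0 => /colP k0 i; have := k0 i; rewrite !mxE.
Qed.

Lemma to_sphere_conv_hull (v : 'I_n.+1 -> V) :
  \matrix_(i, j) v j i 0 \in unitmx ->
  @to_sphere R n @` conv_hull v = simp (\matrix_(i, j) v j i 0).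
Proof.
set M := \matrix_(i, j) _ => uM; apply/seteqP;
  split => [_ [x [a [a0 a1 xE]] <-]|x].
  have xx0 : 0 < dot x x.
    rewrite dot_gt0; apply/eqP => x0; move: a1; rewrite big1 => [/eqP|i _].
      by rewrite eq_sym oner_eq0.
    move: xE; rewrite x0 sumrZ_mulmx -/M => /esym/(congr1 (mulmx (invmx M))).
    by rewrite mulKmx// mulmx0 => /colP/(_ i); rewrite !mxE.
  split; first exact: sphere_to_sphere.
  exists ((Num.sqrt (dot x x))^-1 *: \col_i a i).
    by move=> i; rewrite !mxE mulr_ge0// invr_ge0 sqrtr_ge0.
  by rewrite to_sphereE -scalemxAr xE sumrZ_mulmx.
move=> [Sx [c c0 xE]]; pose s := \sum_i c i 0.
have s0 : 0 < s.
  rewrite lt_def sumr_ge0 ?andbT//; apply/eqP => s0.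
  have cE : c = 0.
    apply/colP => i; rewrite mxE; apply/eqP.
    by move/eqP: s0; rewrite psumr_eq0// => /allP/(_ i (mem_index_enum i)).
  by move/sphereE: Sx => /eqP;
    rewrite xE cE mulmx0 lt_eqF// (eqP (_ : dot 0 0 == 0)) ?dot_eq0// eq_sym
    oner_eq0.
exists (s^-1 *: x); last first.
  by rewrite to_sphereZ ?invr_gt0// to_sphere_id.
exists (fun i => s^-1 * c i 0); split.
- by move=> i; rewrite mulr_ge0// invr_ge0 ltW.
- by rewrite -mulr_sumr mulVf// gt_eqF.
- rewrite sumrZ_mulmx xE scalemxAr; congr (_ *m _).
  by apply/colP => i; rewrite !mxE.
Qed.

(** Rescaling the columns of [M] does not change the cone, so the vertices need
not be unit vectors; linear independence excludes the origin from their
hull. *)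
Lemma is_simplexP T : is_simplex T <-> exists2 M, M \in unitmx & T = simp M.
Proof.
split => [[v [vS vfree v0 ->]]|[M uM ->]].
  exists (\matrix_(i, j) v j i 0); first by rewrite -free_unitmx.
  by rewrite to_sphere_conv_hull// -free_unitmx.
pose nr j := Num.sqrt (dot (col j M) (col j M)).
have cM0 j : 0 < dot (col j M) (col j M).
  rewrite dot_gt0; apply/eqP => cj0.
  have : M *m (delta_mx j 0 : V) = 0 by rewrite -colE.
  move/(congr1 (mulmx (invmx M))); rewrite mulKmx// mulmx0 => /colP/(_ j).
  by rewrite !mxE !eqxx => /eqP; rewrite oner_eq0.
have nr0 j : 0 < nr j by rewrite sqrtr_gt0.
pose v j := to_sphere (col j M).
have vE c : (\matrix_(i, j) v j i 0) *m c = M *m (\col_j ((nr j)^-1 * c j 0)).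
  have vE' i j : v j i 0 = (nr j)^-1 * M i j by rewrite /v to_sphereE !mxE.
  apply/colP => i; rewrite [LHS]mxE [RHS]mxE; apply: eq_bigr => j _.
  by rewrite [in RHS]mxE [X in X * _]mxE vE' mulrA [M i j * _]mulrC.
have uv : \matrix_(i, j) v j i 0 \in unitmx.
  apply: unitmx_inj => c; rewrite vE => /(congr1 (mulmx (invmx M))).
  rewrite mulKmx// mulmx0 => /colP c0; apply/colP => j; have := c0 j;
    rewrite !mxE.
  by move/eqP; rewrite mulf_eq0 invr_eq0 gt_eqF//= => /eqP.
exists v; split.
- by move=> i; exact: sphere_to_sphere.
- by rewrite free_unitmx.
- move=> [a [a0 a1 /esym]];
    rewrite sumrZ_mulmx => /(congr1 (mulmx (invmx (\matrix_(i, j) v j i 0)))).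
  rewrite mulKmx// mulmx0 => /colP aE; move: a1; rewrite big1 => [/eqP|i _].
    by rewrite eq_sym oner_eq0.
  by have := aE i; rewrite !mxE.
- rewrite to_sphere_conv_hull//; apply/seteqP; split => x [Sx [c c0 xE]];
    split => //.
    exists (\col_j (nr j * c j 0)) => [j|]; first by rewrite mxE mulr_ge0// ltW.
    rewrite vE xE; congr (_ *m _); apply/colP => j;
      rewrite !mxE mulrA mulVf ?mul1r//.
    by rewrite gt_eqF.
  exists (\col_j ((nr j)^-1 * c j 0)); last by rewrite -vE.
  by move=> j; rewrite mxE mulr_ge0// invr_ge0 ltW.
Qed.

Definition simps (s : seq 'M[R]_n.+1) : set V :=
  [set x | exists2 M, M \in s & simp M x].

Lemma is_polytopeP P : is_polytope P <->
  exists2 s : seq 'M[R]_n.+1, all (fun M => M \in unitmx) s & P = simps s.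
Proof.
split => [[m [T [Ts ->]]]|[s us ->]].
  have /choice[M ME] : forall i, exists M, M \in unitmx /\ T i = simp M.
    by move=> i; have /is_simplexP[M ? ?] := Ts i; exists M.
  exists [seq M i | i <- enum 'I_m].
    by apply/allP => _ /mapP[i _ ->]; have [] := ME i.
  apply/seteqP; split => x.
    move=> [i _ Tx]; exists (M i); first by rewrite map_f ?mem_enum.
    by have [_ <-] := ME i.
  by move=> [_ /mapP[i _ ->] Mx]; exists i => //; have [_ ->] := ME i.
exists (size s), (fun i : 'I_(size s) => simp (tnth (in_tuple s) i)); split.
  move=> i; apply/is_simplexP; exists (tnth (in_tuple s) i) => //.
  by apply: (allP us); exact: mem_tnth.
apply/seteqP; split => x.
  by move=> [M /(tnthP (in_tuple s))[i ->] Mx]; exists i.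
by move=> [i _ Mx]; exists (tnth (in_tuple s) i) => //; exact: mem_tnth.
Qed.

End simplex.

(** * Polytopes up to negligible sets *)

Section almost_polytope.
Variables (R : realType) (n : nat).
Local Notation V := 'cV[R]_n.+1.
Local Notation S := (sphere (R := R) (n := n)).
Implicit Types (x y : V) (A B X Y Z P : set V) (g M : 'M[R]_n.+1).

Definition apoly X := exists P,
  [/\ is_polytope P, negl (P `\` X) & negl (X `\` P)].

Lemma negl_trans X Y Z : negl (X `\` Y) -> negl (Y `\` Z) -> negl (X `\` Z).
Proof.
move=> XY YZ; apply: neglS (neglU XY YZ) => x _ [Xx nZx].
by have [Yx|nYx] := pselect (Y x); [right|left].
Qed.

Lemma neglD0 X Y : (forall x, S x -> X x -> Y x) -> negl (X `\` Y).
Proof. by move=> XY; apply: neglS (negl0 _ _) => x Sx [Xx []]; exact: XY. Qed.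

Lemma apoly_eqv X Y : negl (X `\` Y) -> negl (Y `\` X) -> apoly X -> apoly Y.
Proof.
move=> XY YX [P [polyP PX XP]]; exists P; split => //;
  first exact: negl_trans XY.
exact: negl_trans XP.
Qed.

Lemma polytope_sphere P : is_polytope P -> P `<=` S.
Proof. by move=> /is_polytopeP[s _ ->] x [M _ []]. Qed.

Lemma is_polytopeU P Q : is_polytope P -> is_polytope Q ->
  is_polytope (P `|` Q).
Proof.
move=> /is_polytopeP[s us ->] /is_polytopeP[t ut ->]; apply/is_polytopeP.
exists (s ++ t); first by rewrite all_cat us.
apply/seteqP; split => x.
  by move=> [] [M Ms Mx]; exists M; rewrite // mem_cat Ms ?orbT.
by move=> [M]; rewrite mem_cat => /orP[] Ms Mx; [left|right]; exists M.
Qed.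

Lemma apoly_polytope P : is_polytope P -> apoly P.
Proof. by move=> polyP; exists P; split => //; exact: neglD0. Qed.

Lemma apolyU X Y : apoly X -> apoly Y -> apoly (X `|` Y).
Proof.
move=> [P [polyP PX XP]] [Q [polyQ QY YQ]]; exists (P `|` Q); split.
- exact: is_polytopeU.
- by apply: neglS (neglU PX QY) => x _ [[?|?] nXY]; [left|right]; split => // ?;
    apply: nXY; [left|right].
- by apply: neglS (neglU XP YQ) => x _ [[?|?] nPQ]; [left|right]; split => // ?;
    apply: nPQ; [left|right].
Qed.

Lemma apoly0 : apoly set0.
Proof. exact/apoly_polytope/is_polytope0. Qed.

Lemma apoly_negl X : negl X -> apoly X.
Proof.
move=> nX; apply: apoly_eqv apoly0; first exact: neglD0.
by apply: neglS nX => x _ [].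
Qed.

Lemma apoly_bigcup (I : eqType) (s : seq I) (X : I -> set V) :
  (forall i, i \in s -> apoly (X i)) ->
    apoly [set x | exists2 i, i \in s & X i x].
Proof.
elim: s => [_|i s IH sX].
  by rewrite (_ : mkset _ = set0); [exact: apoly0|apply/seteqP;
    split => // x []].
rewrite (_ : mkset _ = X i `|` [set x | exists2 i, i \in s & X i x]).
  by apply: apolyU; [apply: sX; exact: mem_head|apply: IH => j js; apply: sX;
    rewrite inE js orbT].
apply/seteqP; split => x.
  by move=> [j]; rewrite inE => /predU1P[->|js] ?; [left|right; exists j].
by move=> [?|[j js ?]]; [exists i; rewrite // mem_head|exists j;
  rewrite // inE js orbT].
Qed.

(** Multiplication by this matrix on the right replaces column [q] by [al]
times column [q] plus [be] times column [p]. *)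
Definition replace_mx (p q : 'I_n.+1) (al be : R) : 'M[R]_n.+1 :=
  1%:M + (al - 1) *: delta_mx q q + be *: delta_mx p q.

Lemma replace_mxE p q al be (d : V) : replace_mx p q al be *m d =
  d + ((al - 1) * d q 0) *: delta_mx q 0 + (be * d q 0) *: delta_mx p 0.
Proof.
have dE i j : delta_mx i j *m d = d j 0 *: (delta_mx i 0 : V).
  apply/colP => k; rewrite !mxE (bigD1 j)//= big1 ?addr0 => [|l lj];
    rewrite !mxE.
    by rewrite !eqxx !andbT mulrC.
  by rewrite (negbTE lj) andbF mul0r.
by rewrite !mulmxDl mul1mx -!scalemxAl !dE !scalerA.
Qed.

Lemma replace_mx_coord p q al be (d : V) i : p != q ->
  (replace_mx p q al be *m d) i 0 =
  if i == q then al * d q 0 else if i == p then d p 0 + be * d q 0 else d i 0.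
Proof.
move=> pq; rewrite replace_mxE !mxE !andbT.
have [->|iq] := eqVneq i q;
  first by rewrite eq_sym (negbTE pq) mulr0 addr0 mulr1; ring.
by have [->|ip] := eqVneq i p; rewrite mulr0 addr0 ?mulr1 ?mulr0 ?addr0.
Qed.

Lemma replace_mx_unit p q al be : p != q -> al != 0 ->
  replace_mx p q al be \in unitmx.
Proof.
move=> pq al0; apply: unitmx_inj => d /colP Ed.
have E i := replace_mx_coord al be d i pq.
have dq : d q 0 = 0.
  by have := E q; rewrite Ed eqxx mxE => /esym/eqP;
    rewrite mulf_eq0 (negbTE al0) => /eqP.
apply/colP => i; have := E i; rewrite Ed mxE.
have [->|iq] := eqVneq i q; first by rewrite dq.
by have [->|ip] := eqVneq i p; rewrite ?dq ?mulr0 ?addr0.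
Qed.

(** The new vertex lies on the edge between vertices p and q; the two pieces
keep one of p and q each. A point of the simplex lies in the piece decided by
which of its coordinates along p and q is larger, after weighting by [al] and
[be]. *)
Lemma simp_bisect M p q al be : p != q -> 0 < al -> 0 < be ->
  simp M =
  simp (M *m replace_mx p q al be) `|` simp (M *m replace_mx q p be al).
Proof.
move=> pq al0 be0; have qp : q != p by rewrite eq_sym.
apply/seteqP; split => x.
  move=> [Sx [c c0 xE]].
  wlog le_cc : p q al be pq qp al0 be0 / be * c q 0 <= al * c p 0.
    have [le_cc|/ltW le_cc] := leP (be * c q 0) (al * c p 0); first exact.
    by move=> W; rewrite setUC; apply: W.
  left; split => //.
  exists (\col_i if i == q then c q 0 / al else if i == p then c p 0 - be * (c
    q 0 / al) else c i 0).
    move=> i; rewrite mxE; case: ifP => _; first by rewrite divr_ge0// ltW.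
    case: ifP => _ //.
    by rewrite subr_ge0 mulrA ler_pdivrMr// (mulrC (c p 0)).
  rewrite -mulmxA xE; congr (_ *m _); apply/colP => i.
  rewrite replace_mx_coord// !mxE !eqxx (negbTE pq).
  case: eqP => [->|_]; first by rewrite mulrC divfK// gt_eqF.
  by case: eqP => [->|_]//; rewrite subrK.
have aux p' q' a b : p' != q' -> 0 < a -> 0 < b ->
    simp (M *m replace_mx p' q' a b) `<=` simp M.
  move=> pq' a0 b0 y [Sy [c c0 yE]]; split => //.
  exists (replace_mx p' q' a b *m c); last by rewrite mulmxA.
  move=> i; rewrite replace_mx_coord//; case: ifP => _;
    first by rewrite mulr_ge0// ltW.
  by case: ifP => _ //; rewrite addr_ge0// mulr_ge0// ltW.
by move=> [] /aux; exact.
Qed.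

Definition halfspace (h : V) : set V := [set x | 0 <= dot h x].

(** If the vertices do not lie strictly on both sides of the hyperplane, the
intersection is the simplex itself or lies in the hyperplane. Otherwise bisect
an edge at the point where it crosses the hyperplane: in both pieces one vertex
fewer lies off the hyperplane. *)
Lemma apoly_simp_halfspace M (h : V) : M \in unitmx ->
  apoly (simp M `&` halfspace h).
Proof.
pose a M i := (h^T *m M) 0 i.
have aE N (c : V) : dot h (N *m c) = \sum_i a N i * c i 0.
  by rewrite dotE mulmxA mxE.
have [k] := ubnP #|[pred i | a M i != 0]|.
elim: k M => // k IH M; rewrite ltnS => Mk uM.
have simpP N : N \in unitmx -> is_polytope (simp N).
  move=> uN; apply/is_polytopeP; exists [:: N]; first by rewrite /= uN.
  apply/seteqP; split => x; first by exists N; rewrite ?mem_head.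
  by move=> [_ /[!inE]/eqP->].
have [/forallP a0|] := boolP [forall i, 0 <= a M i].
  rewrite (_ : _ `&` _ = simp M); first exact/apoly_polytope/simpP.
  apply/seteqP; split => x [] // Sx [c c0 xE]; split; first by split => //;
    exists c.
  by rewrite /halfspace/= xE aE sumr_ge0// => i _; rewrite mulr_ge0.
rewrite negb_forall => /existsP[q]; rewrite -ltNge => aq0.
have h0 : h != 0.
  by apply: contraTneq aq0 => hz; rewrite /a hz trmx0 mul0mx mxE ltxx.
have [/forallP a0|] := boolP [forall i, a M i <= 0].
  apply: apoly_negl; apply: neglS (negl_hyper h0) => x Sx [[_ [c c0 xE]]].
  rewrite /halfspace/= => hx; apply/le_anti; rewrite hx andbT xE aE.
  by rewrite sumr_le0// => i _; rewrite mulr_le0_ge0.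
rewrite negb_forall => /existsP[p]; rewrite -ltNge => ap0.
have pq : p != q by apply: contraTneq ap0 => ->; rewrite -leNgt ltW.
have naq0 : 0 < - a M q by rewrite oppr_gt0.
have aux p' q' al be : p' != q' -> al != 0 -> a M q' != 0 ->
    al * a M q' + be * a M p' = 0 ->
    apoly (simp (M *m replace_mx p' q' al be) `&` halfspace h).
  move=> pq' al0 aq'0 E; apply: IH;
    last by rewrite unitmx_mul uM replace_mx_unit.
  have a'E i : a (M *m replace_mx p' q' al be) i = if i == q' then 0 else a M i.
    rewrite /a mulmxA; have -> : (h^T *m M *m replace_mx p' q' al be) 0 i =
        dot (h^T *m M)^T (replace_mx p' q' al be *m delta_mx i 0).
      by rewrite dotE trmxK mulmxA -colE [RHS]mxE.
    rewrite replace_mxE !dotDr !dotZr.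
    have dd (j : 'I_n.+1) : dot (h^T *m M)^T (delta_mx j 0) = a M j.
      by rewrite dotE trmxK -colE [LHS]mxE.
    rewrite !dd mxE eqxx andbT eq_sym; case: eqP => [->|_];
      last by rewrite !mulr0 !mul0r !addr0.
    by rewrite !mulr1 -E; ring.
  apply: leq_trans Mk; apply: proper_card; apply/properP; split.
    apply/fintype.subsetP => i; by rewrite !inE a'E; case: (i == q');
      rewrite ?eqxx.
  by exists q'; rewrite !inE ?a'E ?eqxx ?aq'0.
rewrite (simp_bisect M pq ap0 naq0) setIUl; apply: apolyU; apply: aux => //.
- by rewrite gt_eqF.
- by rewrite lt_eqF.
- by ring.
- by rewrite eq_sym.
- by rewrite gt_eqF.
- by rewrite gt_eqF.
- by ring.
Qed.

Lemma apolyI_halfspace X h : apoly X -> apoly (X `&` halfspace h).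
Proof.
move=> [P [/is_polytopeP[s us ->] PX XP]].
apply: (@apoly_eqv (simps s `&` halfspace h)).
- by apply: neglS PX => x _ [[? ?] nX]; split => // ?; apply: nX.
- by apply: neglS XP => x _ [[? ?] nX]; split => // ?; apply: nX.
rewrite (_ : _ `&` _ = [set x | exists2 M, M \in s &
  (simp M `&` halfspace h) x]).
  by apply: apoly_bigcup => M Ms; apply: apoly_simp_halfspace; exact: (allP us).
by apply/seteqP; split => x [] => [[M Ms Mx] hx|M Ms [Mx hx]];
  [exists M|split => //; exists M].
Qed.

Definition halfspaces (hs : seq V) : set V := [set x | forall h, h \in hs ->
  halfspace h x].

Lemma apolyI_halfspaces X hs : apoly X -> apoly (X `&` halfspaces hs).
Proof.
elim: hs X => [|h hs IH] X aX.
  by rewrite (_ : _ `&` _ = X)//; apply/seteqP; split => // x [].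
rewrite (_ : _ `&` _ = X `&` halfspace h `&` halfspaces hs);
  first exact/IH/apolyI_halfspace.
apply/seteqP; split => x.
  move=> [Xx hx]; split; first by split => //; apply: hx; exact: mem_head.
  by move=> l lhs; apply: hx; rewrite inE lhs orbT.
by move=> [[Xx hx] hsx]; split => // l; rewrite inE => /predU1P[->//|];
  exact: hsx.
Qed.

(** The sphere is the union of the orthants. *)
Lemma apoly_sphere : apoly S.
Proof.
pose N (e : {ffun 'I_n.+1 ->
  bool}) : 'M[R]_n.+1 := diag_mx (\row_i (-1) ^+ e i).
have NE e (c : V) i : (N e *m c) i 0 = (-1) ^+ e i * c i 0.
  by rewrite mul_diag_mx !mxE.
apply/apoly_polytope/is_polytopeP;
  exists [seq N e | e <- enum {: {ffun 'I_n.+1 -> bool}}].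
  apply/allP => _ /mapP[e _ ->]; apply: unitmx_inj => c /colP Nc;
    apply/colP => i.
  have /eqP := Nc i; rewrite NE !mxE mulf_eq0 signr_eq0 => /eqP//.
apply/seteqP; split => x; last by move=> [_ /mapP[e _ ->]] [].
move=> Sx; pose e := [ffun i => x i 0 < 0]; exists (N e);
  first by rewrite map_f// mem_enum.
split => //; exists (\col_i `|x i 0|) => [i|]; first by rewrite mxE.
by apply/colP => i; rewrite NE mxE ffunE mulr_sign_norm.
Qed.

Lemma apolyI_simp M X : M \in unitmx -> apoly X -> apoly (X `&` simp M).
Proof.
move=> uM /(apolyI_halfspaces [seq facet M i | i <- enum 'I_n.+1]).
apply: apoly_eqv; rewrite (simpE uM); apply: neglD0 => x Sx.
  move=> [Xx Mx]; split => //; split => // i; apply: Mx.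
  by rewrite map_f// mem_enum.
by move=> [Xx [_ Mx]]; split => // _ /mapP[i _ ->]; exact: Mx.
Qed.

Lemma apolyI X Y : apoly X -> apoly Y -> apoly (X `&` Y).
Proof.
move=> aX [P [/is_polytopeP[s us ->] PY YP]].
apply: (@apoly_eqv (X `&` simps s)).
- by apply: neglS PY => x _ [[? ?] nX]; split => // ?; apply: nX.
- by apply: neglS YP => x _ [[? ?] nX]; split => // ?; apply: nX.
rewrite (_ : _ `&` _ = [set x | exists2 M, M \in s & (X `&` simp M) x]).
  by apply: apoly_bigcup => M Ms; apply: apolyI_simp => //; exact: (allP us).
by apply/seteqP; split => x [] => [Xx [M Ms Mx]|M Ms [Xx Mx]];
  [exists M|split => //; exists M].
Qed.

(** The complement of a simplex is a union of open hemispheres, which agree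
with the closed ones up to a negligible set. *)
Lemma apolyC_simp M : M \in unitmx -> apoly (~` simp M).
Proof.
move=> uM; rewrite (simpE uM).
apply: (@apoly_eqv [set x | exists2 i, i \in enum 'I_n.+1 &
  (S `&` halfspace (- facet M i)) x]).
- apply: neglS (negl_bigcup (fun i => negl_hyper (facet_neq0 i uM))) =>
    x Sx [[i _ [_]]].
  rewrite /halfspace/= dotNl oppr_ge0 => fi /contrapT[_ f0].
  by exists i => //=; apply/le_anti; rewrite fi f0.
- apply: neglD0 => x Sx nx; have [i fi] : exists i, ~ 0 <= dot (facet M i) x.
    by apply/existsNP => f0; apply: nx.
  exists i; first by rewrite mem_enum.
  by split => //; rewrite /halfspace/= dotNl oppr_ge0 ltW// ltNge; apply/negP.
- by apply: apoly_bigcup => i _; apply: apolyI_halfspace; exact: apoly_sphere.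
Qed.

Lemma apolyC X : apoly X -> apoly (~` X).
Proof.
move=> [P [/is_polytopeP[s us ->] PY YP]].
apply: (@apoly_eqv (~` simps s)).
- by apply: neglS YP => x _ [? /contrapT].
- by apply: neglS PY => x _ [? /contrapT].
elim: s us {PY YP} => [_|M s IH /= /andP[uM /IH as_]].
  apply: apoly_eqv apoly_sphere; first by apply: neglD0 => x _ _ [].
  exact: neglD0.
rewrite (_ : ~` _ = ~` simp M `&` ~` simps s);
  first exact/apolyI/as_/apolyC_simp.
apply/seteqP; split => x.
  by move=> nx; split => [Mx|[N Ns Nx]]; apply: nx; [exists M|exists N];
    rewrite // inE ?eqxx// Ns orbT.
by move=> [nM ns] [N]; rewrite inE => /predU1P[->//|Ns Nx]; apply: ns; exists N.
Qed.

Lemma apolyD X Y : apoly X -> apoly Y -> apoly (X `\` Y).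
Proof. by move=> aX aY; apply: apolyI => //; exact: apolyC. Qed.

Lemma simp_image g M : orth g -> mulmx g @` simp M = simp (g *m M).
Proof.
move=> gg; apply/seteqP; split => [_ [x [Sx [c c0 xE]] <-]|x [Sx [c c0 xE]]].
  by split; [exact: sphere_orth|exists c; rewrite // xE mulmxA].
exists (M *m c); last by rewrite xE mulmxA.
split; last by exists c.
by rewrite -(orthK gg (M *m c)) (mulmxA g M c) -xE; apply: sphere_orth => //;
  exact: orth_trmx.
Qed.

Lemma is_polytope_image g P : orth g -> is_polytope P ->
  is_polytope (mulmx g @` P).
Proof.
move=> gg /is_polytopeP[s us ->]; apply/is_polytopeP.
exists [seq g *m M | M <- s].
  by apply/allP => _ /mapP[M Ms ->]; rewrite unitmx_mul (orth_unit gg);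
    exact: (allP us).
apply/seteqP; split => [_ [x [M Ms Mx] <-]|x [_ /mapP[M Ms ->]]].
  by exists (g *m M); [exact: map_f|rewrite -simp_image//; exists x].
by rewrite -simp_image// => -[y My <-]; exists y => //; exists M.
Qed.

Lemma vmeas_simp M : M \in unitmx -> vmeas (simp M).
Proof.
move=> uM; rewrite (simpE uM); apply: vmeasI; first exact: vmeas_sphere.
rewrite /vmeas (_ : mkset _ = \bigcap_(i in [set: 'I_n.+1]) [set t | 0 <= dot
  (facet M i) (tcol t)]).
  apply: fin_bigcap_measurable => // i _.
  by apply: (@vmeas_le R n.+1 (fun=> 0) (dot (facet M i))) => //;
    exact: vmeas_dot.
by apply/seteqP; split => t tM i; [move=> _|]; exact: tM.
Qed.

Lemma vmeas_bigcup_seq (I : eqType) (s : seq I) (A : I -> set V) :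
  (forall i, i \in s -> vmeas (A i)) ->
    vmeas [set x | exists2 i, i \in s & A i x].
Proof.
elim: s => [_|i s IH sA].
  by rewrite (_ : mkset _ = set0); [exact: vmeas0|apply/seteqP;
    split => // x []].
rewrite (_ : mkset _ = A i `|` [set x | exists2 i, i \in s & A i x]).
  by apply: vmeasU; [apply: sA; exact: mem_head|apply: IH => j js; apply: sA;
    rewrite inE js orbT].
apply/seteqP; split => x.
  by move=> [j]; rewrite inE => /predU1P[->|js] ?; [left|right; exists j].
by move=> [?|[j js ?]]; [exists i; rewrite // mem_head|exists j;
  rewrite // inE js orbT].
Qed.

Lemma vmeas_polytope P : is_polytope P -> vmeas P.
Proof.
move=> /is_polytopeP[s us ->]; apply: vmeas_bigcup_seq => M Ms.
by apply: vmeas_simp; exact: (allP us).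
Qed.

End almost_polytope.

(** * Interior and closure of polytopes *)

Section polytope_topology.
Variables (R : realType) (n : nat).
Local Notation V := 'cV[R]_n.+1.
Local Notation S := (sphere (R := R) (n := n)).
Local Notation K := (n.+1%:R : R).
Implicit Types (x y z : V) (A B X Y Z P Q : set V) (g M : 'M[R]_n.+1).

(** Caps have positive volume, negligible sets volume zero. *)
Lemma negl_cap x r : S x -> 0 < r -> ~ negl (cap x r).
Proof.
move=> Sx r0 nc; have [C C0 capC] := svol_cap_ge R n.
pose s := Num.min r 1; have s0 : 0 < s by rewrite lt_min r0 ltr01.
have := capC x s Sx s0; rewrite ge_min lexx orbT => /(_ isT).
rewrite (svol_negl (vmeas_cap _ _)).
  by apply/negP; rewrite -ltNge mulr_gt0// exprn_gt0.
by apply: neglS nc => y _; apply: le_cap; rewrite ge_min lexx.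
Qed.

Definition l1norm (l : V) : R := \sum_i `|l i 0|.

Lemma dot_lipschitz l x y r : ball x r y ->
  `|dot l x - dot l y| <= l1norm l * r.
Proof.
move=> /mxballE xy; rewrite -dotNr -dotDr;
  apply: le_trans (ler_norm_sum _ _ _) _.
rewrite /l1norm mulr_suml; apply: ler_sum => i _; rewrite normrM ler_wpM2l//.
by have := xy i; rewrite !mxE => /ltW.
Qed.

Lemma l1norm_ge0 l : 0 <= l1norm l.
Proof. exact: sumr_ge0. Qed.

Lemma dot_gt0_near l x : 0 < dot l x ->
  exists2 r, 0 < r & forall y, ball x r y -> 0 < dot l y.
Proof.
move=> lx; have N1 : 0 < l1norm l + 1 by rewrite ltr_wpDl ?l1norm_ge0.
exists (dot l x / (l1norm l + 1)); first exact: divr_gt0.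
move=> y /(dot_lipschitz l) /ler_normlP[_].
have : l1norm l * (dot l x / (l1norm l + 1)) < dot l x.
  by rewrite mulrA ltr_pdivrMr// mulrC ltr_pM2l// ltrDl.
lra.
Qed.

(** Continuity of the radial projection at a point of the sphere. If the
coordinates of z differ from those of x by at most d then the squared norm of z
differs from 1 by at most 3 K d, and so does its norm. *)
Lemma to_sphere_near x r : S x -> 0 < r -> exists2 e, 0 < e &
  forall z, ball x e z -> 0 < dot z z /\ ball x r (to_sphere z).
Proof.
move=> /sphereE Sx r0; have K1 : 1 <= K by rewrite ler1n.
have K0 : 0 < K by rewrite ltr0n.
pose e := Num.min (6 * K)^-1 (r / (9 * K)).
have e0 : 0 < e by rewrite lt_min invr_gt0 divr_gt0 ?mulr_gt0.
have eK : K * e <= 6^-1.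
  have : e <= (6 * K)^-1 by rewrite ge_min lexx.
  by rewrite -(@ler_pM2l _ K)// invfM mulrCA divff ?mulr1// gt_eqF.
have er : 9 * (K * e) <= r.
  have : e <= r / (9 * K) by rewrite ge_min lexx orbT.
  by rewrite ler_pdivlMr ?mulr_gt0// mulrC mulrA.
have e1 : e <= 1 by nra.
exists e => // z /mxballE xz.
have x1 i : `|x i 0| <= 1 by apply: coord_le1; rewrite Sx.
have zz : `|dot z z - 1| <= 3 * (K * e).
  have -> : dot z z - 1 = dot z z - dot x x by rewrite Sx.
  rewrite /dot -sumrB; apply: le_trans (ler_norm_sum _ _ _) _.
  apply: (@le_trans _ _ (\sum_(i < n.+1) 3 * e)).
    apply: ler_sum => i _; have := xz i; have := x1 i.
    rewrite !ler_norml !ltr_norml => /andP[? ?] /andP[? ?].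
    apply/andP; split; nra.
  by rewrite sumr_const card_ord -[leLHS]mulr_natl [leLHS]mulrCA.
have zz0 : 0 < dot z z by move: zz; rewrite ler_norml => /andP[? ?]; lra.
split=> //; set s := Num.sqrt (dot z z).
have ss : s ^+ 2 = dot z z by rewrite sqr_sqrtr// ltW.
have s0 : 0 < s by rewrite sqrtr_gt0.
have s1 : `|1 - s| <= 3 * (K * e).
  apply: le_trans zz; rewrite -ss -{2}(expr1n _ 2) subr_sqr normrM distrC.
  rewrite ler_peMr// ger0_norm; lra.
have s2 : 2^-1 <= s by move: s1; rewrite ler_norml => /andP[? ?]; lra.
apply/mxballE => i; rewrite to_sphereE -/s mxE.
rewrite (_ : x i 0 - _ = (x i 0 * (s - 1) + (x i 0 - z i 0)) / s); last first.
  by field; rewrite gt_eqF.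
rewrite normrM normfV (gtr0_norm s0) ltr_pdivrMr//.
apply: le_lt_trans (ler_normD _ _) _; rewrite normrM (distrC s).
have := xz i; have := x1 i; have := normr_ge0 (x i 0);
  have := normr_ge0 (1 - s).
nra.
Qed.

Lemma facet_gt0_near M x : M \in unitmx -> S x ->
  (forall i, 0 < dot (facet M i) x) ->
  exists2 r, 0 < r & cap x r `<=` simp M.
Proof.
move=> uM Sx fx; have /choice[rr rrP] i : exists r, 0 < r /\ forall y,
  ball x r y -> 0 < dot (facet M i) y.
  by have [r ? ?] := dot_gt0_near (fx i); exists r.
exists (\big[Order.min/1]_i rr i).
  by elim/big_ind: _ => // [a b a0 b0|i _];
    [rewrite lt_min a0|have [] := rrP i].
move=> y [Sy xy]; rewrite (simpE uM); split => // i; apply/ltW.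
have [_] := rrP i; apply; apply: le_ball xy.
by rewrite (bigD1 i)//= ge_min lexx.
Qed.

(** Move [x] a little towards the sum of the vertices of a simplex that
contains it: all facet forms become positive. *)
Lemma polytope_interior P x r : is_polytope P -> P x -> 0 < r ->
  exists y s, [/\ S y, 0 < s & cap y s `<=` P `&` ball x r].
Proof.
move=> /is_polytopeP[ms us ->] [M Ms [Sx [c c0 xE]]] r0.
have uM : M \in unitmx by exact: (allP us).
have [e e0 eP] := to_sphere_near Sx r0.
pose u : V := M *m const_mx 1.
have N1 : 0 < l1norm u + 1 by rewrite ltr_wpDl ?l1norm_ge0.
pose t := e / (l1norm u + 1); have t0 : 0 < t by exact: divr_gt0.
pose z := x + t *: u.
have xz : ball x e z.
  apply/mxballE => i; have -> : z i 0 = x i 0 + t * u i 0.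
    by rewrite /z mxE [X in _ + X]mxE.
  rewrite opprD addrA subrr sub0r normrN normrM gtr0_norm//.
  apply: (@le_lt_trans _ _ (t * l1norm u)).
    rewrite ler_pM2l// /l1norm (bigD1 i)//= lerDl; exact: sumr_ge0.
  by rewrite mulrAC ltr_pdivrMr// ltr_pM2l// ltrDl.
have [zz0 xy] := eP z xz; set y := to_sphere z in xy *.
have Sy : S y by exact: sphere_to_sphere.
have [s s0 sM] : exists2 s, 0 < s & cap y s `<=` simp M.
  apply: facet_gt0_near => // i; rewrite facetE /y to_sphereE -scalemxAr mxE.
  rewrite mulr_gt0 ?invr_gt0 ?sqrtr_gt0// /z /u xE scalemxAr -mulmxDr mulKmx//.
  by rewrite !mxE mulr1 ltr_wpDl.
have [d d0 yd] : exists2 d, 0 < d & forall w, ball y d w -> ball x r w.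
  pose m := \big[Order.max/0]_i `|x i 0 - y i 0|.
  have mr : m < r.
    by rewrite /m; elim/big_ind: _ => // [a b ? ?|i _]; [rewrite gt_max;
      apply/andP|move/mxballE: xy].
  exists (r - m); first by rewrite subr_gt0.
  move=> w /mxballE yw; apply/mxballE => i;
    rewrite -(subrK (y i 0) (x i 0)) -addrA.
  apply: le_lt_trans (ler_normD _ _) _.
  have : `|x i 0 - y i 0| <= m by rewrite /m (bigD1 i)//= le_max lexx.
  have := yw i; lra.
exists y, (Num.min s d); split => //; first by rewrite lt_min s0.
move=> w wc; split; last first.
  by apply: yd; case: wc => _; apply: le_ball; rewrite ge_min lexx orbT.
by exists M => //; apply: sM; apply: le_cap wc; rewrite ge_min lexx.
Qed.

(** This replaces a Baire argument: near every point a polytope contains a cap,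
and caps are not negligible. *)
Lemma polytope_regular P Z x r : is_polytope P -> negl Z -> P x -> 0 < r ->
  exists y, [/\ P y, ball x r y & ~ Z y].
Proof.
move=> polyP nZ Px r0; have [y [s [Sy s0 ysP]]] :=
  polytope_interior polyP Px r0.
apply: contrapT => no; apply: (negl_cap Sy s0); apply: neglS nZ => w _ wc.
apply: contrapT => nZw; apply: no; exists w; have [] := ysP w wc; split => //.
Qed.

Lemma polytope_not_negl P x : is_polytope P -> P x -> ~ negl P.
Proof.
by move=> polyP Px nP; have [y []] := polytope_regular polyP nP Px ltr01.
Qed.

(** The interior relative to the sphere, with caps instead of neighbourhood
filters. *)
Definition pinterior P : set V := [set x | S x /\ exists2 r, 0 < r &
  cap x r `<=` P].

Lemma sinteriorE P : sinterior P = pinterior P.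
Proof.
apply/seteqP; split => x [Sx].
  move=> /nbhs_ballP[r /= r0 xr]; split => //; exists r => // y [Sy xy].
  exact: xr.
move=> [r r0 xr]; split => //; apply/nbhs_ballP; exists r => // y xy Sy.
exact: xr.
Qed.

(** A point where no facet form of its simplex vanishes is interior. *)
Lemma polytope_boundary P : is_polytope P -> negl (P `\` pinterior P).
Proof.
move=> /is_polytopeP[ms us ->].
have nM M : M \in ms -> negl [set x | exists2 i, i \in enum 'I_n.+1 &
  dot (facet M i) x = 0].
  move=> Ms; apply: negl_bigcup_seq => i _; apply: negl_hyper;
    apply: facet_neq0.
  exact: (allP us).
apply: neglS (negl_bigcup_seq nM) => x Sx [[M Ms Mx] nx]; exists M => //.
have uM : M \in unitmx by exact: (allP us).
apply: contrapT => no; apply: nx; split => //.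
have [|r r0 xr] := @facet_gt0_near M x uM Sx.
  move=> i; move: Mx; rewrite (simpE uM) => -[_ Mx]; rewrite lt_def Mx andbT.
  by apply/eqP => fx; apply: no; exists i; rewrite ?mem_enum.
by exists r => // y /xr My; exists M.
Qed.

(** Closedness relative to the sphere. *)
Definition pclosed X := forall x, S x -> ~ X x ->
  exists2 r, 0 < r & forall y, S y -> ball x r y -> ~ X y.

Lemma pclosedI X Y : pclosed X -> pclosed Y -> pclosed (X `&` Y).
Proof.
move=> cX cY x Sx nXY; have [Xx|nX] := pselect (X x).
  have [|r r0 xr] := cY x Sx; first by move=> Yx; apply: nXY.
  by exists r => // y Sy xy [_]; exact: xr.
by have [r r0 xr] := cX x Sx nX; exists r => // y Sy xy [Xy _]; exact: xr Xy.
Qed.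

Lemma pclosed_bigcup_seq (I : eqType) (s : seq I) (A : I -> set V) :
  (forall i, i \in s -> pclosed (A i)) ->
    pclosed [set x | exists2 i, i \in s & A i x].
Proof.
elim: s => [_ x Sx _|i s IH sA x Sx nx]; first by exists 1 => // y _ _ [].
have [|r r0 xr] := sA i (mem_head _ _) x Sx.
  by move=> Ax; apply: nx; exists i; rewrite // mem_head.
have [||t t0 xt] := IH _ x Sx.
- by move=> j js; apply: sA; rewrite inE js orbT.
- by move=> [j js Ax]; apply: nx; exists j; rewrite // inE js orbT.
exists (Num.min r t); first by rewrite lt_min r0.
move=> y Sy xy [j]; rewrite inE => /predU1P[->|js] Ay.
  by apply: xr Ay => //; apply: le_ball xy; rewrite ge_min lexx.
apply: (xt y) => //; last by exists j.
by apply: le_ball xy; rewrite ge_min lexx orbT.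
Qed.

Lemma pclosed_bigcup (I : finType) (A : I -> set V) :
  (forall i, pclosed (A i)) -> pclosed (\bigcup_i A i).
Proof.
move=> cA; rewrite (_ : \bigcup_i A i = [set x | exists2 i,
  i \in index_enum I & A i x]).
  exact: pclosed_bigcup_seq.
by apply/seteqP; split => x [i _ Ax]; exists i => //; exact: mem_index_enum.
Qed.

Lemma pclosed_simp M : M \in unitmx -> pclosed (simp M).
Proof.
move=> uM x Sx; rewrite (simpE uM) => nMx.
have [i fi] : exists i, ~ 0 <= dot (facet M i) x.
  by apply/existsNP => f0; apply: nMx.
have [|r r0 xr] := @dot_gt0_near (- facet M i) x.
  by rewrite dotNl oppr_gt0 ltNge; apply/negP.
exists r => // y Sy /xr; rewrite dotNl oppr_gt0 => fy [_ /(_ i)].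
by rewrite leNgt fy.
Qed.

Lemma pclosed_polytope P : is_polytope P -> pclosed P.
Proof.
move=> /is_polytopeP[s us ->]; apply: pclosed_bigcup_seq => M Ms.
by apply: pclosed_simp; exact: (allP us).
Qed.

(** A point of [P] outside the closed set [X] has a neighbourhood that misses
[X]; the part of [P] in it is not negligible. *)
Lemma polytope_sub P X : is_polytope P -> pclosed X -> negl (P `\` X) ->
  P `<=` X.
Proof.
move=> polyP cX nPX x Px; apply: contrapT => nXx.
have [r r0 xr] := cX x (polytope_sphere polyP Px) nXx.
have [y [Py xy nZ]] := polytope_regular polyP nPX Px r0.
by apply: nZ; split => //; apply: xr => //; exact: polytope_sphere Py.
Qed.

(** The representing polytope lies in the closure of [X]; this is what makes it
a subset of a given closed set. *)
Lemma apoly_rep X : apoly X -> exists P : polytope R n,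
  [/\ negl (P `\` X), negl (X `\` P) &
      forall Y, pclosed Y -> (forall x, S x -> X x -> Y x) -> P `<=` Y].
Proof.
move=> [P [polyP PX XP]]; exists (Polytope polyP); split => // Y cY XY.
by apply: polytope_sub => //; apply: negl_trans PX _; exact: neglD0.
Qed.

Lemma sinterior_disjoint P Q : is_polytope P -> is_polytope Q ->
  sinterior P `&` sinterior Q = set0 <-> negl (P `&` Q).
Proof.
rewrite !sinteriorE => polyP polyQ; split => [PQ0|nPQ].
  apply: neglS (neglU (polytope_boundary polyP) (polytope_boundary polyQ)) => x
    Sx [Px Qx].
  have [Pi|?] := pselect (pinterior P x); last by left.
  right; split => // Qi; suff : set0 x by [].
  by rewrite -PQ0.
apply/seteqP; split => // x [[Sx [r r0 xr]] [_ [s s0 xs]]].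
have rs0 : 0 < Num.min r s by rewrite lt_min r0.
apply: (negl_cap Sx rs0); apply: neglS nPQ => y _ yc.
by split; [apply: xr|apply: xs]; apply: le_cap yc; rewrite ge_min lexx ?orbT.
Qed.

End polytope_topology.

(** * Separated points and small pieces *)

Section small_pieces.
Variables (R : realType) (n : nat).
Local Notation V := 'cV[R]_n.+1.
Local Notation S := (sphere (R := R) (n := n)).
Local Notation K := (n.+1%:R : R).
Implicit Types (x y z : V) (A B D U X Y Z : set V) (P Q : polytope R n) (g M :
  'M[R]_n.+1).

Lemma polytopeP P : is_polytope P. Proof. by case: P. Qed.

Lemma vmeasP P : vmeas P. Proof. by apply: vmeas_polytope;
  exact: polytopeP. Qed.

Lemma pclosedP P : pclosed P. Proof. by apply: pclosed_polytope;
  exact: polytopeP. Qed.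

Lemma apolyP P : apoly P. Proof. by apply: apoly_polytope;
  exact: polytopeP. Qed.

Lemma pclosed_halfspace h : pclosed (halfspace (h : V)).
Proof.
move=> x Sx /negP; rewrite -ltNge => hx.
have [|r r0 xr] := @dot_gt0_near R n (- h) x; first by rewrite dotNl oppr_gt0.
exists r => // y Sy /xr; rewrite dotNl oppr_gt0 /halfspace/= => hy.
by apply/negP; rewrite -ltNge.
Qed.

Lemma pclosed_halfspaces (hs : seq V) : pclosed (halfspaces hs).
Proof.
elim: hs => [|h hs IH]; first by move=> x _ [].
rewrite (_ : halfspaces _ = halfspace h `&` halfspaces hs).
  by apply: pclosedI => //; exact: pclosed_halfspace.
apply/seteqP; split => x.
  move=> hx; split; first by apply: hx; exact: mem_head.
  by move=> l ls; apply: hx; rewrite inE ls orbT.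
by move=> [hx hsx] l; rewrite inE => /predU1P[->//|]; exact: hsx.
Qed.

(** Around the pole, the cell is given by the inequalities |x_i| <= t x_0 for i
> 0, a spherical cube; around other points it is moved by an orthogonal
matrix. *)
Lemma small_cell r : 0 < r -> exists2 d, 0 < d & forall x, S x ->
  exists hs : seq V,
  cap x d `<=` halfspaces hs /\ (S `&` halfspaces hs `<=` ball x r).
Proof.
move=> r0; have K1 : 1 <= K by rewrite ler1n.
have K0 : 0 < K by rewrite ltr0n.
have nK : n%:R + 1 = K by rewrite -natr1.
pose q := Num.min 1 (r / K).
have q0 : 0 < q by rewrite lt_min ltr01 divr_gt0.
have q1 : q <= 1 by rewrite ge_min lexx.
have qr : K * q <= r by rewrite mulrC -ler_pdivlMr// ge_min lexx orbT.
pose t := q / (2 * K).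
have t0 : 0 < t by rewrite divr_gt0// mulr_gt0.
have tq : t * (2 * K) = q by rewrite /t; field; rewrite gt_eqF.
have t1 : t <= 1 by nra.
pose es : seq V := [seq (delta_mx i 0 : V) | i <- enum 'I_n.+1 & i != 0].
pose ts : seq V := @e0 R n :: [seq t *: @e0 R n + e | e <- es] ++ [seq t *: @e0
  R n - e | e <- es].
have dotd i x : dot (delta_mx i 0) x = x i 0.
  rewrite /dot (bigD1 i)//= big1 ?addr0 => [|j ji]; rewrite !mxE.
    by rewrite !eqxx mul1r.
  by rewrite (negbTE ji) mul0r.
have ball0 : S `&` halfspaces ts `<=` ball (@e0 R n) q.
  move=> y [Sy hy].
  have y0 : 0 <= y 0 0 by rewrite -(dotd 0); apply: hy; exact: mem_head.
  have y1 : y 0 0 <= 1.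
    by have /sphereE Sy1 := Sy; have := @coord_le1 R _ y 0;
      rewrite Sy1 lexx ger0_norm//; apply.
  apply: (@near_e0 _ _ _ _ t) => //; first exact: ltW.
  - move=> i i0; have ie : delta_mx i 0 \in es by apply: map_f;
      rewrite mem_filter i0 mem_enum.
    have h1 : halfspace (t *: @e0 R n + delta_mx i 0) y.
      by apply: hy; rewrite inE mem_cat map_f ?orbT.
    have h2 : halfspace (t *: @e0 R n - delta_mx i 0) y.
      apply: hy; rewrite inE mem_cat; apply/orP; right; apply/orP; right.
      by apply/mapP; exists (delta_mx i 0).
    move: h1 h2; rewrite /halfspace/= dotDl dotDl dotNl dotZl !dotd => h1 h2.
    by rewrite ler_norml; apply/andP; split; nra.
  - by nra.
  - by have : 0 <= n%:R :> R by []; nra.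
have cap0 : cap (@e0 R n) (t / 2) `<=` halfspaces ts.
  move=> y [Sy /mxballE yb].
  have y0 : 1 - t / 2 < y 0 0.
    by have := yb 0; rewrite e0E eqxx ltr_norml /= => /andP[_]; lra.
  move=> h; rewrite inE => /predU1P[->|]; first by rewrite /halfspace/= dotd;
    lra.
  rewrite mem_cat => /orP[] /mapP[_ /mapP[i + ->] ->];
    rewrite mem_filter => /andP[i0 _];
    rewrite /halfspace/= dotDl ?dotNl dotZl !dotd; have := yb i;
    rewrite e0E (negbTE i0) sub0r normrN ltr_norml => /andP[? ?]; nra.
exists (t / 2 / K); first by rewrite !divr_gt0.
move=> x Sx; have [g [gg gx]] := to_e0 Sx.
have gE h y : dot (g^T *m h) y = dot h (g *m y).
  by rewrite -{2}(orthKV gg h) orth_dot.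
exists [seq g^T *m h | h <- ts]; split => y.
  move=> yc _ /mapP[h hts ->]; rewrite /halfspace/= gE; apply: cap0 => //.
  have [] := image_cap gg (_ : (mulmx g @` cap x (t / 2 / K)) (g *m y));
    first by exists y.
  by rewrite gx mulrC divfK ?gt_eqF.
move=> [Sy hy]; have : ball (@e0 R n) q (g *m y).
  apply: ball0; split; first exact: sphere_orth.
  by move=> h hts; rewrite /halfspace/= -gE; apply: hy; exact: map_f.
move=> /(orth_ball (orth_trmx gg)); rewrite -gx !orthK//.
exact: le_ball.
Qed.

Fixpoint spread r (s : seq V) : Prop :=
  if s is x :: s' then (forall y, y \in s' ->
    ~ ball y r x) /\ spread r s' else True.

Lemma spread_nth r s x0 i j : spread r s -> (i < size s)%N ->
  (j < size s)%N -> i != j ->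
  ~ ball (nth x0 s i) r (nth x0 s j).
Proof.
elim: s i j => //= x s IH [|i] [|j] //= [sx ss];
  rewrite ?ltnS ?eqSS => si sj ij.
- by move=> /ball_sym; apply: sx; exact: mem_nth.
- by apply: sx; exact: mem_nth.
- exact: IH.
Qed.

(** The caps of radius [r / 2] around the points are disjoint, and disjoint
from [U]; their volumes add up. *)
Lemma spread_volume : exists2 C : R, 0 < C & forall r (s : seq V) U,
  0 < r -> r <= 1 -> spread r s -> (forall x, x \in s -> S x) -> vmeas U ->
  (forall x y, x \in s -> S y -> U y -> ~ ball x (r / 2) y) ->
  (size s)%:R * (C * (r / 2) ^+ n) + svol U <= svol S.
Proof.
have [C C0 capC] := svol_cap_ge R n; exists C => // r s U r0 r1.
elim: s U => [|x s IH] U /= ss sS mU sU.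
  by rewrite mul0r add0r; apply: le_svol => //; exact: vmeas_sphere.
have mc := vmeas_cap x (r / 2).
have := IH (U `|` cap x (r / 2)) ss.2 _ (vmeasU mU mc) _.
rewrite svolU_disj//; last by move=> y Sy Uy [_]; apply: (sU x y);
  rewrite // mem_head.
have Sx : S x by apply: sS; exact: mem_head.
have : C * (r / 2) ^+ n <= svol (cap x (r / 2)) by apply: capC => //; lra.
move=> ha hb; rewrite -[(size s).+1%:R]natr1 mulrDl mul1r.
apply: le_trans (hb _ _); first by lra.
  by move=> y ys; apply: sS; rewrite inE ys orbT.
move=> y z ys Sz [Uz|[_ xz]]; first by apply: sU; rewrite // inE ys orbT.
move=> yz; apply: (ss.1 y ys); rewrite (splitr r); apply: ball_triangle yz _.
exact: ball_sym.
Qed.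

(** As long as the caps of radius [r] around the chosen points do not exhaust
the volume of [U], another point can be chosen in [U]. *)
Lemma spread_exists U r N : vmeas U -> 0 <= r ->
  N%:R * (2 * (2 * K) ^+ n * r ^+ n) < svol U ->
  exists s, [/\ size s = N, spread r s & forall x, x \in s -> S x /\ U x].
Proof.
move=> mU r0; set c := 2 * _ * _.
have c0 : 0 <= c by rewrite !mulr_ge0 ?exprn_ge0 ?mulr_ge0.
elim: N => [_|N IH Nc]; first by exists [::].
have [|s [sN ss sU]] := IH.
  by apply: le_lt_trans Nc; rewrite -[N.+1%:R]natr1 mulrDl mul1r lerDl.
have [y [Sy Uy ny]] : exists y, [/\ S y, U y & forall x, x \in s ->
  ~ ball x r y].
  apply: contrapT => no.
  suff : svol U <= (size s)%:R * c.
    by rewrite sN leNgt; apply/negP/negPn; apply: le_lt_trans Nc;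
      rewrite -[N.+1%:R]natr1 mulrDl mul1r lerDl.
  have sc : svol [set y | exists2 x, x \in s & cap x r y] <= (size s)%:R * c.
    have : forall x, x \in s -> S x by move=> x /sU[].
    elim: s {sN ss sU no} => [_|x s IHs sS].
      by rewrite mul0r (_ : mkset _ = set0) ?svol_set0//; apply/seteqP;
        split => // ? [].
    rewrite (_ : mkset _ = cap x r `|` [set y | exists2 x, x \in s &
      cap x r y]).
      apply: le_trans (svolU_le _ _) _; first exact: vmeas_cap.
        by apply: vmeas_bigcup_seq => z _; exact: vmeas_cap.
      rewrite /= -[(size s).+1%:R]natr1 mulrDl mul1r addrC lerD//.
        by apply: IHs => z zs; apply: sS; rewrite inE zs orbT.
      by apply: svol_cap_le => //; apply: sS; exact: mem_head.
    apply/seteqP; split => z.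
      by move=> [w]; rewrite inE => /predU1P[->|ws] ?; [left|right; exists w].
    by move=> [?|[w ws ?]]; [exists x; rewrite // mem_head|exists w;
      rewrite // inE ws orbT].
  apply: le_trans sc; apply: le_svol => //.
    by apply: vmeas_bigcup_seq => z _; exact: vmeas_cap.
  move=> y [Uy Sy]; apply: contrapT => ny; apply: no; exists y;
    split => // x xs xy.
  by apply: ny; exists x.
exists (y :: s); split; rewrite /= ?sN//.
by move=> x; rewrite inE => /predU1P[->//|/sU].
Qed.

(** A separated set that cannot be enlarged is a net; by [spread_volume]
enlarging it must stop. This takes the place of compactness of the sphere. *)
Lemma finite_net r : 0 < r -> exists s : seq V, (forall x, x \in s -> S x) /\
  forall y, S y -> exists2 x, x \in s & ball x r y.
Proof.
move=> r0; wlog r1 : r r0 / r <= 1.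
  move=> W; have [||s [sS sr]] := W (Num.min r 1);
    rewrite ?ge_min ?lexx ?orbT//.
    by rewrite lt_min r0 ltr01.
  exists s; split => // y /sr[x xs xy]; exists x => //; apply: le_ball xy.
  by rewrite ge_min lexx.
apply: contrapT => no; have [C C0 CP] := spread_volume.
have sep N : exists s, [/\ size s = N, spread r s & forall x, x \in s -> S x].
  elim: N => [|N [s [sN ss sS]]]; first by exists [::].
  have [y [Sy ny]] : exists y, S y /\ forall x, x \in s -> ~ ball x r y.
    apply: contrapT => no'; apply: no; exists s; split => // y Sy.
    by apply: contrapT => ny; apply: no'; exists y; split => // x xs xy;
      apply: ny; exists x.
  exists (y :: s); split; rewrite /= ?sN//.
  by move=> x; rewrite inE => /predU1P[->//|/sS].
have c0 : 0 < C * (r / 2) ^+ n by rewrite mulr_gt0// exprn_gt0// divr_gt0.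
have [s [sN ss sS]] := sep (Num.bound (svol S / (C * (r / 2) ^+ n))).
have := CP r s set0 r0 r1 ss sS (@vmeas0 R n) (fun x y _ _ h => False_ind _ h).
rewrite sN svol_set0 addr0 leNgt => /negP; apply.
by rewrite -ltr_pdivrMr// (le_lt_trans _ (archi_boundP _))// divr_ge0
  ?svol_ge0// ltW.
Qed.

(** Cover the sphere by finitely many small cells and assign every point of [P]
to the first cell that contains it. *)
Lemma polytope_cut P r : 0 < r -> exists m (A : 'I_m -> polytope R n),
  [/\ \bigcup_i (A i : set V) = P,
      forall i j, i != j -> negl (A i `&` A j) &
      forall i x y, Defs.pset (A i) x -> Defs.pset (A i) y -> ball x r y].
Proof.
move=> r0; have r20 : 0 < r / 2 by rewrite divr_gt0.
have [d d0 dP] := small_cell r20; have [s [sS sd]] := finite_net d0.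
pose c (i : 'I_(size s)) := tnth (in_tuple s) i.
have Sc i : S (c i) by apply: sS; exact: mem_tnth.
have /choice[hs hsP] i := dP (c i) (Sc i).
pose D i := halfspaces (hs i).
have aD i : apoly (S `&` D i) by apply: apolyI_halfspaces; exact: apoly_sphere.
pose X i := (P `&` (S `&` D i)) `\` [set x | exists2 j,
  j \in enum 'I_(size s) & [set x | (j < i)%N /\ (S `&` D j) x] x].
have aX i : apoly (X i).
  apply: apolyD; first by apply: apolyI => //; exact: apolyP.
  apply: apoly_bigcup => j _; have [ji|ji] := boolP (j < i)%N.
    by rewrite (_ : mkset _ = S `&` D j)//; apply/seteqP; split => // x [].
  by rewrite (_ : mkset _ = set0); [exact: apoly0|apply/seteqP;
    split => // x []].
have /choice[A AP] i := apoly_rep (aX i).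
have AD i : A i `<=` P `&` D i.
  have [_ _] := AP i; apply; last by move=> x _ [[? [_ ?]] _].
  by apply: pclosedI; [exact: pclosedP|exact: pclosed_halfspaces].
have AS i x : Defs.pset (A i) x -> S x by apply: polytope_sphere;
  exact: polytopeP.
exists (size s), A; split.
- apply/seteqP; split => [x [i _ /AD[]]//|].
  apply: polytope_sub; first exact: polytopeP.
    by apply: pclosed_bigcup => i; exact: pclosedP.
  apply: neglS (negl_bigcup (A := fun i => X i `\` A i) _) =>
    [x Sx [Px nAx]|i]; last by have [] := AP i.
  have [y ys yx] := sd x Sx.
  have /existsP[i0 i0D] : [exists i, `[< D i x >]].
    have /tnthP[i yE] : y \in in_tuple s by [].
    by apply/existsP; exists i; apply/asboolP; apply: (hsP i).1; split => //;
      rewrite /c -yE.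
  have [i /asboolP iD imin] := @arg_minnP _ i0 (fun i =>
    `[< D i x >]) (fun i => val i) i0D.
  exists i => //; split; last by move=> Ax; apply: nAx; exists i.
  split => // -[j _ [ji [_ Dj]]].
  by have := imin j (asboolT Dj); rewrite leqNgt ji.
- have aux (i j : 'I_(size s)) : (i < j)%N -> negl (A i `&` A j).
    move=> ij; have [AX _ _] := AP j; apply: neglS AX => x Sx [Ai Aj];
      split => // -[_]; apply.
    exists i; [by rewrite mem_enum|split => //; split => //].
    by have [] := AD i x Ai.
  move=> i j; rewrite neq_ltn => /orP[/aux//|/aux]; by rewrite setIC.
- move=> i x y Ax Ay; rewrite (splitr r); apply: (@ball_triangle _ _ (c i)).
    by apply: ball_sym; apply: (hsP i).2; split;
      [exact: AS Ax|have [] := AD i x Ax].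
  by apply: (hsP i).2; split; [exact: AS Ay|have [] := AD i y Ay].
Qed.

(** [U] consists of the points where all facet forms of some simplex are at
least a small constant. As the constant tends to 0 these sets exhaust [P] up to
a negligible set. *)
Lemma polytope_deflate P e : 0 < e -> exists r U,
  [/\ 0 < r, vmeas U, svol P - e <= svol U & forall y, U y ->
    S y /\ cap y r `<=` P].
Proof.
move=> e0; have /is_polytopeP[ms us PE] := polytopeP P.
pose c : R := 1 + \sum_(M <- ms) \sum_i l1norm (facet M i).
have s0 (M : 'M[R]_n.+1) : 0 <= \sum_i l1norm (facet M i).
  by apply: sumr_ge0 => i _; exact: l1norm_ge0.
have cl M i : M \in ms -> l1norm (facet M i) <= c.
  move=> Ms; apply: (@le_trans _ _ (\sum_i l1norm (facet M i))).
    by rewrite (bigD1 i)//= lerDl sumr_ge0// => j _; exact: l1norm_ge0.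
  by rewrite /c (big_rem M)//= addrCA lerDl addr_ge0// sumr_ge0.
have c0 : 0 < c by rewrite ltr_pwDl// sumr_ge0.
pose N M k := S `&` [set y | forall i, c * (k.+1%:R)^-1 <= dot (facet M i) y].
pose U k := [set y | exists2 M, M \in ms & N M k y].
have mU k : vmeas (U k).
  apply: vmeas_bigcup_seq => M _; apply: vmeasI; first exact: vmeas_sphere.
  rewrite /vmeas (_ : mkset _ = \bigcap_(i in [set: 'I_n.+1]) [set t | c *
    (k.+1%:R)^-1 <= dot (facet M i) (tcol t)]).
    apply: fin_bigcap_measurable => // i _.
    by apply: (@vmeas_le R n.+1 (fun=> c * (k.+1%:R)^-1) (dot (facet M i))) =>
      //; exact: vmeas_dot.
  by apply/seteqP; split => t tM i; [move=> _|]; exact: tM.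
have ndU k l : (k <= l)%N -> U k `<=` U l.
  move=> kl y [M Ms [Sy My]]; exists M => //; split => // i;
    apply: le_trans (My i).
  by rewrite ler_pM2l// lef_pV2 ?posrE// ler_nat ltnS.
have [k kP] := svol_bigcup_approx e0 mU ndU.
exists (k.+1%:R)^-1, (U k); split => //.
- apply: ltW; apply: le_lt_trans kP; rewrite lerD2r.
  have mUU : vmeas (\bigcup_i U i).
    rewrite /vmeas (_ : mkset _ = \bigcup_i [set t | U i (tcol t)]).
      exact: bigcupT_measurable.
    by apply/seteqP; split => t [l _ ?]; exists l.
  have nPU : negl (P `\` \bigcup_i U i).
    have nM M : M \in ms -> negl [set x | exists2 i, i \in enum 'I_n.+1 &
      dot (facet M i) x = 0].
      by move=> Ms; apply: negl_bigcup_seq => i _; apply: negl_hyper;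
        apply: facet_neq0; exact: (allP us).
    rewrite PE; apply: neglS (negl_bigcup_seq nM) => x Sx [[M Ms Mx] nUx];
      exists M => //.
    apply: contrapT => no; apply: nUx.
    have fx i : 0 < dot (facet M i) x.
      move: Mx; rewrite (simpE (allP us _ Ms)) => -[_ Mx];
        rewrite lt_def Mx andbT.
      by apply/eqP => fx; apply: no; exists i; rewrite ?mem_enum.
    pose m := \big[Order.min/1]_i dot (facet M i) x.
    have m0 : 0 < m by rewrite /m; elim/big_ind: _ => // a b a0 b0;
      rewrite lt_min a0.
    exists (Num.bound (c / m)) => //; exists M => //; split => // i.
    apply: (@le_trans _ _ m); last by rewrite /m (bigD1 i)//= ge_min lexx.
    rewrite ler_pdivrMr// -ler_pdivrMl// mulrC; apply: ltW.
    apply: lt_le_trans (archi_boundP _) _; first by rewrite divr_ge0// ltW.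
    by rewrite ler_nat.
  have mD := vmeasI (vmeasP P) (vmeasC mUU).
  rewrite -[leRHS]addr0 -(svol_negl mD nPU).
  apply: le_trans (svolU_le _ _) => //; apply: le_svol; first exact: vmeasP.
    exact: vmeasU.
  by move=> x [Px _]; have [?|?] := pselect ((\bigcup_i U i) x); [left|right].
- move=> y [M Ms [Sy My]]; split => // w [Sw yw]; rewrite PE; exists M => //.
  rewrite (simpE (allP us _ Ms)); split => // i.
  have := dot_lipschitz (facet M i) yw; rewrite ler_norml => /andP[_].
  move: (My i) => /= Myi; have : l1norm (facet M i) * (k.+1%:R)^-1 <= c *
    (k.+1%:R)^-1.
    by rewrite ler_pM2r ?invr_gt0// cl.
  move=> h1 h2; have := le_trans h2 (le_trans h1 Myi).
  by rewrite gerBl.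
Qed.

End small_pieces.

(** * Packing by isometries *)

Section packing.
Variables (R : realType) (n : nat).
Local Notation V := 'cV[R]_n.+1.
Local Notation S := (sphere (R := R) (n := n)).
Local Notation K := (n.+1%:R : R).
Implicit Types (x y z : V) (A B D U X Y Z : set V) (P Q : polytope R n) (g M :
  'M[R]_n.+1).

(** If the orthogonal matrix found has determinant -1, compose it with a
reflection that fixes [y]; there is one since the sphere has positive
dimension. *)
Lemma special_transitive x y : (0 < n)%N -> S x -> S y ->
  exists g, @SO R n g /\ g *m x = y.
Proof.
move=> n0 /sphereE Sx /sphereE Sy.
have det1 (g : 'M[R]_n.+1) : orth g -> \det g ^+ 2 = 1.
  by move=> /(congr1 determinant); rewrite det_mulmx det_tr det1 expr2.
have [g [gg gx]] : exists g, orth g /\ g *m x = y by apply: orth_transitive;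
  rewrite Sx.
have [dg|/eqP dg] := eqVneq (\det g) 1; first by exists g.
have {}dg : \det g = -1.
  by have /eqP := det1 g gg; rewrite sqrf_eq1 => /orP[/eqP|/eqP].
pose e : V := delta_mx ord_max 0.
have [a [aa ae]] : exists a, orth a /\ a *m e = y.
  apply: orth_transitive; rewrite Sy /dot (bigD1 ord_max)//= big1 ?addr0 =>
    [|i im].
    by rewrite !mxE !eqxx mulr1.
  by rewrite !mxE (negbTE im) mul0r.
pose d : 'rV[R]_n.+1 := \row_i (if i == 0 then -1 else 1).
pose D : 'M[R]_n.+1 := diag_mx d.
have DD : orth D.
  rewrite /orth /D tr_diag_mx; apply/matrixP => i j.
  rewrite mul_diag_mx !mxE; case: (i == j); rewrite ?mulr0//.
  by case: (i == 0); rewrite ?mulrNN mulr1.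
have De : D *m e = e.
  apply/colP => i; rewrite mul_diag_mx !mxE; case: eqP => [->|_];
    last by rewrite mul1r.
  by rewrite andbT -val_eqE/= (ltn_eqF n0) mulr0.
exists (a *m D *m a^T *m g); split; last first.
  by rewrite -!mulmxA gx -{1}ae orthK// De.
split.
  by apply: orthM => //; apply: orthM (orth_trmx aa); exact: orthM.
have dD : \det D = -1.
  rewrite det_diag (bigD1 0)//= mxE eqxx big1 ?mulr1// => i i0.
  by rewrite mxE (negbTE i0).
rewrite !det_mulmx det_tr dg dD; have := det1 a aa.
by move: (\det a) => q q2; rewrite -[RHS]q2; ring.
Qed.

Lemma dense_transitive (G : orth_subgroup R n) x y r : (0 < n)%N ->
  contains_dense_SO G -> S x -> S y -> 0 < r ->
  exists g, grp G g /\ ball y r (g *m x).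
Proof.
move=> n0 [H [HG _ dH]] Sx Sy r0.
have [g0 [g0SO g0x]] := special_transitive n0 Sx Sy.
have K0 : 0 < K by rewrite ltr0n.
pose e := r / (2 * K); have e0 : 0 < e by rewrite divr_gt0// mulr_gt0.
have eK : K * e < r.
  have -> : K * e = r / 2 by rewrite /e; field; rewrite gt_eqF.
  lra.
have [g [Hg [_ g0g]]] := dH g0 g0SO _ (nbhsx_ballx g0 e e0).
exists g; split; first exact: HG.
apply/mxballE => i; rewrite -g0x !mxE -sumrB; apply: le_lt_trans eK.
apply: le_trans (ler_norm_sum _ _ _) _.
rewrite mulr_natl -[n.+1 in leRHS]card_ord -sumr_const; apply: ler_sum => j _.
rewrite -mulrBl normrM; apply: le_trans (_ : e * 1 <= _); last by rewrite mulr1.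
have /sphereE Sx1 := Sx.
apply: ler_pM => //; last by apply: coord_le1; rewrite Sx1.
by have := g0g i j => /ltW.
Qed.

Lemma svol_bigcup (I : finType) (A : I -> set V) :
  (forall i, vmeas (A i)) -> (forall i j, i != j -> negl (A i `&` A j)) ->
  svol (\bigcup_i A i) = \sum_i svol (A i).
Proof.
move=> mA nA.
have main (s : seq I) : uniq s ->
    svol [set x | exists2 i, i \in s & A i x] = \sum_(i <- s) svol (A i).
  elim: s => [_|i s IH /= /andP[is_ us]].
    by rewrite big_nil (_ : mkset _ = set0) ?svol_set0//; apply/seteqP;
      split => // x [].
  have mU : vmeas [set x | exists2 i, i \in s &
    A i x] by apply: vmeas_bigcup_seq => j _.
  rewrite big_cons -IH// -svolU//.
    congr svol; apply/seteqP; split => x.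
      by move=> [j]; rewrite inE => /predU1P[->|js] ?; [left|right; exists j].
    by move=> [?|[j js ?]]; [exists i; rewrite // mem_head|exists j;
      rewrite // inE js orbT].
  apply: svol_negl; first exact: vmeasI.
  have nij j : j \in s -> negl (A i `&` A j).
    by move=> js; apply: nA; apply: contraNneq is_ => ->.
  by apply: neglS (negl_bigcup_seq nij) => x _ [Ai [j js Aj]]; exists j.
rewrite -main ?index_enum_uniq//; congr svol; apply/seteqP;
  split => x [i _ Ax]; exists i => //.
Qed.

(** Choose the points greedily along the list. *)
Lemma spread_net (r : R) (s : seq V) : exists t : seq V, [/\ {subset t <= s},
  spread r t &
  0 < r -> forall x, x \in s -> exists2 y, y \in t & ball y r x].
Proof.
elim: s => [|x s [t [ts st tr]]]; first by exists [::]; split.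
have [[y yt yx]|no] := pselect (exists2 y, y \in t & ball y r x).
  exists t; split => //; first by move=> z /ts zs; rewrite inE zs orbT.
  by move=> r0 z; rewrite inE => /predU1P[->|/(tr r0)]; [exists y|].
exists (x :: t); split.
- by move=> z; rewrite inE => /predU1P[->|/ts zs]; rewrite inE ?eqxx// zs orbT.
- by split => // y yt yx; apply: no; exists y.
- move=> r0 z; rewrite inE => /predU1P[->|/(tr r0)[y yt yz]].
    by exists x; [exact: mem_head|exact: ballxx].
  by exists y; rewrite // inE yt orbT.
Qed.

Variable G : orth_subgroup R n.

Lemma grp_orthP g : grp G g -> orth g. Proof. exact: grp_orth. Qed.

Definition embeds (B X : polytope R n) :=
  exists m (A : 'I_m -> polytope R n) (g : 'I_m -> 'M[R]_n.+1),
  [/\ \bigcup_i (A i : set V) = B,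
      forall i j, i != j -> negl (A i `&` A j),
      forall i, grp G (g i) /\ mulmx (g i) @` A i `<=` X &
      forall i j, i != j -> negl (mulmx (g i) @` A i `&` mulmx (g j) @` A j)].

Hypothesis dG : forall x y r, S x -> S y -> 0 < r ->
  exists g, grp G g /\ ball y r (g *m x).

Lemma pack_small (de : R) : 0 < de -> exists2 e, 0 < e &
  forall B X : polytope R n, svol B <= e -> de <= svol X -> embeds B X.
Proof.
move=> de0; have [C C0 CP] := spread_volume R n.
have K0 : 0 < K by rewrite ltr0n.
pose C1 := 2 * (2 * K) ^+ n.
have C10 : 0 < C1 by rewrite mulr_gt0// exprn_gt0// mulr_gt0.
(* ratio between the radius of the caps that receive pieces and their mesh *)
pose L := 2 * K + 1; have L0 : 0 < L by rewrite addr_gt0// mulr_gt0.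
pose W := C1 * (4 * L) ^+ n.
have W0 : 0 < W by rewrite mulr_gt0// exprn_gt0// mulr_gt0.
pose e := de * C / (8 * W).
have e0 : 0 < e by rewrite divr_gt0// mulr_gt0.
exists e => // B X Be deX.
(* To control the volume near B, shrink its complement Rp instead of
   enlarging B. *)
have [Rp [RC CR _]] := apoly_rep (apolyC (apolyP B)).
have [r1 [UR [r10 mUR URv URP]]] := polytope_deflate Rp e0.
have de20 : 0 < de / 2 by rewrite divr_gt0.
have [r2 [UX [r20 mUX UXv UXP]]] := polytope_deflate X de20.
pose r := Num.min 1 (Num.min r1 (r2 / L)).
have r0 : 0 < r by rewrite !lt_min ltr01 r10 divr_gt0.
have r_1 : r <= 1 by rewrite ge_min lexx.
have r_r1 : r <= r1 by rewrite !ge_min lexx orbT.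
have Lr : L * r <= r2 by rewrite mulrC -ler_pdivlMr// !ge_min lexx !orbT.
have [m [A [AB AA Ar]]] := polytope_cut B r0.
have AS i : A i `<=` S by apply: polytope_sphere; exact: polytopeP.
have /choice[z zP] i : exists z, (A i !=set0) ->
  Defs.pset (A i) z /\ ~ Defs.pset Rp z.
  have [[w Aw]|] := pselect (A i !=set0); last by exists 0.
  have nAR : negl (A i `&` Rp).
    apply: neglS RC => x Sx [Ax Rx]; split => // nB; apply: nB; rewrite -AB.
    by exists i.
  have [v [Av _ nv]] := polytope_regular (polytopeP _) nAR Aw ltr01.
  by exists v => _; split => // Rv; apply: nv.
(* Points of the pieces, away from Rp; empty pieces have none. *)
pose zs := [seq z i | i <- enum 'I_m & `[< A i !=set0 >]].
have zsP x : x \in zs -> S x /\ ~ Defs.pset Rp x.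
  move=> /mapP[i]; rewrite mem_filter => /andP[/asboolP Ai _] ->.
  by have [Az nR] := zP i Ai; split => //; exact: AS Az.
have [xs [xzs sxs /(_ r0) xsP]] := spread_net r zs.
have xsv : (size xs)%:R * (C * (r / 2) ^+ n) <= 2 * e.
  have xsS x : x \in xs -> S x by move=> /xzs/zsP[].
  have xsR x y : x \in xs -> S y -> UR y -> ~ ball x (r / 2) y.
    move=> xs_x Sy /URP[_ yR] xy; have [Sx nR] := zsP x (xzs x xs_x).
    by apply: nR; apply: yR; split => //; apply: ball_sym; apply: le_ball xy;
      lra.
  have := CP r xs UR r0 r_1 sxs xsS mUR xsR.
  have : svol S <= svol Rp + svol B.
    rewrite -svolU; last first.
    - apply: svol_negl; first by apply: vmeasI; exact: vmeasP.
      by apply: neglS RC => x _ [Rx Bx]; split => // /(_ Bx).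
    - exact: vmeasP.
    - exact: vmeasP.
    have mSRB := vmeasI (@vmeas_sphere R n) (vmeasC (vmeasU (vmeasP Rp) (vmeasP
      B))).
    have nSRB : negl (S `\` (Rp `|` B)).
      apply: neglS CR => x _ [_ nRB]; split; first by move=> Bx; apply: nRB;
        right.
      by move=> Rx; apply: nRB; left.
    rewrite -[leRHS]addr0 -(svol_negl mSRB nSRB).
    apply: le_trans (svolU_le _ _) => //; last by apply: vmeasU; exact: vmeasP.
    apply: le_svol; first exact: vmeas_sphere.
      by apply: vmeasU => //; apply: vmeasU; exact: vmeasP.
    by move=> x [Sx _]; have [?|?] := pselect ((Rp `|` B : set V) x);
      [left|right].
  lra.
(* A piece around x_i lies within 2 r of it; its image lies within 2 K r of the
   image of x_i, which lies within r of y_i.  This is the radius s. *)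
pose s := L * r; have s0 : 0 < s by exact: mulr_gt0.
have [||ys [ysN sys ysP]] := @spread_exists R n UX (2 * s) (size xs) mUX.
- by rewrite mulr_ge0// ltW.
- apply: (@lt_le_trans _ _ (de / 2)); last by lra.
  have -> : (size xs)%:R * (C1 * (2 * s) ^+ n) = (size xs)%:R * (C * (r / 2) ^+
    n) * (W / C).
    have -> : 2 * s = 4 * L * (r / 2) by rewrite /s; field.
    by rewrite (exprMn n (4 * L)) /W; field; rewrite gt_eqF.
  (* the choice of e: N caps of radius 2 s have volume at most de / 4 *)
  apply: (@le_lt_trans _ _ (2 * e * (W / C))).
    by rewrite ler_pM2r// divr_gt0.
  have -> : 2 * e * (W / C) = de / 4 by rewrite /e; field; rewrite !gt_eqF.
  lra.
have /choice[h hP] i : exists h, grp G h /\ ((i < size xs)%N ->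
  ball (nth 0 ys i) r (h *m nth 0 xs i)).
  have [ixs|ixs] := ltnP i (size xs); last by exists 1%:M; split => //;
    exact: grp1.
  have [||h [Gh hb]] := @dG (nth 0 xs i) (nth 0 ys i) r _ _ r0.
  - by have [] := zsP _ (xzs _ (mem_nth 0 ixs)).
  - by rewrite -ysN in ixs; have [] := ysP _ (mem_nth 0 ixs).
  - by exists h.
have /choice[ix ixP] : forall k, exists i : nat, A k !=set0 ->
    (i < size xs)%N /\ ball (nth 0 xs i) r (z k).
  move=> k; have [Ak|] := pselect (A k !=set0); last by exists 0%N.
  have [|x xxs xz] := xsP (z k).
    by apply: map_f; rewrite mem_filter mem_enum andbT; exact/asboolP.
  exists (index x xs) => _; rewrite index_mem; split => //.
  by rewrite nth_index.
have imA k w : Defs.pset (A k) w ->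
  (ix k < size xs)%N /\ cap (nth 0 ys (ix k)) s (h (ix k) *m w).
  move=> Aw; have Ak : A k !=set0 by exists w.
  have [ik xz] := ixP k Ak; split => //; split.
    by apply: sphere_orth; [exact/grp_orthP/(hP _).1|exact: AS Aw].
  have -> : s = r + K * (r + r) by rewrite /s /L; ring.
  apply: ball_triangle; first exact: (hP _).2.
  apply: orth_ball; first exact/grp_orthP/(hP _).1.
  apply: ball_triangle xz _; apply: Ar Aw.
  by have [] := zP k Ak.
exists m, A, (h \o ix); split => //.
  move=> k; split; first exact: (hP _).1.
  move=> _ [w Aw <-]; have [ik wc] := imA k w Aw.
  have yx : nth 0 ys (ix k) \in ys by apply: mem_nth; rewrite ysN.
  by have [_ yX] := UXP _ (ysP _ yx).2; apply: yX; apply: le_cap wc.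
move=> i j ij /=; have [<-|ixij] := eqVneq (ix i) (ix j).
  have := negl_image (grp_orthP (hP (ix i)).1) (AA i j ij).
  apply: neglS => _ _ [[w Aw <-] [v Av vw]]; exists w => //; split => //.
  by rewrite -(can_inj (orthK (grp_orthP (hP (ix i)).1)) vw).
apply: neglS (negl0 R n) => _ _ [[w Aw <-] [v Av vw]].
have [ii [_ yi]] := imA i w Aw; have [jj [_ yj]] := imA j v Av.
rewrite -ysN in ii jj; case: (spread_nth (x0 := 0) sys ii jj ixij).
rewrite mulr_natl mulr2n; apply: ball_triangle yi _; apply: ball_sym.
by rewrite -vw.
Qed.

End packing.

(** * Packing families of polytopes *)

Section pack_families.
Variables (R : realType) (n : nat).
Local Notation V := 'cV[R]_n.+1.
Local Notation S := (sphere (R := R) (n := n)).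
Implicit Types (x y z : V) (P Q : polytope R n) (g M : 'M[R]_n.+1).
Variable G : orth_subgroup R n.

(** The polytopes [X j], what the images leave of the [Q j], are part of the
data: they receive the next piece and form the complement asked for by axiom
(E). *)
Definition packing (I J : finType) (B : I -> polytope R n)
    (Q : J -> polytope R n) (s : seq I) := exists (K : finType) (p : K -> I) (q : K -> J)
    (A : K -> polytope R n) (g : K -> 'M[R]_n.+1) (X : J -> polytope R n),
  [/\ forall k, p k \in s /\ A k `<=` B (p k),
      forall i x, i \in s -> Defs.pset (B i) x ->
        exists2 k, p k = i & Defs.pset (A k) x &
      forall k l, k != l -> p k = p l -> negl (A k `&` A l)] /\
  [/\ forall k, grp G (g k) /\ mulmx (g k) @` A k `<=` Q (q k),
      forall k l, k != l -> q k = q l ->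
        negl (mulmx (g k) @` A k `&` mulmx (g l) @` A l),
      forall j, X j `<=` Q j /\ (forall x, Defs.pset (Q j) x ->
        ~ Defs.pset (X j) x ->
         exists2 k, q k = j & (mulmx (g k) @` A k) x),
      forall k, negl (X (q k) `&` mulmx (g k) @` A k) &
      \sum_j svol (Q j) <= \sum_j svol (X j) + \sum_(i <- s) svol (B i)].

(** Place the polytopes [B i] one after the other. The volume left in the [Q j]
stays above [de * #|J|], so one of the remainders [X j] has volume at least
[de] and the next polytope embeds in it. *)
Lemma packing_exists (I J : finType) (B : I -> polytope R n)
    (Q : J -> polytope R n) (de e : R) (s : seq I) :
  (forall C X : polytope R n, svol C <= e -> de <= svol X -> embeds G C X) ->
  (forall i, svol (B i) <= e) -> uniq s ->
  de * #|J|%:R + \sum_(i <- s) svol (B i) < \sum_j svol (Q j) ->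
  packing B Q s.
Proof.
move=> small Be; elim: s => [_ _|i s IH /= /andP[is_ us]].
  exists void, (of_void I), (of_void J), (of_void _), (of_void _), Q.
  split; split => //; try by case.
    by move=> j; split.
  by rewrite big_nil addr0.
rewrite big_cons => lt_QB.
have [|K [p [q [A [g [X [[pA pB pn] [qA qn XQ Xn Xv]]]]]]]] := IH us.
  by apply: le_lt_trans lt_QB; rewrite lerD2l lerDr svol_ge0.
have [j Xj] : exists j, de <= svol (X j).
  apply: contrapT => no.
  have : \sum_j svol (X j) <= de * #|J|%:R.
    rewrite mulr_natr -sumr_const; apply: ler_sum => j _; rewrite leNgt;
      apply/negP => /ltW h.
    by apply: no; exists j.
  have := svol_ge0 (B i); lra.
have [m [A' [g' [A'B A'n gX gn]]]] := small (B i) (X j) (Be i) Xj.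
have orthg' k : orth (g' k) by exact: grp_orth (gX k).1.
have mim k : vmeas (mulmx (g' k) @` A' k) by apply: vmeas_image => //;
  exact: vmeasP.
pose U := \bigcup_k (mulmx (g' k) @` A' k).
have aU : apoly (X j `\` U).
  apply: apolyD; first exact: apolyP.
  rewrite (_ : U = [set x | exists2 k, k \in enum 'I_m &
    (mulmx (g' k) @` A' k) x]).
    apply: apoly_bigcup => k _; apply: apoly_polytope;
      apply: is_polytope_image => //.
    exact: polytopeP.
  by apply/seteqP; split => x [k _ ?]; exists k; rewrite ?mem_enum.
have [Y [YX XY Yc]] := apoly_rep aU.
have YXj : Y `<=` X j by apply: Yc => [|x _ []//]; exact: pclosedP.
have Uv : svol U = svol (B i).
  rewrite svol_bigcup// -A'B svol_bigcup//; last by move=> k; exact: vmeasP.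
  by apply: eq_bigr => k _; rewrite svol_image//; exact: vmeasP.
have mU : vmeas U.
  rewrite /vmeas (_ : mkset _ = \bigcup_(k in [set: 'I_m]) [set t | (mulmx (g'
    k) @` A' k) (tcol t)])//.
  by apply: fin_bigcup_measurable => // k _; exact: mim.
have Xsub : X j `<=` Y `|` U.
  apply: polytope_sub; first exact: polytopeP.
    have -> : Y `|` U = \bigcup_(b : bool) (if b then (Y : set V) else U).
      apply/seteqP; split => x; first by move=> [?|?];
        [exists true|exists false].
      by move=> [[] _ ?]; [left|right].
    apply: pclosed_bigcup => -[]; first exact: pclosedP.
    apply: pclosed_bigcup => k; apply: pclosed_polytope;
      apply: is_polytope_image => //.
    exact: polytopeP.
  apply: neglS XY => x _ [Xx nYU]; split; last by move=> Yx; apply: nYU; left.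
  by split => // Ux; apply: nYU; right.
exists (K + 'I_m)%type, (fun k => match k with inl k => p k | inr _ => i end),
  (fun k => match k with inl k => q k | inr _ => j end),
  (fun k => match k with inl k => A k | inr k => A' k end),
  (fun k => match k with inl k => g k | inr k => g' k end),
  (fun l => if l == j then Y else X l).
split; split.
- move=> [k|k]; first by have [ps AB] := pA k; rewrite inE ps orbT.
  by rewrite mem_head; split => // x Ax; rewrite -A'B; exists k.
- move=> l x; rewrite inE => /predU1P[->|ls] Bx.
    by move: Bx; rewrite -A'B => -[k _ Ax]; exists (inr k).
  by have [k kl Ax] := pB l x ls Bx; exists (inl k).
- move=> [k|k] [l|l] kl.
  + by apply: pn; apply: contraNneq kl => ->.
  + by move=> pk; move: is_; rewrite -pk (pA k).1.
  + by move=> pl; move: is_; rewrite pl (pA l).1.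
  + by move=> _; apply: A'n; apply: contraNneq kl => ->.
- move=> [k|k]; first exact: qA.
  by have [? gk] := gX k; split => // x /gk; exact: (XQ j).1.
- move=> [k|k] [l|l] kl.
  + by apply: qn; apply: contraNneq kl => ->.
  + by move=> qk; apply: neglS (Xn k) => x _ [? ?]; split => //; rewrite qk;
      exact: (gX l).2.
  + by move=> ql; apply: neglS (Xn l) => x _ [? ?]; split => //; rewrite -ql;
      exact: (gX k).2.
  + by move=> _; apply: gn; apply: contraNneq kl => ->.
- move=> l; case: eqP => [->|_]; last first.
    split; first exact: (XQ l).1.
    by move=> x Qx nX; have [k] := (XQ l).2 x Qx nX; exists (inl k).
  split; first exact: subset_trans YXj (XQ j).1.
  move=> x Qx nY; have [Xx|nX] := pselect (Defs.pset (X j) x).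
    by have [//|[k _ kx]] := Xsub x Xx; exists (inr k).
  by have [k] := (XQ j).2 x Qx nX; exists (inl k).
- move=> [k|k].
    case: eqP => [qk|_]; last exact: Xn.
    by apply: neglS (Xn k) => x _ [? ?]; split => //; rewrite qk; exact: YXj.
  rewrite eqxx; apply: neglS YX => x _ [Yx kx]; split => // -[_]; apply.
  by exists k.
- rewrite big_cons; apply: le_trans Xv _.
  rewrite addrA lerD2r (bigD1 j)//= [X in _ <= X + _](bigD1 j)//= eqxx.
  rewrite -addrA [X in _ <= _ + X]addrC addrA.
  rewrite [X in _ <= _ + X](eq_bigr (fun l => svol (X l)));
    last by move=> l /negbTE ->.
  rewrite lerD2r -Uv; apply: le_trans (svolU_le (vmeasP Y) mU).
  apply: le_svol => //; first exact: vmeasP.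
    by apply: vmeasU => //; exact: vmeasP.
  by move=> x [Xx _]; exact: Xsub.
Qed.

End pack_families.

(** * The assembler structure *)

Section sphere_assembler.
Variables (R : realType) (n : nat).
Local Notation V := 'cV[R]_n.+1.
Local Notation S := (sphere (R := R) (n := n)).
Variable G : orth_subgroup R n.
Implicit Types (x y z : V) (P Q T : polytope R n) (g M : 'M[R]_n.+1).
Local Notation hom := (sphere_hom G).

(** With the identity as default value at the empty polytope, every morphism
acts by a matrix of [G]. *)
Definition act P Q (f : hom P Q) : 'M[R]_n.+1 := odflt 1%:M (sval f).

Lemma act_grp P Q (f : hom P Q) : grp G (act f).
Proof.
case: f => o; rewrite /act/=; case: o => [g [] //|_]; exact: grp1.
Qed.

Lemma act_orth P Q (f : hom P Q) : orth (act f).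
Proof. exact/grp_orth/act_grp. Qed.

Lemma hom_imageE P Q (f : hom P Q) : hom_image f = mulmx (act f) @` P.
Proof.
rewrite /hom_image /act; case: f => o; rewrite /sval; case: o => [g|] //= P0.
by rewrite P0 image_set0.
Qed.

Lemma hom_image_sub P Q (f : hom P Q) : mulmx (act f) @` P `<=` Q.
Proof.
rewrite /act; case: f => o; rewrite /sval; case: o => [g []//|/= P0].
by rewrite P0 image_set0.
Qed.

(** Morphisms out of the empty polytope are unique, so the matrices need only
agree on a nonempty source. *)
Lemma hom_eq P Q (f h : hom P Q) : (P !=set0 -> act f = act h) -> f = h.
Proof.
case: f => o fP; case: h => o2 hP; rewrite /act/= => fh.
have oo : o = o2.
  case: o o2 fP hP fh => [g|] [g2|]//=.
  - by move=> [P0 _ _] _ /(_ P0) ->.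
  - by move=> [[x Px] _ _] P0 _; rewrite P0 in Px.
  - by move=> P0 [[x Px] _ _] _; rewrite P0 in Px.
by subst o2; congr (exist _ _ _); exact: Prop_irrelevance.
Qed.

Lemma act_comp P Q T (h : hom Q T) (f : hom P Q) : P !=set0 ->
  act (sphere_comp h f) = act h *m act f.
Proof.
case: f h => -[g|] fP [[h|] hP] //= P0; rewrite /act/= ?mulmx1//.
  case: fP => _ _ gPQ; have [x Px] := P0.
  have : Defs.pset Q (g *m x) by apply: gPQ; exists x.
  by rewrite (hP : Q = set0 :> set V).
by case: P0 => x; rewrite (fP : P = set0 :> set V).
Qed.

Lemma mkhom_subproof P Q g : grp G g -> mulmx g @` P `<=` Q ->
  hom_spec G P Q (if pselect (P = set0 :> set V) then None else Some g).
Proof.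
move=> Gg gPQ; case: pselect => //= P0; split => //.
exact/set0P/eqP.
Qed.

Definition mkhom P Q g (Gg : grp G g) (gPQ : mulmx g @` P `<=` Q) : hom P Q :=
  exist _ _ (mkhom_subproof Gg gPQ).

Lemma act_mkhom P Q g (Gg : grp G g) (gPQ : mulmx g @` P `<=` Q) :
  P !=set0 -> act (mkhom Gg gPQ) = g.
Proof.
by rewrite /act/=; case: pselect => //= -> [].
Qed.

Lemma hom_image_mkhom P Q g (Gg : grp G g) (gPQ : mulmx g @` P `<=` Q) :
  hom_image (mkhom Gg gPQ) = mulmx g @` P.
Proof.
have [P0|/set0P P0] := eqVneq (P : set V) set0.
  by rewrite hom_imageE P0 !image_set0.
by rewrite hom_imageE act_mkhom.
Qed.

Lemma hom_image_polytope P Q (f : hom P Q) : is_polytope (hom_image f).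
Proof.
by rewrite hom_imageE; apply: is_polytope_image;
  [exact: act_orth|exact: polytopeP].
Qed.

Lemma sub_image1 P Q : P `<=` Q -> mulmx 1%:M @` P `<=` Q.
Proof. by move=> PQ _ [x Px <-]; rewrite mul1mx; exact: PQ. Qed.

Definition inclusion P Q (PQ : P `<=` Q) : hom P Q :=
  mkhom (grp1 G) (sub_image1 PQ).

Lemma hom_image_inclusion P Q (PQ : P `<=` Q) : hom_image (inclusion PQ) = P.
Proof.
rewrite hom_image_mkhom; apply/seteqP; split => [_ [x Px <-]|x Px].
  by rewrite mul1mx.
by exists x; rewrite // mul1mx.
Qed.

Local Notation asm := (sphere_assembler G).

Lemma is_coverP (Q : asm) (I : finType) (P : I ->
  asm) (f : forall i, Defs.hom (P i) Q) :
  is_cover f <-> \bigcup_i hom_image (f i) = Q /\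
    forall i j, i != j -> negl (hom_image (f i) `&` hom_image (f j)).
Proof.
split=> -[cf df]; split => // i j.
  move=> /eqP/df/=; rewrite sinterior_disjoint//; exact: hom_image_polytope.
by move=> /eqP/df ?; apply/sinterior_disjoint => //; exact: hom_image_polytope.
Qed.

(** Morphisms are invertible matrices, so [h] factors through [f] as soon as
its image lies in that of [f]. *)
Lemma factor_through P Q T (h : hom T Q) (f : hom P Q) :
  hom_image h `<=` hom_image f -> exists u : hom T P, h = sphere_comp f u.
Proof.
rewrite !hom_imageE => hf.
have Gu : grp G (invmx (act f) *m act h) by apply: grpM;
  [exact/grpV/act_grp|exact: act_grp].
have uTP : mulmx (invmx (act f) *m act h) @` T `<=` P.
  move=> _ [x Tx <-]; have [|y Py yx] := hf (act h *m x); first by exists x.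
  by rewrite -mulmxA -yx mulKmx// orth_unit//; exact: act_orth.
exists (mkhom Gu uTP); apply: hom_eq => T0.
by rewrite act_comp// act_mkhom// mulKVmx// orth_unit//; exact: act_orth.
Qed.

Lemma hom_nonempty P Q (f : hom P Q) : P !=set0 -> Q !=set0.
Proof.
move=> [x Px]; exists (act f *m x); apply: (hom_image_sub (f := f)).
by exists x.
Qed.

Lemma act_idm P : act (sphere_idm G P) = 1%:M.
Proof. by rewrite /act /= /id_opt; case: pselect. Qed.

Lemma hom_image_comp P Q T (h : hom Q T) (f : hom P Q) :
  hom_image (sphere_comp h f) = mulmx (act h) @` hom_image f.
Proof.
have [P0|/set0P P0] := eqVneq (P : set V) set0.
  by rewrite !hom_imageE P0 !image_set0.
rewrite !hom_imageE act_comp//; apply/seteqP;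
  split => [_ [x Px <-]|_ [_ [x Px <-] <-]].
  by exists (act f *m x); [exists x|rewrite mulmxA].
by exists x; rewrite ?mulmxA.
Qed.

Lemma hom_image_idm P : hom_image (sphere_idm G P) = P.
Proof.
rewrite hom_imageE act_idm; apply/seteqP; split => [_ [x Px <-]|x Px].
  by rewrite mul1mx.
by exists x; rewrite // mul1mx.
Qed.

Lemma empty_hom P Q : (P : set V) = set0 -> exists f : hom P Q, forall h, f = h.
Proof.
move=> P0; have PQ : P `<=` Q by rewrite P0.
by exists (inclusion PQ) => h; apply: hom_eq; rewrite P0 => -[].
Qed.

Lemma is_initial_empty : is_initial (Defs.init asm).
Proof.
move=> Q; have [//|f fu] := @empty_hom (Polytope (@is_polytope0 R n)) Q.
by exists f.
Qed.

(** The intersection of two polytopes need not be a polytope, because of lower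
dimensional parts; those are negligible. *)
Lemma polytope_inter (X Y : set V) : is_polytope X -> is_polytope Y ->
  exists T : polytope R n, T `<=` X `&` Y /\ negl ((X `&` Y) `\` T).
Proof.
move=> pX pY; have [|T [_ XT Tc]] := @apoly_rep R n (X `&` Y).
  by apply: apolyI; exact: apoly_polytope.
exists T; split => //; apply: Tc => //.
by apply: pclosedI; exact: pclosed_polytope.
Qed.

(** The preimages under [h] of the images of the cover, intersected with
[P]. *)
Lemma sphere_stable (Q : asm) (C : sieve Q) : is_sieve C -> covering_sieve C ->
  forall (P : asm) (h : Defs.hom P Q), covering_sieve (pull_sieve h C).
Proof.
move=> sC [I [D [f [cf Cf]]]] P h; have oh := act_orth h.
pose E i := [set x | hom_image (f i) (act h *m x)].
have pE i : is_polytope (E i).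
  rewrite (_ : E i = mulmx (act h)^T @` hom_image (f i)); last first.
    by rewrite image_orth ?trmxK//; exact: orth_trmx.
  by apply: is_polytope_image; [exact: orth_trmx|exact: hom_image_polytope].
have /choice[T TP] i := polytope_inter (polytopeP (P : polytope R n)) (pE i).
have TsubP i : T i `<=` (P : polytope R n) by move=> x /(TP i).1[].
exists I, T, (fun i => inclusion (TsubP i)); split.
  rewrite /= (eq_bigcupr (fun i _ => hom_image_inclusion (TsubP i))).
  apply/seteqP; split => [x [i _ /TsubP]//|].
  apply: polytope_sub; first exact: polytopeP.
    by apply: pclosed_bigcup => i; exact: pclosedP.
  apply: neglS (negl_bigcup (fun i => (TP i).2)) => x _ [Px nTx].
  have : (\bigcup_i hom_image (f i)) (act h *m x).
    by rewrite cf; apply: (hom_image_sub (f := h)); exists x.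
  by move=> [i _ fx]; exists i => //; split => // Tx; apply: nTx; exists i.
move=> i; rewrite /pull_sieve.
have [|u uE] := @factor_through _ _ _ (sphere_comp h (inclusion (TsubP i))) (f
  i).
  rewrite hom_image_comp hom_image_inclusion => _ [x Tx <-].
  by have [] := (TP i).1 x Tx.
by have := sC _ _ (f i) u (Cf i); rewrite /= -uE.
Qed.

Lemma sphere_trans (Q : asm) (C C' : sieve Q) : is_sieve C -> is_sieve C' ->
  covering_sieve C ->
  (forall (P : asm) (f : Defs.hom P Q), C P f ->
    covering_sieve (pull_sieve f C')) ->
  covering_sieve C'.
Proof.
move=> _ _ [I [P [f [cf Cf]]]] CC'.
have H i : {K : finType & {T : K -> asm & {t : forall k, Defs.hom (T k) (P i) |
    covering t /\ forall k, C' (T k) (Defs.comp (f i) (t k))}}}.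
  have /cid[K /cid[T /cid[t tP]]] := CC' _ _ (Cf i).
  by exists K, T, t.
pose K i := projT1 (H i); pose T i := projT1 (projT2 (H i)).
pose t i := sval (projT2 (projT2 (H i))).
have tP i : covering (t i) /\ forall k, C' (T i k) (Defs.comp (f i) (t i k)).
  exact: (svalP (projT2 (projT2 (H i)))).
exists {i : I & K i}, (fun u => T (tag u) (tagged u)),
  (fun u => Defs.comp (f (tag u)) (t (tag u) (tagged u))); split; last first.
  by move=> u; exact: (tP _).2.
have imE i k : hom_image (sphere_comp (f i) (t i k)) = mulmx (act (f i)) @`
  hom_image (t i k).
  exact: hom_image_comp.
rewrite /= -[RHS]cf; apply/seteqP; split => x.
  move=> [[i k] _]; rewrite /= imE => -[y ty <-]; exists i => //.
  rewrite hom_imageE; exists y => //.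
  by have [<- _] := tP i; exists k.
move=> [i _]; rewrite hom_imageE => -[y Py <-].
have : (\bigcup_k hom_image (t i k)) y by rewrite (tP i).1.
by move=> [k _ ty]; exists (Tagged K k) => //=; rewrite imE; exists y.
Qed.

(** If the images meet in a negligible set, a common source of two commuting
maps has a negligible image, hence is empty. Otherwise a nonempty polytope in
the intersection maps to both sources, and would have to map to the empty
polytope. *)
Lemma sphere_disj (P P' Q : asm) (f : Defs.hom P Q) (g : Defs.hom P' Q) :
  disj f g <->
  exists (p : Defs.hom (Defs.init asm) P) (q : Defs.hom (Defs.init asm) P'),
    is_pullback f g p q.
Proof.
rewrite /= sinterior_disjoint; [|exact: hom_image_polytope..].
split=> [nfg|[p [q [_ pq]]]].
  have [//|p _] := @empty_hom (Polytope (@is_polytope0 R n)) P.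
  have [//|q _] := @empty_hom (Polytope (@is_polytope0 R n)) P'.
  exists p, q; split; first by apply: hom_eq => -[].
  move=> X a b ab; have X0 : (X : polytope R n) = set0 :> set V.
    apply: contrapT => /eqP/set0P X0.
    have im1 : hom_image (sphere_comp f a) `<=` hom_image f.
      by rewrite hom_image_comp (hom_imageE f); apply: image_subset;
        rewrite hom_imageE; exact: hom_image_sub.
    have im2 : hom_image (sphere_comp f a) `<=` hom_image g.
      have -> : sphere_comp f a = sphere_comp g b by [].
      by rewrite hom_image_comp (hom_imageE g); apply: image_subset;
        rewrite hom_imageE; exact: hom_image_sub.
    have [y Xy] := X0.
    have imy : hom_image (sphere_comp f a) (act (sphere_comp f a) *m y).
      by rewrite hom_imageE; exists y.
    apply: polytope_not_negl (hom_image_polytope _) imy _.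
    by apply: neglS nfg => x _ ix; split; [exact: im1|exact: im2].
  have [u uu] := @empty_hom X (Polytope (@is_polytope0 R n)) X0.
  exists u; split => [|u' _]; last exact: uu.
  by split; apply: hom_eq; rewrite X0 => -[].
apply: contrapT => nfg.
have [W [Wfg fgW]] := polytope_inter (hom_image_polytope f) (hom_image_polytope
  g).
have [W0|/set0P W0] := eqVneq (W : set V) set0.
  by apply: nfg; apply: neglS fgW => x _ fgx; split => //; rewrite W0.
have WQ : W `<=` (Q : polytope R n).
  by move=> x /Wfg[+ _]; rewrite hom_imageE; exact: hom_image_sub.
have [|a aE] := @factor_through _ _ _ (inclusion WQ) f.
  by rewrite hom_image_inclusion => x /Wfg[].
have [|b bE] := @factor_through _ _ _ (inclusion WQ) g.
  by rewrite hom_image_inclusion => x /Wfg[].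
have [|u _] := pq W a b; first by rewrite /= -aE -bE.
by have [] := hom_nonempty u W0.
Qed.

Lemma sphere_refine (Q : asm) (I J : finType) (P : I -> asm) (P' : J -> asm)
    (f : forall i, Defs.hom (P i) Q) (g : forall j, Defs.hom (P' j) Q) :
  is_cover f -> is_cover g ->
  exists (K : finType) (T : K -> asm) (h : forall k, Defs.hom (T k) Q),
    [/\ is_cover h, refines h f & refines h g].
Proof.
move=> /is_coverP[cf df] /is_coverP[cg dg].
have /choice[T TP] (u : I * J) :=
  polytope_inter (hom_image_polytope (f u.1)) (hom_image_polytope (g u.2)).
have TQ u : T u `<=` (Q : polytope R n).
  by move=> x /(TP u).1[+ _]; rewrite hom_imageE; exact: hom_image_sub.
exists (I * J)%type, T, (fun u => inclusion (TQ u)); split.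
- apply/is_coverP; rewrite (eq_bigcupr (fun u _ =>
    hom_image_inclusion (TQ u))); split.
    apply/seteqP; split => [x [u _ /TQ]//|].
    apply: polytope_sub; first exact: polytopeP.
      by apply: pclosed_bigcup => u; exact: pclosedP.
    apply: neglS (negl_bigcup (fun u => (TP u).2)) => x _ [Qx nTx].
    have : (\bigcup_i hom_image (f i)) x by rewrite cf.
    have : (\bigcup_j hom_image (g j)) x by rewrite cg.
    by move=> [j _ gx] [i _ fx]; exists (i, j) => //; split => // Tx;
      apply: nTx; exists (i, j).
  move=> [i j] [i' j'] uv; rewrite !hom_image_inclusion.
  have [ii'|ii'] := eqVneq i i'.
    have jj' : j != j' by apply: contraNneq uv => ->; rewrite ii'.
    apply: neglS (dg _ _ jj') => x _ [/(TP _).1[_ ?] /(TP _).1[_ ?]].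
    by split.
  by apply: neglS (df _ _ ii') => x _ [/(TP _).1[? _] /(TP _).1[? _]].
- move=> u; exists u.1; have [|a aE] :=
    @factor_through _ _ _ (inclusion (TQ u)) (f u.1).
    by rewrite hom_image_inclusion => x /(TP u).1[].
  by exists a.
- move=> u; exists u.2; have [|a aE] :=
    @factor_through _ _ _ (inclusion (TQ u)) (g u.2).
    by rewrite hom_image_inclusion => x /(TP u).1[].
  by exists a.
Qed.

Lemma sphere_is_assembler : is_assembler asm.
Proof.
split.
- by move=> P Q f; apply: hom_eq => P0; rewrite act_comp// act_idm mul1mx.
- by move=> P Q f; apply: hom_eq => P0; rewrite act_comp// act_idm mulmx1.
- move=> P Q T X h g f; apply: hom_eq => P0; have Q0 := hom_nonempty f P0.
  by rewrite !act_comp// mulmxA.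
- move=> Q; exists unit, (fun=> Q), (fun=> idm Q); split => //=.
  rewrite (eq_bigcupr (fun _ _ => hom_image_idm Q)).
  by apply/seteqP; split => [x []//|x Qx]; exists tt.
- exact: sphere_stable.
- exact: sphere_trans.
- exact: is_initial_empty.
- by move=> P f; apply/seteqP; split => x [] // [].
- move=> P Q f T a b ab; apply: hom_eq => T0.
  have uf : act f \in unitmx by apply: orth_unit; exact: act_orth.
  have := congr1 (fun h => act (h : hom T Q)) ab; rewrite !act_comp//.
  by move=> /(congr1 (mulmx (invmx (act f)))); rewrite !mulKmx.
- exact: sphere_disj.
- exact: sphere_refine.
Qed.

End sphere_assembler.

(** * Spherical volume and the two axioms *)

Section spherical_volume.
Variables (R : realType) (n : nat).
Local Notation V := 'cV[R]_n.+1.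
Local Notation S := (sphere (R := R) (n := n)).
Variable G : orth_subgroup R n.
Implicit Types (x y z : V) (P Q T : polytope R n) (g M : 'M[R]_n.+1).
Local Notation asm := (sphere_assembler G).

Lemma cone_scone (A : set V) : A `<=` S -> cone A = scone A.
Proof.
move=> AS; apply/seteqP; split => x.
  move=> [t [y [t0 t1 Ay ->]]]; have /sphereE Sy := AS y Ay; split.
    rewrite dotZl dotZr Sy mulr1 mulr_gt0//=; nra.
  by rewrite to_sphereZ// to_sphere_id//; apply/sphereE.
move=> [/andP[x0 x1] Ax]; exists (Num.sqrt (dot x x)), (to_sphere x).
have s0 : 0 < Num.sqrt (dot x x) by rewrite sqrtr_gt0.
split => //; first by rewrite -sqrtr1 ler_sqrt.
by rewrite to_sphereE scalerA divff ?scale1r// gt_eqF.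
Qed.

Lemma sphere_volE P : sphere_vol P = n.+1%:R * svol P.
Proof.
rewrite /sphere_vol cone_scone; last by apply: polytope_sphere;
  exact: polytopeP.
by rewrite /svol /vleb lebTE.
Qed.

Lemma sphere_is_volume : @is_volume asm R (@sphere_vol R n).
Proof.
split=> [P|Q I P f /is_coverP[cf df]].
  by rewrite sphere_volE mulr_ge0// svol_ge0.
rewrite sphere_volE; under eq_bigr do rewrite sphere_volE.
rewrite -mulr_sumr; congr (_ * _).
have -> : (Q : polytope R n) = \bigcup_i hom_image (f i) :> set V by rewrite cf.
rewrite svol_bigcup//; last by move=> i;
  exact: vmeas_polytope (hom_image_polytope _).
by apply: eq_bigr => i _; rewrite hom_imageE svol_image//;
  [exact: act_orth|exact: vmeasP].
Qed.

Lemma hom_image_ecast P (J : Type) (Q : J -> polytope R n) (j k : J) (e : j = k)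
    (h : sphere_hom G P (Q j)) :
  hom_image (ecast k (sphere_hom G P (Q k)) e h) = hom_image h.
Proof. by case: _ / e. Qed.

Lemma hom_image_fiber (P Q : tup asm) (phi : idx P -> idx Q)
    (f : forall i, Defs.hom (P i) (Q (phi i))) j (i : {i : idx P | phi i == j})
      :
  hom_image (fiber f i) = hom_image (f (val i)).
Proof. exact: hom_image_ecast. Qed.

(** Avoids the transports along equalities of indices in the definition of
fibers. *)
Lemma tup_hom_of (P Q : tup asm) (phi : idx P -> idx Q)
    (f : forall i, Defs.hom (P i) (Q (phi i))) :
  (forall j x, Defs.pset (Q j) x -> exists2 i, phi i = j & hom_image (f i) x) ->
  (forall i k, i != k -> phi i = phi k ->
    negl (hom_image (f i) `&` hom_image (f k))) ->
  inhabited (tup_hom P Q).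
Proof.
move=> cf df; constructor; exists phi f => j; apply/is_coverP; split.
  apply/seteqP; split => x.
    move=> [i _ fx]; move: (fiber f i) fx => h; rewrite hom_imageE.
    exact: hom_image_sub.
  move=> /cf[i /eqP ij fx]; exists (exist _ i ij) => //.
  by rewrite hom_image_fiber.
move=> i k ik; rewrite !hom_image_fiber; apply: df.
  by apply: contraNneq ik => /val_inj ->.
by rewrite (eqP (valP i)) (eqP (valP k)).
Qed.

Lemma polytope_small_cut P (e : R) : (0 < n)%N -> 0 < e ->
  exists m (A : 'I_m -> polytope R n),
  [/\ \bigcup_i (A i : set V) = P,
      forall i j, i != j -> negl (A i `&` A j) &
      forall i, svol (A i) <= e].
Proof.
move=> n0 e0; pose C : R := 2 * (2 * n.+1%:R) ^+ n.
have C0 : 0 < C by rewrite mulr_gt0// exprn_gt0// mulr_gt0.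
pose r := Num.min 1 (e / C); have r0 : 0 < r by rewrite lt_min ltr01 divr_gt0.
have r1 : r <= 1 by rewrite ge_min lexx.
have re : C * r <= e by rewrite mulrC -ler_pdivlMr// ge_min lexx orbT.
have [m [A [AP An Ar]]] := polytope_cut P r0.
exists m, A; split => // i.
have [A0|/set0P[x Ax]] := eqVneq (A i : set V) set0;
  first by rewrite A0 svol_set0 ltW.
have Sx : S x by apply: polytope_sphere Ax; exact: polytopeP.
apply: (@le_trans _ _ (svol (cap x r))).
  apply: le_svol; [exact: vmeasP|exact: vmeas_cap|].
  by move=> y [Ay Sy]; split => //; exact: Ar Ax Ay.
apply: le_trans (svol_cap_le Sx (ltW r0)) _; apply: le_trans re.
by rewrite ler_pM2l// -[leRHS]expr1; apply: ler_wiXn2l => //; exact: ltW.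
Qed.

Lemma sphere_axiom_A : (0 < n)%N -> @axiom_A asm R (@sphere_vol R n).
Proof.
move=> n0 P P0 Q; pose e : R :=
  @tup_vol asm R (@sphere_vol R n) P / (2 * n.+1%:R).
have e0 : 0 < e by rewrite divr_gt0// mulr_gt0.
have H j : {m : nat & {A : 'I_m ->
  polytope R n | [/\ \bigcup_i (A i : set V) = Q j,
      forall i k, i != k -> negl (A i `&` A k) & forall i, svol (A i) <= e]}}.
  by have /cid[m /cid[A AP]] := polytope_small_cut (Q j : polytope R n) n0 e0;
    exists m, A.
pose m j := projT1 (H j); pose A j : 'I_(m j) ->
  polytope R n := sval (projT2 (H j)).
have AP j : [/\ \bigcup_i (A j i : set V) = (Q j : polytope R n),
      forall i k, i != k -> negl (A j i `&` A j k) &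
        forall i, svol (A j i) <= e].
  exact: (svalP (projT2 (H j))).
have AQ j i : A j i `<=` (Q j : polytope R n).
  by have [<- _ _] := AP j => x Ax; exists i.
exists {j : idx Q & 'I_(m j)}, (fun u =>
  @Tup asm unit (fun=> A (tag u) (tagged u))).
split; last first.
  move=> [j i]; rewrite /tup_vol /= (bigD1 tt)//= big1 ?addr0 => [|[]]//.
  rewrite sphere_volE; have [_ _ /(_ i)] := AP j;
    rewrite /e ler_pdivlMr ?mulr_gt0//.
  by rewrite mulrA mulrC (mulrC _ (svol _)).
pose PT := @tup_bigsqcup asm {j : idx Q & 'I_(m j)} (fun u =>
  @Tup asm unit (fun=> A (tag u) (tagged u))).
apply: (@tup_hom_of PT Q (fun v => tag (tag v)) (fun v =>
  inclusion G (@AQ (tag (tag v)) (tagged (tag v))))).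
  move=> j x; have [<- _ _] := AP j; move=> [i _ Ax].
  exists (existT (fun=> unit) (existT (fun j =>
    'I_(m j) : Type) j i) tt : idx PT) => //.
  by rewrite hom_image_inclusion.
move=> [[j i] []] [[k l] []] /= uv jk; subst k.
rewrite !hom_image_inclusion/=; have [_ An _] := AP j; apply: An.
by apply: contraNneq uv => ->.
Qed.

Lemma sphere_axiom_E : (0 < n)%N -> contains_dense_SO G ->
  @axiom_E asm R (@sphere_vol R n).
Proof.
move=> n0 hG P Q; rewrite /tup_vol.
under eq_bigr do rewrite sphere_volE.
under [X in _ < X]eq_bigr do rewrite sphere_volE.
rewrite -!mulr_sumr ltr_pM2l// => PQ.
pose de := (\sum_i svol (Q i : polytope R n) - \sum_i svol (P i : polytope R
  n)) / (#|idx Q|.+1%:R).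
have de0 : 0 < de by rewrite divr_gt0// subr_gt0.
have [e e0 small] := pack_small (fun x y r Sx Sy r0 =>
  dense_transitive n0 hG Sx Sy r0) de0.
have H j : {m : nat & {A : 'I_m ->
  polytope R n | [/\ \bigcup_i (A i : set V) = P j,
      forall i k, i != k -> negl (A i `&` A k) & forall i, svol (A i) <= e]}}.
  by have /cid[m /cid[A AP]] := polytope_small_cut (P j : polytope R n) n0 e0;
    exists m, A.
pose m j := projT1 (H j); pose A j : 'I_(m j) ->
  polytope R n := sval (projT2 (H j)).
have AP j : [/\ \bigcup_i (A j i : set V) = (P j : polytope R n),
      forall i k, i != k -> negl (A j i `&` A j k) &
        forall i, svol (A j i) <= e].
  exact: (svalP (projT2 (H j))).
pose K0 : finType := {j : idx P & 'I_(m j)}.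
pose B (u : K0) := A (tag u) (tagged u).
have BP u : B u `<=` (P (tag u) : polytope R n).
  by have [<- _ _] := AP (tag u) => x Bx; exists (tagged u).
have sumB : \sum_(u <- index_enum K0) svol (B u) = \sum_i svol (P i : polytope
  R n).
  transitivity (\sum_j \sum_(i < m j) svol (A j i)).
    by rewrite (sig_big_dep xpredT (fun j => xpredT) (fun j i => svol (A j i))).
  apply: eq_bigr => j _; have [<- An _] := AP j.
  by rewrite svol_bigcup// => i; exact: vmeasP.
have [||L [p [q [D [g [X [[pD pB pn] [qD qn XQ Xn _]]]]]]]] :=
    @packing_exists R n G K0 (idx Q) B (fun j =>
      Q j : polytope R n) de e (index_enum K0) small _ (index_enum_uniq _) _.
- by move=> u; have [_ _] := AP (tag u); exact.
- rewrite sumB -ltrBrDr /de mulrAC ltr_pdivrMr// ltr_pM2l ?subr_gt0//.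
  by rewrite ltr_nat.
have DP k : D k `<=` (P (tag (p k)) : polytope R n).
  by apply: subset_trans (pD k).2 _; exact: BP.
have XQs j : X j `<=` (Q j : polytope R n) by exact: (XQ j).1.
exists (@Tup asm (idx Q) X).
pose T := @Tup asm (L + idx Q)%type (fun t => match t with inl k =>
  D k | inr j => X j end).
exists T; split.
- pose phi (t : idx T) : idx (tup_sqcup P (@Tup asm (idx Q) X)) :=
    match t with inl k => inl (tag (p k)) | inr j => inr j end.
  pose f (t : idx T) : Defs.hom (T t) (tup_sqcup P (@Tup asm (idx Q) X) (phi
    t)) :=
    match t with inl k => inclusion G (@DP k) | inr j => sphere_idm G (X j) end.
  apply: (@tup_hom_of T _ phi f).
    move=> [j|j] x /= jx.
      have [PE _ _] := AP j; move: jx; rewrite -PE => -[i _ Ax].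
      have [k pk Dx] := pB (Tagged (fun j =>
        'I_(m j)) i) x (mem_index_enum _) Ax.
      by exists (inl k); rewrite /= ?pk//; rewrite hom_image_inclusion.
    by exists (inr j); rewrite //= hom_image_idm.
  move=> [k|j] [l|j'] //= kl; last first.
    by move=> [jj]; rewrite jj eqxx in kl.
  move=> [pkl]; rewrite !hom_image_inclusion.
  have [pp|pp] := eqVneq (p k) (p l).
    by apply: pn pp; apply: contraNneq kl => ->.
  have: negl (B (p k) `&` B (p l)).
    move: pp pkl; case: (p k) => a i; case: (p l) => b i' /= pp ab; subst b.
    by have [_ An _] := AP a; apply: An; apply: contraNneq pp => /= ->.
  by apply: neglS => x _ [/(pD k).2 ? /(pD l).2 ?].
- pose phi (t : idx T) : idx Q := match t with inl k => q k | inr j => j end.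
  pose f (t : idx T) : Defs.hom (T t) (Q (phi t)) :=
    match t with inl k => mkhom (qD k).1 (qD k).2 | inr j =>
      inclusion G (@XQs j) end.
  apply: (@tup_hom_of T Q phi f).
    move=> j x Qx; have [Xx|nX] := pselect (Defs.pset (X j) x).
      by exists (inr j); rewrite //= hom_image_inclusion.
    have [k kj kx] := (XQ j).2 x Qx nX.
    by exists (inl k); rewrite //= hom_image_mkhom.
  move=> [k|j] [l|j'] /= kl.
  + by rewrite !hom_image_mkhom; apply: qn; apply: contraNneq kl => ->.
  + by move=> qk; rewrite hom_image_mkhom hom_image_inclusion setIC -qk;
      exact: Xn.
  + by move=> qk; rewrite hom_image_mkhom hom_image_inclusion qk; exact: Xn.
  + by move=> jj; rewrite jj eqxx in kl.
Qed.

End spherical_volume.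

Theorem theorem5p13 (R : realType) (n : nat) (hn : (0 < n)%N)
  (G : orth_subgroup R n) (hG : contains_dense_SO G) :
  @EA_assembler (sphere_assembler G) R (@sphere_vol R n).
Proof.
split.
- exact: sphere_is_assembler.
- exact: sphere_is_volume.
- exact: sphere_axiom_E.
- exact: sphere_axiom_A.
Qed.
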